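(* Let $\Theta_0\subseteq\mathbb{R}^d$ be open, let $\{P_\theta:\theta\in\Theta_0\}$ be a statistical model on $(\mathcal{X},\mathcal{A})$ that is Hellinger differentiable at every $\theta\in\Theta_0$, with Fisher information $\mathcal{I}(\theta)$, and let $\psi:\Theta_0\to\mathbb{R}^k$ be any (measurable) functional. Let $\phi:\mathbb{R}^d\to\mathbb{R}^k$ be absolutely continuous on $\Theta_0$ with almost-everywhere derivative $\nabla\phi$ (a $d\times k$ matrix). Let $\|\cdot\|$ be any norm on $\mathbb{R}^k$ with dual norm $\|\cdot\|_*$, and let $\mathcal{Q}^\dag$ be the set of probability measures on $\Theta_0$ that are nice with respect to $\phi$ and $\|\cdot\|$. Then $$\inf_T\sup_{\theta\in\Theta_0}\mathbb{E}_\theta\|T(X)-\psi(\theta)\|^2\ \ge\ \sup_{Q\in\mathcal{Q}^\dag}\left[\sup_{\|u\|_*\le 1}\|\Gamma_{Q,\phi}^{1/2}u\|_2-\left(\int_{\Theta_0}\|\psi(\theta)-\phi(\theta)\|^2\,dQ(\theta)\right)^{1/2}\right]_+^2,$$ where the infimum is over all measurable $T:\mathcal{X}\to\mathbb{R}^k$ and $$\Gamma_{Q,\phi}:=\left(\int_{\Theta_0}\nabla\phi(t)\,dQ(t)\right)^{\top}\left(\mathcal{I}(Q)+\int_{\Theta_0}\mathcal{I}(t)\,dQ(t)\right)^{-1}\left(\int_{\Theta_0}\nabla\phi(t)\,dQ(t)\right).$$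
   Context: All $P_\theta$ have densities $dP_\theta$ with respect to a common $\sigma$-finite measure $\nu$. $\mathbb{E}_\theta$ is expectation under $X\sim P_\theta$; $[x]_+=\max(x,0)$; $\|\cdot\|_2$ is the Euclidean norm. The bracket is read as $0$ if the last integral is infinite. Hellinger differentiability at $t$: there is a measurable $\dot\xi_t:\mathcal{X}\to\mathbb{R}^d$, square integrable with respect to $\nu$, with $\int[dP_{t+h}^{1/2}-dP_t^{1/2}-h^\top\dot\xi_t]^2\,d\nu=o(\|h\|_2^2)$ as $\|h\|_2\to0$. The Fisher information is $\mathcal{I}(t)=4\int\dot\xi_t\dot\xi_t^\top\,d\nu$. For $Q$ with absolutely continuous Lebesgue density $q$ and a.e. gradient $\nabla q$, $\mathcal{I}(Q)=\int \frac{\nabla q(t)\nabla q(t)^\top}{q(t)}\mathbf{1}\{q(t)>0\}\,dt$. A probability measure $Q$ on $\Theta_0$ is nice (with respect to $\phi$ and $\|\cdot\|$) if: (1) it has a Lebesgue density $q$ that is absolutely continuous, and $\mathcal{I}(Q)$ is positive definite; (2) $\|\phi\|$ and $\|\nabla\phi\|$ are $Q$-integrable and $\int_{\Theta_0}\mathrm{tr}(\mathcal{I}(t))\,dQ(t)<\infty$; (3) $q(\theta)\to0$ as $\theta$ approaches any boundary point of $\Theta_0$ with finite norm along some canonical (coordinate) direction. A function on an open set of $\mathbb{R}^d$ is called absolutely continuous if for every open ball $B(\theta,\delta)$ contained in the set and every unit vector $u$, $t\mapsto\omega(\theta+tu)$ is absolutely continuous on $0<t<\delta$ (componentwise for vector-valued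 functions). *)

(* Defs.v *)
From HB Require Import structures.
From mathcomp Require Import all_boot all_order all_algebra.
From mathcomp Require Import all_classical all_reals all_analysis.

Set Implicit Arguments.
Unset Strict Implicit.
Unset Printing Implicit Defensive.

Import Order.TTheory GRing.Theory Num.Theory.
Import numFieldNormedType.Exports.

Local Open Scope classical_set_scope.
Local Open Scope ring_scope.

(* The product sigma-algebra, generated by the coordinates (as the library does
   for [n.-tuple T]); on R^n it is the Borel sigma-algebra. *)
Definition mx_coord_sets (R : realType) (m n : nat) : set (set 'M[R]_(m, n)) :=
  [set A | exists i j B, measurable (B : set R) /\
                         A = (fun M : 'M[R]_(m, n) => M i j) @^-1` B].

Definition mx_display : measure_display. Proof. exact: default_measure_display. Qed.

Section mx_measurable.
Context (R : realType) (m n : nat).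

Let mx_measurable0 : <<s @mx_coord_sets R m n >> set0.
Proof. exact: sigma_algebra0. Qed.

Let mx_measurableC A :
  <<s @mx_coord_sets R m n >> A -> <<s @mx_coord_sets R m n >> (~` A).
Proof. exact: sigma_algebraC. Qed.

Let mx_measurable_bigcup (F : (set 'M[R]_(m, n))^nat) :
  (forall i, <<s @mx_coord_sets R m n >> (F i)) ->
  <<s @mx_coord_sets R m n >> (\bigcup_i F i).
Proof. exact: sigma_algebra_bigcup. Qed.

HB.instance Definition _ := @isMeasurable.Build mx_display 'M[R]_(m, n)
  <<s @mx_coord_sets R m n >> mx_measurable0 mx_measurableC mx_measurable_bigcup.

End mx_measurable.

Lemma measurable_mx_coord (R : realType) m n (i : 'I_m) (j : 'I_n) :
  measurable_fun [set: 'M[R]_(m, n)] (fun M => M i j).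
Proof.
move=> _ B mB; rewrite setTI; apply: sub_sigma_algebra.
by exists i, j, B.
Qed.

Lemma measurable_fun_mxP (R : realType) d (T : measurableType d) m n
    (f : T -> 'M[R]_(m, n)) :
  (forall i j, measurable_fun setT (fun t => f t i j)) -> measurable_fun setT f.
Proof.
move=> mf; apply: (@measurability _ _ _ _ _ _ (@mx_coord_sets R m n)) => //.
move=> _ [_ [i [j [B [mB ->]]]] <-].
by rewrite -comp_preimage; exact: mf.
Qed.

Section lebesgue_step.
Context (R : realType) (n : nat).
Variable mu : {sigma_finite_measure set 'cV[R]_n -> \bar R}.

Definition cons_cV (p : measurableTypeR R * 'cV[R]_n) : 'cV[R]_n.+1 :=
  \col_i if unlift ord0 i is Some j then p.2 j ord0 else p.1.

Definition uncons_cV (v : 'cV[R]_n.+1) : measurableTypeR R * 'cV[R]_n :=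
  (v ord0 ord0, \col_i v (lift ord0 i) ord0).

Lemma cons_cVK : cancel cons_cV uncons_cV.
Proof.
move=> [x v]; rewrite /uncons_cV !mxE unlift_none; congr pair.
by apply/colP => i; rewrite !mxE liftK.
Qed.

Lemma measurable_cons_cV : measurable_fun setT cons_cV.
Proof.
apply: measurable_fun_mxP => i j; rewrite ord1.
case: (unliftP ord0 i) => [k ->|->].
- under eq_fun do rewrite mxE liftK.
  exact: measurableT_comp (measurable_mx_coord _ _) measurable_snd.
- under eq_fun do rewrite mxE unlift_none.
  exact: measurable_fst.
Qed.

Lemma measurable_uncons_cV : measurable_fun setT uncons_cV.
Proof.
apply/measurable_fun_pairP; split; first exact: measurable_mx_coord.
apply: measurable_fun_mxP => i j; rewrite /comp/=.
under eq_fun do rewrite mxE.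
exact: measurable_mx_coord.
Qed.

Definition lebesgue_step : set 'cV[R]_n.+1 -> \bar R :=
  pushforward (lebesgue_measure \x mu)%E cons_cV.

Let lebesgue_step0 : lebesgue_step set0 = 0%E.
Proof. by rewrite /lebesgue_step /pushforward preimage_set0 measure0. Qed.

Let lebesgue_step_ge0 A : (0 <= lebesgue_step A)%E.
Proof. by rewrite /lebesgue_step /pushforward measure_ge0. Qed.

Let lebesgue_step_sigma_additive : semi_sigma_additive lebesgue_step.
Proof.
have mc B : measurable B -> measurable (cons_cV @^-1` B).
  by move=> mB; rewrite -[X in measurable X]setTI; exact: measurable_cons_cV.
move=> F mF tF mUF; rewrite /lebesgue_step /pushforward preimage_bigcup.
apply: measure_semi_sigma_additive.
- by move=> k; exact: mc.
- apply/trivIsetP => /= i j _ _ ij; rewrite -preimage_setI.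
  by move/trivIsetP : tF => /(_ _ _ _ _ ij) ->//; rewrite preimage_set0.
- by rewrite -preimage_bigcup; exact: mc.
Qed.

HB.instance Definition _ := isMeasure.Build _ _ _ lebesgue_step
  lebesgue_step0 lebesgue_step_ge0 lebesgue_step_sigma_additive.

Let lebesgue_step_sigma_finite : sigma_finite setT lebesgue_step.
Proof.
have /sigma_finiteP[F [TF ndF Foo]] := sigma_finiteT (@lebesgue_measure R).
have /sigma_finiteP[G [TG ndG Goo]] := sigma_finiteT mu.
exists (fun k => uncons_cV @^-1` (F k `*` G k)).
  apply/esym; rewrite -subTset => v _; set p := uncons_cV v.
  have [a _ Fa] : (\bigcup_k F k) p.1 by rewrite -TF.
  have [b _ Gb] : (\bigcup_k G k) p.2 by rewrite -TG.
  exists (maxn a b) => //; split => /=.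
    by move: Fa; exact/subsetPset/ndF/leq_maxl.
  by move: Gb; exact/subsetPset/ndG/leq_maxr.
move=> k; have [mF Fk] := Foo k; have [mG Gk] := Goo k; split.
  rewrite -[X in measurable X]setTI; apply: measurable_uncons_cV => //.
  exact: measurableX.
rewrite /lebesgue_step /pushforward -comp_preimage.
rewrite (_ : _ @^-1` _ = F k `*` G k); last first.
  by rewrite (_ : uncons_cV \o cons_cV = id)//; apply/funext => p; exact: cons_cVK.
by rewrite product_measure1E// lte_mul_pinfty// ge0_fin_numE.
Qed.

HB.instance Definition _ := Measure_isSigmaFinite.Build _ _ _ lebesgue_step
  lebesgue_step_sigma_finite.

End lebesgue_step.

Fixpoint lebesgue_cV (R : realType) (n : nat) :
    {sigma_finite_measure set 'cV[R]_n -> \bar R} :=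
  match n with
  | 0 => \d_(0 : 'cV[R]_0)
  | n'.+1 => lebesgue_step (lebesgue_cV R n')
  end.

Lemma lebesgue_cV_box (R : realType) (n : nat) (A : 'I_n -> set (measurableTypeR R)) :
  (forall i, measurable (A i)) ->
  lebesgue_cV R n [set v | forall i, A i (v i ord0)] =
  (\prod_(i < n) lebesgue_measure (A i))%E.
Proof.
elim: n A => [|n IH] A mA.
  rewrite big_ord0 /= diracE mem_set// => -[].
  by case.
rewrite big_ord_recl -IH//= /lebesgue_step /pushforward.
have mB : measurable [set v : 'cV[R]_n | forall i, A (lift ord0 i) (v i ord0)].
  rewrite [X in measurable X](_ : _ = \bigcap_(i in [set: 'I_n])
    ((fun v : 'cV[R]_n => v i ord0) @^-1` A (lift ord0 i))); last first.
    by apply/seteqP; split => [v /= Av i _|v /= Av i]; exact: Av.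
  apply: fin_bigcap_measurable => // i _.
  rewrite -[X in measurable X]setTI.
  exact: (@measurable_mx_coord R n 1 i ord0 measurableT _ (mA _)).
rewrite -product_measure1E//.
congr ((_ \x _)%E _); apply/seteqP; split => -[x v] /=.
- move=> H; split; first by have := H ord0; rewrite mxE unlift_none.
  by move=> i; have := H (lift ord0 i); rewrite mxE liftK.
- move=> [Ax Av] i; rewrite mxE.
  by case: unliftP => [j ->|->].
Qed.

Definition is_norm (R : realType) (k : nat) (N : 'cV[R]_k -> R) : Prop :=
  [/\ forall x y, N (x + y) <= N x + N y,
      forall a x, N (a *: x) = `|a| * N x &
      forall x, N x = 0 -> x = 0].

(* The library norm of ['cV[R]_n] is the sup norm, hence a separate name for
   the Euclidean one. *)
Definition l2norm (R : realType) (n : nat) (v : 'cV[R]_n) : R :=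
  Num.sqrt (\sum_i v i ord0 ^+ 2).

Definition dual_norm (R : realType) (k : nat) (N : 'cV[R]_k -> R)
    (u : 'cV[R]_k) : R :=
  sup [set (u^T *m x) ord0 ord0 | x in [set x | N x <= 1]].

(* Norm of a gradient [A], seen as the linear map [h |-> A^T h] from the
   Euclidean space R^d to (R^k, N). *)
Definition op_norm (R : realType) (d k : nat) (N : 'cV[R]_k -> R)
    (A : 'M[R]_(d, k)) : R :=
  sup [set N (A^T *m h) | h in [set h : 'cV[R]_d | l2norm h <= 1]].

Definition posdefmx (R : realType) (n : nat) (A : 'M[R]_n) : Prop :=
  A^T = A /\ forall v : 'cV[R]_n, v != 0 -> 0 < (v^T *m A *m v) ord0 ord0.

Definition possemidefmx (R : realType) (n : nat) (A : 'M[R]_n) : Prop :=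
  A^T = A /\ forall v : 'cV[R]_n, 0 <= (v^T *m A *m v) ord0 ord0.

(* The positive semidefinite square root (it is unique); 0 if [A] has none. *)
Definition sqrtmx (R : realType) (n : nat) (A : 'M[R]_n) : 'M[R]_n :=
  xget 0 [set S | possemidefmx S /\ S *m S = A].

Definition mx_integral dT (T : measurableType dT) (R : realType) (m n : nat)
    (mu : {measure set T -> \bar R}) (D : set T) (F : T -> 'M[R]_(m, n)) :
    'M[R]_(m, n) :=
  \matrix_(i, j) \int[mu]_(x in D) F x i j.

Definition abs_continuous_itv (R : realType) (a b : R) (f : R -> R) : Prop :=
  forall e : R, 0 < e -> exists2 r : R, 0 < r &
    forall (n : nat) (s t : 'I_n -> R),
      (forall i, [/\ a < s i, s i <= t i & t i < b]) ->
      trivIset [set: 'I_n] (fun i => `]s i, t i[%classic) ->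
      \sum_(i < n) (t i - s i) < r ->
      \sum_(i < n) `|f (t i) - f (s i)| < e.

Definition abs_continuous_on (R : realType) (d : nat) (D : set 'cV[R]_d)
    (f : 'cV[R]_d -> R) : Prop :=
  forall (c : 'cV[R]_d) (r : R), [set x | l2norm (x - c) < r] `<=` D ->
    forall u : 'cV[R]_d, l2norm u = 1 ->
      abs_continuous_itv 0 r (fun t => f (c + t *: u)).

(* The gradients below are made of the partial derivatives, which exist
   Lebesgue-almost everywhere for absolutely continuous functions; the junk
   value of ['D_v f t] elsewhere is irrelevant, as the gradients only occur
   under integrals with respect to measures dominated by Lebesgue measure. *)
Definition gradient (R : realType) (d : nat) (f : 'cV[R]_d -> R)
    (t : 'cV[R]_d) : 'cV[R]_d :=
  \col_i 'D_(delta_mx i ord0) f t.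

Definition vgradient (R : realType) (d k : nat) (f : 'cV[R]_d -> 'cV[R]_k)
    (t : 'cV[R]_d) : 'M[R]_(d, k) :=
  \matrix_(i, j) gradient (fun s => f s j ord0) t i ord0.

Section model.
Context (R : realType) (d k : nat) dX (X : measurableType dX).
Variable nu : {sigma_finite_measure set X -> \bar R}.

Definition is_density dT (T : measurableType dT)
    (mu : {measure set T -> \bar R}) (D : set T) (P : set T -> \bar R)
    (f : T -> R) : Prop :=
  [/\ measurable_fun D f, forall x, D x -> 0 <= f x &
      forall A, measurable A -> A `<=` D ->
        P A = (\int[mu]_(x in A) (f x)%:E)%E].

Definition hellinger_derivative (p : 'cV[R]_d -> X -> R) (t : 'cV[R]_d)
    (xi : X -> 'cV[R]_d) : Prop :=
  [/\ measurable_fun setT xi,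
      (\int[nu]_x (l2norm (xi x) ^+ 2)%:E < +oo)%E &
      (fun h : 'cV[R]_d =>
         (\int[nu]_x ((Num.sqrt (p (t + h) x) - Num.sqrt (p t x)
                       - (h^T *m xi x) ord0 ord0) ^+ 2)%:E
          * ((l2norm h ^+ 2)^-1)%:E)%E) @ (0 : 'cV[R]_d)^' --> (0 : \bar R)%E].

Definition fisher_info (xi : X -> 'cV[R]_d) : 'M[R]_d :=
  4 *: mx_integral nu setT (fun x => xi x *m (xi x)^T).

Definition minimax_risk (Theta0 : set 'cV[R]_d) (P : 'cV[R]_d -> probability X R)
    (psi : 'cV[R]_d -> 'cV[R]_k) (N : 'cV[R]_k -> R) : \bar R :=
  ereal_inf [set ereal_sup
      [set 'E_(P theta)[(fun x => N (T x - psi theta) ^+ 2)%R]%E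
        | theta in Theta0]
    | T in [set T : X -> 'cV[R]_k | measurable_fun setT T]].

End model.

Section van_trees.
Context (R : realType) (d k : nat).
Variables (Theta0 : set 'cV[R]_d) (info : 'cV[R]_d -> 'M[R]_d).
Variables (phi : 'cV[R]_d -> 'cV[R]_k) (N : 'cV[R]_k -> R).

Definition prior_info_integrand (q : 'cV[R]_d -> R) (t : 'cV[R]_d) : 'M[R]_d :=
  if 0 < q t then (q t)^-1 *: (gradient q t *m (gradient q t)^T) else 0.

Definition prior_info (q : 'cV[R]_d -> R) : 'M[R]_d :=
  mx_integral (lebesgue_cV R d) Theta0 (prior_info_integrand q).

(* The integrability clause on the information makes explicit that I(Q) is a
   finite matrix. In the last clause [b] ranges over the boundary of the open
   set [Theta0] and is approached, from within [Theta0], along the line through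
   [b] directed by the i-th canonical vector, for every i for which that is
   possible. *)
Record nice (Q : probability 'cV[R]_d R) (q : 'cV[R]_d -> R) : Prop := Nice {
  nice_supported : Q Theta0 = 1%E ;
  nice_density : is_density (lebesgue_cV R d) Theta0 Q q ;
  nice_abs_continuous : abs_continuous_on Theta0 q ;
  nice_info_integrable : forall i j, (lebesgue_cV R d).-integrable Theta0
    (fun t => (prior_info_integrand q t i j)%:E) ;
  nice_info_posdef : posdefmx (prior_info q) ;
  nice_phi_integrable : Q.-integrable Theta0 (fun t => (N (phi t))%:E) ;
  nice_gradient_integrable :
    Q.-integrable Theta0 (fun t => (op_norm N (vgradient phi t))%:E) ;
  nice_trace_integrable :
    (\int[Q]_(t in Theta0) (\tr (info t))%:E < +oo)%E ;
  nice_boundary : forall (b : 'cV[R]_d) (i : 'I_d),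
    (closure Theta0 `\` Theta0) b ->
    q (b + s *: delta_mx i ord0)
      @[s --> within [set s : R | Theta0 (b + s *: delta_mx i ord0)] (nbhs 0)]
      --> (0 : R)
}.

(* Gamma_{Q,phi}; under [nice] the matrix inverted is positive definite. *)
Definition van_trees_mx (Q : probability 'cV[R]_d R) (q : 'cV[R]_d -> R) :
    'M[R]_k :=
  let D := mx_integral Q Theta0 (vgradient phi) in
  D^T *m invmx (prior_info q + mx_integral Q Theta0 info) *m D.

(* When the last integral is +oo, the difference is -oo and the bound is 0. *)
Definition van_trees_bound (psi : 'cV[R]_d -> 'cV[R]_k)
    (Q : probability 'cV[R]_d R) (q : 'cV[R]_d -> R) : \bar R :=
  (maxe (ereal_sup [set (l2norm (sqrtmx (van_trees_mx Q q) *m u))%:E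
                     | u in [set u | (dual_norm N u <= 1)%R]]
         - sqrte (\int[Q]_(t in Theta0) (N (psi t - phi t) ^+ 2)%:E))
        0) ^+ 2.

End van_trees.

(* Main.v *)
Require Import Defs.
From HB Require Import structures.
From mathcomp Require Import all_boot all_order all_algebra.
From mathcomp Require Import all_classical all_reals all_analysis.
From mathcomp Require Import measurable_realfun.
From mathcomp Require Import ring lra.

Set Implicit Arguments.
Unset Strict Implicit.
Unset Printing Implicit Defensive.

Import Order.TTheory GRing.Theory Num.Theory.
Import numFieldNormedType.Exports.

Local Open Scope classical_set_scope.
Local Open Scope ring_scope.

Lemma measure_bigcup_finType d (T : measurableType d) (R : realType)
    (mu : {measure set T -> \bar R}) (I : finType) (F : I -> set T) :
  (forall i, measurable (F i)) -> trivIset [set: I] F ->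
  mu (\bigcup_i F i) = (\sum_i mu (F i))%E.
Proof.
move=> mF tF; have fI : finite_set [set: I] by exact: finite_finset.
rewrite measure_fin_bigcup// [RHS]fsbig_seq ?index_enum_uniq//.
apply: eq_fsbigl.
by apply/seteqP; split => i //= _; rewrite mem_index_enum.
Qed.

Section absolute_continuity.
Context {R : realType}.
Implicit Types (f g : R -> R) (a b x y z e r : R).

Definition nonoverlapping (I : finType) (s t : I -> R) : Prop :=
  (forall i, s i <= t i) /\
  forall i j, i != j -> t i <= s j \/ t j <= s i.

Definition abs_cont f : Prop := forall e, 0 < e -> exists2 r, 0 < r &
  forall (I : finType) (s t : I -> R), nonoverlapping s t ->
    \sum_i (t i - s i) < r -> \sum_i `|f (t i) - f (s i)| < e.

Definition clamp a b z : R := Num.max a (Num.min b z).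

Lemma clamp_homo a b : {homo clamp a b : y z / y <= z}.
Proof.
move=> y z yz; rewrite /clamp; apply: le_max2 => //; exact: le_min2.
Qed.

Lemma clamp_itv a b z : a <= b -> a <= clamp a b z <= b.
Proof. by move=> ab; rewrite /clamp le_max lexx ge_max ab ge_min lexx. Qed.

Lemma clamp_id a b z : a <= z <= b -> clamp a b z = z.
Proof. by move=> /andP[az zb]; rewrite /clamp (min_idPr zb) (max_idPr az). Qed.

Lemma clamp_left a b z : a <= b -> z <= a -> clamp a b z = a.
Proof.
by move=> ab za; rewrite /clamp (min_idPr (le_trans za ab)) (max_idPl za).
Qed.

Lemma clamp_right a b z : a <= b -> b <= z -> clamp a b z = b.
Proof. by move=> ab bz; rewrite /clamp (min_idPl bz) (max_idPr ab). Qed.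

Lemma clamp_lip a b y z : y <= z -> clamp a b z - clamp a b y <= z - y.
Proof.
move=> yz; rewrite /clamp.
rewrite /Num.max /Num.min.
by do !case: ifPn => //=; rewrite -?leNgt; lra.
Qed.

Lemma nonoverlapping_homo (I : finType) (s t : I -> R) (h : R -> R) :
  {homo h : y z / y <= z} -> nonoverlapping s t ->
  nonoverlapping (h \o s) (h \o t).
Proof.
move=> hh [st d]; split => [i|i j ij] /=; first exact: hh.
by case: (d i j ij) => ?; [left|right]; exact: hh.
Qed.

Lemma nonoverlapping_trivIset (I : finType) (s t : I -> R) :
  nonoverlapping s t -> trivIset [set: I] (fun i => `]s i, t i[%classic).
Proof.
move=> [st d]; apply/trivIsetP => i j _ _ ij.
apply/seteqP; split => // z [] /=; rewrite !in_itv/=.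
by move=> /andP[? ?] /andP[? ?]; case: (d i j ij) => ?; exfalso; lra.
Qed.

Lemma nonoverlapping_sum_le a b (I : finType) (s t : I -> R) : a <= b ->
  nonoverlapping s t -> (forall i, a <= s i /\ t i <= b) ->
  \sum_i (t i - s i) <= b - a.
Proof.
move=> ab no sab.
have no' := nonoverlapping_trivIset no.
have [st _] := no.
rewrite -lee_fin -sumEFin.
have -> : (b - a)%:E = lebesgue_measure `[a, b].
  by rewrite lebesgue_measure_itv/= lte_fin; case: ltP => // ba; congr (_%:E); lra.
under eq_bigr => i _.
  rewrite (_ : (t i - s i)%:E = lebesgue_measure `]s i, t i[); last first.
    rewrite lebesgue_measure_itv/= lte_fin; case: ltP => // ba; congr (_%:E).
    by have := st i; lra.
  over.
rewrite -measure_bigcup_finType//=.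
rewrite le_measure ?inE//=.
  by apply: fin_bigcup_measurable => //; exact: finite_finset.
move=> z [i _] /=; rewrite !in_itv /= => /andP[? ?].
by have [? ?] := sab i; apply/andP; split; lra.
Qed.

Lemma abs_cont_of_itv a b f x y : abs_continuous_itv a b f ->
  a < x -> x <= y -> y < b -> abs_cont (f \o clamp x y).
Proof.
move=> acf ax xy yb e /acf[r r0 H]; exists r => // I s t no str.
have [st _] := no.
pose s' (i : 'I_#|I|) := clamp x y (s (enum_val i)).
pose t' (i : 'I_#|I|) := clamp x y (t (enum_val i)).
rewrite (reindex (@enum_val I (fun=> true)))/=; last first.
  by apply: onW_bij; exact: enum_val_bij.
apply: (H _ s' t').
- move=> i; split.
  + by have /andP[] := clamp_itv (s (enum_val i)) xy; rewrite /s'; lra.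
  + exact: clamp_homo.
  + by have /andP[] := clamp_itv (t (enum_val i)) xy; rewrite /t'; lra.
- have /trivIsetP tr := nonoverlapping_trivIset
    (nonoverlapping_homo (@clamp_homo x y) no).
  apply/trivIsetP => i j _ _ ij; apply: tr => //.
  by apply: contra ij => /eqP/enum_val_inj ->.
- apply: le_lt_trans str.
  rewrite [leRHS](reindex (@enum_val I (fun=> true)))/=; last first.
    by apply: onW_bij; exact: enum_val_bij.
  by apply: ler_sum => i _; exact: clamp_lip.
Qed.

Lemma nonoverlapping_unit y z : y <= z ->
  nonoverlapping (fun _ : unit => y) (fun=> z).
Proof. by move=> yz; split => // -[] []. Qed.

Lemma abs_cont_cvg f : abs_cont f -> forall e, 0 < e -> exists2 r, 0 < r &
  forall y z, `|y - z| < r -> `|f y - f z| < e.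
Proof.
move=> acf e /acf[r r0 H]; exists r => // y z yz.
wlog : y z yz / z <= y.
  move=> W; case: (leP z y) => zy; first exact: W.
  by rewrite distrC; apply: W; [rewrite distrC|exact: ltW].
move=> zy; have /H := nonoverlapping_unit zy.
rewrite !big_const !card_unit/= !addr0; apply.
by apply: le_lt_trans yz; exact: ler_norm.
Qed.

Lemma abs_cont_continuous f : abs_cont f -> continuous f.
Proof.
move=> acf z; apply/cvgrPdist_lt => e /(abs_cont_cvg acf)[r r0 H].
near=> y; apply: H; near: y.
exact: cvgr_dist_lt.
Unshelve. all: by end_near. Qed.

End absolute_continuity.

Section variation.
Context {R : realType}.
Implicit Types (f g : R -> R) (a b x y z e r : R).

Definition variations f x y : set R := [set v |
  exists p : {I : finType & ((I -> R) * (I -> R))%type},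
  [/\ nonoverlapping (tagged p).1 (tagged p).2,
      forall i, x <= (tagged p).1 i /\ (tagged p).2 i <= y &
      v = \sum_i `|f ((tagged p).2 i) - f ((tagged p).1 i)|]].

Lemma variations0 f x y : variations f x y 0.
Proof.
exists (existT _ ('I_0 : finType) (fun=> 0, fun=> 0)).
by split => [|[]//|]; [split => -[]|rewrite big_ord0].
Qed.

Lemma variations_unit f x y : x <= y -> variations f x y `|f y - f x|.
Proof.
move=> xy; exists (existT _ (unit : finType) (fun=> x, fun=> y)) => /=.
by split => //; rewrite big_const card_unit/= addr0.
Qed.

Lemma variations_cat f x y z v w : x <= y -> y <= z ->
  variations f x y v -> variations f y z w -> variations f x z (v + w).
Proof.
move=> xy yz [[I [s t]]/= [[st no] sxy ->]] [[J [s' t']]/= [[st' no'] sxy' ->]].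
pose S (k : I + J) := match k with inl i => s i | inr j => s' j end.
pose T (k : I + J) := match k with inl i => t i | inr j => t' j end.
exists (existT _ ((I + J)%type : finType) (S, T)) => /=; split.
- split => [[]//|].
  move=> [i|j] [i'|j'] ij /=.
  + by apply: no; apply: contra ij => /eqP ->.
  + by left; have := sxy i; have := sxy' j'; lra.
  + by right; have := sxy i'; have := sxy' j; lra.
  + by apply: no'; apply: contra ij => /eqP ->.
- move=> [i|j] /=.
  + by have := sxy i; lra.
  + by have := sxy' j; lra.
- by rewrite big_sumType.
Qed.

Lemma variations_split f x y z v : x <= y -> y <= z ->
  variations f x z v ->
  exists v1 v2, [/\ variations f x y v1, variations f y z v2 & v <= v1 + v2].
Proof.
move=> xy yz [[I [s t]]/= [no sxz ->]].
have h1 : {homo Num.min y : u w / u <= w} by move=> u w uw; exact: le_min2.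
have h2 : {homo Num.max y : u w / u <= w} by move=> u w uw; exact: le_max2.
eexists; eexists; split.
- exists (existT _ I (Num.min y \o s, Num.min y \o t)); split; last reflexivity.
    exact: nonoverlapping_homo.
  by move=> i /=; rewrite le_min xy ge_min lexx; have [-> _] := sxz i.
- exists (existT _ I (Num.max y \o s, Num.max y \o t)); split; last reflexivity.
    exact: nonoverlapping_homo.
  by move=> i /=; rewrite ge_max yz le_max lexx; have [_ ->] := sxz i.
rewrite -big_split/=; apply: ler_sum => i _.
have [st _] := no; have := st i.
rewrite /Num.min /Num.max.
case: (ltP y (t i)) => ty; case: (ltP y (s i)) => sy st'.
- by rewrite subrr normr0; lra.
- by rewrite addrC (le_trans _ (ler_normD _ _))// subrKA.
- by exfalso; lra.
- by rewrite subrr normr0; lra.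
Qed.

Lemma variations_lt f e r : 
  (forall (I : finType) (s t : I -> R), nonoverlapping s t ->
    \sum_i (t i - s i) < r -> \sum_i `|f (t i) - f (s i)| < e) ->
  forall x y v, x <= y -> y - x < r -> variations f x y v -> v < e.
Proof.
move=> H x y v xy yxr [[I [s t]]/= [no sxy ->]]; apply: H => //.
exact: le_lt_trans (nonoverlapping_sum_le xy no sxy) yxr.
Qed.

Lemma variations_bounded f a b : abs_cont f -> a <= b ->
  exists M, forall v, variations f a b v -> v <= M.
Proof.
move=> /(_ _ ltr01)[r r0 H] ab.
have [n nr] : exists n : nat, b - a <= r / 2 * n%:R.
  exists (Num.bound ((b - a) / (r / 2))).
  rewrite mulrC -ler_pdivrMr; last lra.
  by apply/ltW/archi_boundP; rewrite divr_ge0//; lra.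
suff K k c : a <= c -> c - a <= r / 2 * k%:R ->
    forall v, variations f a c v -> v <= k%:R.
  by exists n%:R; apply: K.
elim: k c => [|k IH] c ac cak v vv.
  have ca : c = a by lra.
  case: vv => -[I [s t]]/= [[st no] sxy ->]; rewrite big1// => i _.
  have [? ?] := sxy i; have ? := st i.
  by rewrite (_ : s i = t i) ?subrr ?normr0//; lra.
pose x := Num.max a (c - r / 2).
have ax : a <= x by rewrite le_max lexx.
have xc : x <= c by rewrite ge_max ac; lra.
have [v1 [v2 [vv1 vv2 vle]]] := variations_split ax xc vv.
have cxr : c - x < r.
  have : c - r / 2 <= x by rewrite le_max lexx orbT.
  by lra.
have v21 := variations_lt H xc cxr vv2.
have v1k : v1 <= k%:R.
  apply: IH vv1 => //; move: cak; rewrite -(natr1 k) mulrDr mulr1 => cak.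
  have ? : 0 <= r / 2 * k%:R by rewrite mulr_ge0// divr_ge0// ltW.
  by rewrite lerBlDr ge_max; apply/andP; split; lra.
by rewrite -(natr1 k); lra.
Qed.

Definition variation_from f a z : R := sup (variations f a z).

Section variation_of_abs_cont.
Variables (f : R -> R) (a b : R).
Hypotheses (acf : abs_cont f) (ab : a <= b).

Let has_sup_variations y : a <= y -> y <= b -> has_sup (variations f a y).
Proof.
move=> ay yb; split; first by exists 0; exact: variations0.
have [M HM] := variations_bounded acf ab; exists M => v vv.
have := variations_cat ay yb vv (variations0 f y b); rewrite addr0; exact: HM.
Qed.

Lemma variation_increment y z v : a <= y -> y <= z -> z <= b ->
  variations f y z v -> variation_from f a y + v <= variation_from f a z.
Proof.
move=> ay yz zb vv; rewrite -lerBrDr; apply: ge_sup.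
  by exists 0; exact: variations0.
move=> w ww; rewrite lerBrDr; apply: ub_le_sup.
  by have [] := has_sup_variations (le_trans ay yz) zb.
exact: variations_cat ww vv.
Qed.

Lemma variation_approx y z e : 0 < e -> a <= y -> y <= z -> z <= b ->
  exists2 v, variations f y z v & variation_from f a z - variation_from f a y < v + e.
Proof.
move=> e0 ay yz zb.
have hs := has_sup_variations (le_trans ay yz) zb.
have [v vv ve] := sup_adherent e0 hs.
have [v1 [v2 [vv1 vv2 vle]]] := variations_split ay yz vv.
exists v2 => //.
have : v1 <= variation_from f a y.
  by apply: ub_le_sup => //; have [] := has_sup_variations ay (le_trans yz zb).
by rewrite /variation_from in ve *; lra.
Qed.

Lemma abs_cont_variation : abs_cont (variation_from f a \o clamp a b).
Proof.
move=> e e0; have e20 : 0 < e / 2 by lra.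
have [r r0 H] := acf e20; exists r => // I s t no str.
pose s' i := clamp a b (s i); pose t' i := clamp a b (t i).
have [st' no'] : nonoverlapping s' t' by exact: nonoverlapping_homo (@clamp_homo _ a b) no.
have st'r : \sum_i (t' i - s' i) < r.
  by apply: le_lt_trans str; apply: ler_sum => i _; apply: clamp_lip; case: no.
have as' i : a <= s' i by have /andP[] := clamp_itv (s i) ab.
have tb' i : t' i <= b by have /andP[] := clamp_itv (t i) ab.
pose eta := e / 2 / (#|I|.+1)%:R.
have eta0 : 0 < eta by rewrite divr_gt0.
have /choice[p Hp] : forall i, exists p : {J : finType & ((J -> R) * (J -> R))%type},
  [/\ nonoverlapping (tagged p).1 (tagged p).2,
      forall j, s' i <= (tagged p).1 j /\ (tagged p).2 j <= t' i &
      variation_from f a (t' i) - variation_from f a (s' i) <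
        \sum_j `|f ((tagged p).2 j) - f ((tagged p).1 j)| + eta].
  move=> i; have [v [p [p1 p2 ->]] p3] := variation_approx eta0 (as' i) (st' i) (tb' i).
  by exists p.
pose K : finType := {i : I & tag (p i)}.
pose S (k : K) := (tagged (p (tag k))).1 (tagged k).
pose T (k : K) := (tagged (p (tag k))).2 (tagged k).
have noK : nonoverlapping S T.
  split => [[i j]|]; first by have [[+ _] _ _] := Hp i; exact.
  move=> [i j] [i' j'] /=.
  have [ii'|ii'] := eqVneq i i'.
    move: j'; rewrite -ii' => j' jj'; have [[_ noi] _ _] := Hp i.
    by apply: (noi j j'); apply: contra jj' => /eqP ->.
  move=> _; rewrite /S/T/=.
  have [_ sp _] := Hp i; have [_ sp' _] := Hp i'.
  have := sp j; have := sp' j'.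
  by case: (no' _ _ ii') => ? [? ?] [? ?]; [left|right]; lra.
have lenK : \sum_k (T k - S k) < r.
  apply: le_lt_trans st'r.
  rewrite (_ : \sum_k _ = \sum_i \sum_j ((tagged (p i)).2 j - (tagged (p i)).1 j)); last first.
    by rewrite sig_big_dep.
  apply: ler_sum => i _; have [no'' sp _] := Hp i.
  exact: nonoverlapping_sum_le.
have := H _ _ _ noK lenK.
rewrite (_ : \sum_k _ = \sum_i \sum_j `|f ((tagged (p i)).2 j) - f ((tagged (p i)).1 j)|); last first.
  by rewrite sig_big_dep.
move=> He.
have : \sum_i (variation_from f a (t' i) - variation_from f a (s' i)) <=
  \sum_i (\sum_j `|f ((tagged (p i)).2 j) - f ((tagged (p i)).1 j)| + eta).
  by apply: ler_sum => i _; have [_ _ /ltW] := Hp i.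
have -> : \sum_i (\sum_j `|f ((tagged (p i)).2 j) - f ((tagged (p i)).1 j)| + eta) =
    \sum_i \sum_j `|f ((tagged (p i)).2 j) - f ((tagged (p i)).1 j)| + eta *+ #|I|.
  by rewrite big_split -sumr_const.
move=> He'.
have Heta : eta *+ #|I| <= e / 2.
  rewrite -mulr_natr /eta mulrAC ler_pdivrMr// ler_wpM2l//; first lra.
  by rewrite ler_nat.
apply: (@le_lt_trans _ _ (\sum_i (variation_from f a (t' i) - variation_from f a (s' i)))); last lra.
apply: ler_sum => i _ /=; rewrite ger0_norm// subr_ge0.
have := variation_increment (as' i) (st' i) (tb' i) (variations0 _ _ _).
by rewrite addr0.
Qed.
End variation_of_abs_cont.

End variation.

Section stieltjes.
Context {R : realType}.
Implicit Types (f g : R -> R) (a b x y z e r : R).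
Local Notation mu := (@lebesgue_measure R).

Lemma lebesgue_stieltjes_itv_oc (f : cumulative R R) x y : x <= y ->
  lebesgue_stieltjes_measure f `]x, y]%classic = (f y - f x)%:E.
Proof.
move=> xy; rewrite /lebesgue_stieltjes_measure/= /measure_extension/=.
rewrite measurable_mu_extE/=; last exact: is_ocitv.
by rewrite wlength_itv_bnd.
Qed.

Lemma stieltjes_dominates (f : cumulative R R) : abs_cont f ->
  lebesgue_stieltjes_measure f `<< mu.
Proof.
move=> acf; apply/null_content_dominatesP => A mA A0.
apply/eqP; rewrite eq_le measure_ge0 andbT.
apply/lee_addgt0Pr => e e0; rewrite add0e.
have [r r0 H] := acf e e0.
have /ereal_inf_lt[z [/= F [mF AF] <-{z} Fr]] : (mu A < r%:E)%E.
  by rewrite A0 lte_fin.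
have mF' k : measurable (F k : set (measurableTypeR R)).
  by apply: sub_sigma_algebra; exact: mF.
apply: (@le_trans _ _ (lebesgue_stieltjes_measure f (\bigcup_k F k))).
  apply: le_measure => //; rewrite inE//; exact: bigcup_measurable.
pose G n : set (measurableTypeR R) := \big[setU/set0]_(k < n.+1) F k.
have mG n : measurable (G n) by exact: bigsetU_measurable.
have UG : \bigcup_k F k = \bigcup_n G n.
  by rewrite /G bigcup_bigsetU_bigcup.
have ndG : nondecreasing_seq G.
  by move=> m n mn; exact/subsetPset/subset_bigsetU.
have cG := @nondecreasing_cvg_mu _ (measurableTypeR R) R
  (lebesgue_stieltjes_measure f) G mG (bigcup_measurable (fun n _ => mG n)) ndG.
rewrite UG -(cvg_lim _ cG)//; apply: lime_le.
  by apply/cvg_ex; eexists; exact: cG.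
apply: nearW => n /=.
have : (R.-ocitv.-ring).-measurable (G n : set (SetRing.type (ocitv_type R))).
  by apply: bigsetU_measurable => k _; apply: SetRing.measurable_subring; exact: mF.
move=> /SetRing.ring_finite_set[B [finB B0 tB mB GB]].
have [s0 sB] := (finite_seqP B).1 finB.
pose s := undup s0; pose X := 'I_(size s).
pose V (i : X) : set R := nth set0 s i.
have VB (i : X) : B (V i).
  by rewrite sB /= -mem_undup; exact: mem_nth.
have Vinj (i j : X) : V i = V j -> i = j.
  by move=> /eqP; rewrite nth_uniq ?ltn_ord ?undup_uniq// => /eqP/val_inj.
have /choice[st stE] : forall i : X, exists p : R * R,
    p.1 < p.2 /\ V i = `]p.1, p.2]%classic.
  move=> i; have /ocitvP[i0|[p]] : ocitv (V i).
    by apply: mB; rewrite inE; exact: VB.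
  + by have := B0 _ (VB i); rewrite i0 => -[].
  + by exists p.
have GX : G n = \bigcup_(i in [set: X]) V i.
  rewrite GB; apply/seteqP; split => z.
    move=> [Y]; rewrite sB /= -mem_undup => Ys Yz.
    have sY : (index Y s < size s)%N by rewrite index_mem.
    by exists (Ordinal sY) => //; rewrite /V /= nth_index.
  by move=> [i _ iz]; exists (V i) => //; exact: VB.
have tX : trivIset [set: X] (fun i => V i).
  by move=> i j _ _ ij0; apply: Vinj; exact: tB.
have no : nonoverlapping (fst \o st) (snd \o st).
  split => [i|i j ij] /=; first by have [/ltW] := stE i.
  have [sti Ei] := stE i; have [stj Ej] := stE j.
  have [?|l1] := leP (st i).2 (st j).1; first by left.
  have [?|l2] := leP (st j).2 (st i).1; first by right.
  exfalso; move/eqP: ij; apply; apply: tX => //.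
  exists (Num.min (st i).2 (st j).2); split; rewrite ?Ei ?Ej /= in_itv/=.
    by rewrite lt_min ge_min lexx sti l2.
  by rewrite lt_min ge_min lexx orbT stj l1.
rewrite GX measure_bigcup_finType//=; last first.
  by move=> i; rewrite (stE i).2; exact: measurable_itv.
under eq_bigr => i _ do rewrite (stE i).2 lebesgue_stieltjes_itv_oc ?(ltW (stE i).1)//.
rewrite sumEFin lee_fin.
apply: le_trans (ltW (H _ _ _ no _)).
  by apply: ler_sum => i _; exact: ler_norm.
rewrite /=.
rewrite -lte_fin -sumEFin.
under eq_bigr => i _ do rewrite -(lebesgue_stieltjes_itv_oc idfun (ltW (stE i).1)) -(stE i).2.
apply: le_lt_trans Fr.
have -> : (\sum_(i : X) lebesgue_stieltjes_measure idfun (V i : set (measurableTypeR R)))%E = mu (G n).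
  by rewrite GX measure_bigcup_finType//= => i; rewrite (stE i).2; exact: measurable_itv.
apply: (@le_trans _ _ (\sum_(k < n.+1) mu (F k))%E).
  by apply: Boole_inequality => i _; exact: mF'.
rewrite (eq_bigr (fun k : 'I_n.+1 => wlength idfun (F k))); last first.
  by move=> k _; rewrite /= /lebesgue_measure /lebesgue_stieltjes_measure /measure_extension/= measurable_mu_extE.
rewrite -(big_mkord xpredT (fun k => wlength idfun (F k))).
by apply: nneseries_lim_ge => k _ _; exact: measure_ge0.
Qed.
Definition is_integral_of f g : Prop := mu.-integrable setT (EFin \o g) /\
  forall x y, x <= y -> f y - f x = \int[mu]_(t in `]x, y]) g t.

Lemma nondecreasing_is_integral f a b : a <= b -> abs_cont f ->
  {homo f : x y / x <= y} -> (forall z, f z = f (clamp a b z)) ->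
  exists g, is_integral_of f g.
Proof.
move=> ab acf ndf fE.
have rcf : right_continuous f.
  by apply/right_continuousW => x; exact: (abs_cont_continuous acf).
pose F : cumulative R R := HB.pack f (isCumulative.Build R _ R f ndf rcf).
pose nu := lebesgue_stieltjes_measure F.
pose D : set (measurableTypeR R) := `]a, b]%classic.
have mD : measurable D by exact: measurable_itv.
have nuD : (nu D < +oo)%E by rewrite /nu lebesgue_stieltjes_itv_oc// ltry.
have dom : mfrestr mD nuD `<< mu.
  apply/null_content_dominatesP => A mA A0.
  have /null_content_dominatesP/(_ A mA A0) nuA := @stieltjes_dominates F acf.
  apply/eqP; rewrite eq_le measure_ge0 andbT.
  rewrite -[leRHS]nuA; apply: le_measure; rewrite ?inE//.
  exact: measurableI.
have [g [g0 gfin gint gE]] := radon_nikodym_sigma_finite dom.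
have gK : EFin \o (fine \o g) = g by apply/funext => x /=; rewrite fineK.
exists (fine \o g); split; first by rewrite gK.
move=> x y xy.
rewrite /Rintegral (_ : (\int[mu]_(t in `]x, y]) ((fine \o g) t)%:E)%E = \int[mu]_(t in `]x, y]) g t)%E; last first.
  by apply: eq_integral => t _ /=; rewrite fineK.
rewrite -gE; last exact: measurable_itv.
rewrite /= /mfrestr /mrestr.
rewrite (_ : _ `&` D = `]clamp a b x, clamp a b y]%classic); last first.
  apply/seteqP; split => z; rewrite /D /= !in_itv/= /clamp.
  - move=> [/andP[xz zy] /andP[az zb]]; rewrite gt_max az gt_min xz.
    by rewrite le_max le_min zb zy !orbT.
  - move=> /andP[]; rewrite gt_max gt_min le_max le_min.
    move=> /andP[az /orP bxz] /orP[za|/andP[zb zy]]; first by exfalso; lra.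
    by rewrite az zb zy !andbT; case: bxz => // bz; exfalso; lra.
rewrite /nu lebesgue_stieltjes_itv_oc//=; last exact: clamp_homo.
by rewrite -!fE.
Qed.

Lemma is_integral_ofB f1 f2 g1 g2 : is_integral_of f1 g1 -> is_integral_of f2 g2 ->
  is_integral_of (f1 \- f2) (g1 \- g2).
Proof.
move=> [i1 H1] [i2 H2]; split => [|x y xy].
  rewrite (_ : _ \o _ = (EFin \o g1) \- (EFin \o g2))%E; last first.
    by apply/funext => t /=; rewrite EFinB.
  exact: integrableB.
rewrite RintegralB//; last 2 first.
- exact: integrableS i1.
- exact: integrableS i2.
by rewrite -H1// -H2//=; lra.
Qed.

(** The Jordan decomposition [f = V - (V - f)] by the variation [V]. *)
Lemma abs_cont_is_integral f a b : a <= b -> abs_cont f ->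
  (forall z, f z = f (clamp a b z)) -> exists g, is_integral_of f g.
Proof.
move=> ab acf fE.
pose V := variation_from f a \o clamp a b.
have acV : abs_cont V by exact: abs_cont_variation.
have cE z : clamp a b (clamp a b z) = clamp a b z by rewrite clamp_id// clamp_itv.
have VE z : V z = V (clamp a b z) by rewrite /V /= cE.
have dV x y : x <= y -> `|f y - f x| <= V y - V x.
  move=> xy; rewrite (fE x) (fE y) lerBrDl.
  have /andP[ax _] := clamp_itv x ab; have /andP[_ yb] := clamp_itv y ab.
  have cxy : clamp a b x <= clamp a b y by exact: clamp_homo.
  by apply: (variation_increment acf ab) => //; exact: variations_unit.
have ndV : {homo V : x y / x <= y}.
  by move=> x y /dV; have := normr_ge0 (f y - f x); lra.
have acVf : abs_cont (V \- f).
  move=> e e0; have e20 : 0 < e / 2 by lra.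
  have [r1 r10 H1] := acV _ e20; have [r2 r20 H2] := acf _ e20.
  exists (Num.min r1 r2); first by rewrite lt_min r10.
  move=> I s t no; rewrite lt_min => /andP[l1 l2].
  have := H1 _ _ _ no l1; have := H2 _ _ _ no l2 => h1 h2.
  apply: (@le_lt_trans _ _ (\sum_i `|V (t i) - V (s i)| + \sum_i `|f (t i) - f (s i)|)); last lra.
  rewrite -big_split/=; apply: ler_sum => i _.
  have -> : (V \- f) (t i) - (V \- f) (s i) =
      (V (t i) - V (s i)) - (f (t i) - f (s i)) by rewrite /=; lra.
  exact: ler_normB.
have ndVf : {homo (V \- f) : x y / x <= y}.
  by move=> x y /dV /=; have := ler_norm (f y - f x); lra.
have [g1 g1P] := nondecreasing_is_integral ab acV ndV VE.
have VfE z : (V \- f) z = (V \- f) (clamp a b z) by rewrite /= -VE -fE.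
have [g2 g2P] := nondecreasing_is_integral ab acVf ndVf VfE.
exists (g1 \- g2).
have := is_integral_ofB g1P g2P.
by rewrite (_ : V \- (V \- f) = f)//; apply/funext => z /=; lra.
Qed.

Lemma is_integral_of_derive f g : is_integral_of f g ->
  {ae mu, forall x, is_derive x (1 : R) f (g x)}.
Proof.
move=> [ig fg].
have iS (y : R) : mu.-integrable `]-oo, y]%classic (EFin \o g) by exact: integrableS ig.
have lg : locally_integrable setT g by apply: open_integrable_locally => //; exact: openT.
pose F (x : R) := \int[mu]_(t in `]-oo, x]) g t.
have FE u v : u <= v -> F v - F u = f v - f u.
  by move=> uv; rewrite fg// /F Rintegral_itvB.
have -> : f = F + cst (f 0 - F 0).
  apply/funext => y; rewrite fctE /=.
  have [y0|/ltW y0] := leP 0 y; first by have := FE _ _ y0; lra.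
  by have := FE _ _ y0; lra.
have := FTC1Ny iS lg; apply: filterS; first exact: (ae_filter_ringOfSetsType mu).
move=> x [dF DF].
have dFx : is_derive x (1 : R) F (g x).
  by apply: DeriveDef => //; rewrite -DF derive1E.
by apply: is_derive_eq; rewrite addr0.
Qed.
End stieltjes.

Section absolute_continuity_on.
Context {R : realType}.
Implicit Types (f g : R -> R) (a b x y z e r : R).
Local Notation mu := (@lebesgue_measure R).

Definition abs_cont_on x y f : Prop := abs_cont (f \o clamp x y).

Lemma abs_cont_on_bounded x y f : x <= y -> abs_cont_on x y f ->
  exists2 M, 0 <= M & forall z, `|f (clamp x y z)| <= M.
Proof.
move=> xy acf; have [M HM] := variations_bounded acf xy.
exists (M + `|f x|) => [|z].
  by rewrite addr_ge0// (HM _ (variations0 _ _ _)).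
have /andP[xz zy] := clamp_itv z xy.
have := HM _ (variations_cat xz zy (variations_unit (f \o clamp x y) xz) (variations0 _ _ _)).
rewrite addr0 /= (@clamp_id _ x y x) ?lexx// (@clamp_id _ x y (clamp x y z)) ?xz//.
have := ler_normD (f (clamp x y z) - f x) (f x); rewrite subrK; lra.
Qed.

Lemma abs_cont_on_lipschitz x y f (h : R -> R) L :
  (forall u v, `|h u - h v| <= L * `|u - v|) ->
  abs_cont_on x y f -> abs_cont_on x y (h \o f).
Proof.
move=> hL acf e e0.
have L0 : 0 <= L.
  by have := hL 1 0; rewrite subr0 normr1 mulr1; exact: le_trans.
have eL0 : 0 < e / (L + 1) by rewrite divr_gt0//; lra.
have [r r0 H] := acf _ eL0; exists r => // I s t no str.
have := H I s t no str; rewrite ltr_pdivlMr; last lra.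
apply: le_lt_trans; rewrite mulr_suml; apply: ler_sum => i _ /=.
apply: le_trans (hL _ _) _; rewrite mulrC ler_wpM2l//; lra.
Qed.

Lemma abs_cont_onB x y f g : abs_cont_on x y f -> abs_cont_on x y g ->
  abs_cont_on x y (f \- g).
Proof.
move=> acf acg e e0; have e20 : 0 < e / 2 by lra.
have [r1 r10 H1] := acf _ e20; have [r2 r20 H2] := acg _ e20.
exists (Num.min r1 r2); first by rewrite lt_min r10.
move=> I s t no; rewrite lt_min => /andP[l1 l2].
have /= h1 := H1 _ _ _ no l1; have /= h2 := H2 _ _ _ no l2.
pose F i := `|f (clamp x y (t i)) - f (clamp x y (s i))|.
pose G i := `|g (clamp x y (t i)) - g (clamp x y (s i))|.
apply: (@le_lt_trans _ _ (\sum_i F i + \sum_i G i)); last lra.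
rewrite -big_split/=; apply: ler_sum => i _.
rewrite /F /G; set ft := f _; set fs := f _; set gt := g _; set gs := g _.
have -> : ft - gt - (fs - gs) = (ft - fs) - (gt - gs) by lra.
exact: ler_normB.
Qed.

Lemma abs_cont_onM x y f g : x <= y -> abs_cont_on x y f -> abs_cont_on x y g ->
  abs_cont_on x y (f \* g).
Proof.
move=> xy acf acg e e0.
have [M M0 HM] := abs_cont_on_bounded xy acf.
have [K K0 HK] := abs_cont_on_bounded xy acg.
have e20 : 0 < e / 2 / (M + K + 1) by rewrite divr_gt0//; lra.
have [r1 r10 H1] := acf _ e20; have [r2 r20 H2] := acg _ e20.
exists (Num.min r1 r2); first by rewrite lt_min r10.
move=> I s t no; rewrite lt_min => /andP[l1 l2].
have /= h1 := H1 _ _ _ no l1; have /= h2 := H2 _ _ _ no l2.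
pose F i := `|f (clamp x y (t i)) - f (clamp x y (s i))|.
pose G i := `|g (clamp x y (t i)) - g (clamp x y (s i))|.
rewrite ltr_pdivlMr in h1; last lra.
rewrite ltr_pdivlMr in h2; last lra.
apply: (@le_lt_trans _ _ ((\sum_i F i) * (M + K + 1) + (\sum_i G i) * (M + K + 1))); last lra.
rewrite !mulr_suml -big_split/=; apply: ler_sum => i _.
have := HM (t i); have := HK (s i).
rewrite /F /G /=.
set ft := f (clamp x y (t i)); set fs := f (clamp x y (s i)).
set gt := g (clamp x y (t i)); set gs := g (clamp x y (s i)).
have -> : ft * gt - fs * gs = gs * (ft - fs) + ft * (gt - gs) by ring.
move=> gK fM.
apply: le_trans (ler_normD _ _) _; rewrite !normrM.
apply: lerD; rewrite mulrC ler_wpM2l//; lra.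
Qed.

Lemma ge0_integral_bigcup_finType (I : finType) (F : I -> set (measurableTypeR R))
    (g : measurableTypeR R -> \bar R) :
  (forall i, measurable (F i)) -> trivIset [set: I] F ->
  measurable_fun setT g -> (forall t, (0 <= g t)%E) ->
  (\int[mu]_(t in \bigcup_i F i) g t = \sum_i \int[mu]_(t in F i) g t)%E.
Proof.
move=> mF tF mg g0.
have -> : \bigcup_i F i = \big[setU/set0]_(i <- index_enum I) F i.
  by rewrite -bigcup_seq; apply: eq_bigcupl; split => i //= _; rewrite mem_index_enum.
rewrite ge0_integral_bigsetU//.
- exact: index_enum_uniq.
- by apply: sub_trivIset tF.
- exact: measurable_funTS.
Qed.

Lemma abs_cont_on_integral x y f (W : R -> R) : x <= y ->
  mu.-integrable `[x, y]%classic (EFin \o W) -> (forall t, 0 <= W t) ->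
  (forall s t, x <= s -> s <= t -> t <= y ->
    `|f t - f s| <= \int[mu]_(z in `]s, t]) W z) ->
  abs_cont_on x y f.
Proof.
move=> xy iW W0 fW e e0.
pose V := W \_ `[x, y].
have iV : mu.-integrable setT (EFin \o V).
  by rewrite /V -restrict_EFin; apply/(integrable_mkcond _ _).1.
have V0 t : 0 <= V t by rewrite /V patchE; case: ifPn.
have [r [r0 H]] := integral_normr_continuous iV e0.
exists r => // I s t no str.
have [st no'] := nonoverlapping_homo (@clamp_homo _ x y) no.
pose S i := clamp x y (s i); pose T i := clamp x y (t i).
have xS i : x <= S i by have /andP[] := clamp_itv (s i) xy.
have Ty i : T i <= y by have /andP[] := clamp_itv (t i) xy.
pose F i : set (measurableTypeR R) := `]S i, T i]%classic.
have mF i : measurable (F i) by exact: measurable_itv.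
have mUF : measurable (\bigcup_i F i).
  by apply: fin_bigcup_measurable => //; exact: finite_finset.
have tF : trivIset [set: I] F.
  apply/trivIsetP => i j _ _ ij; apply/seteqP; split => // z []; rewrite /F/= !in_itv/= /S /T.
  by move=> /andP[? ?] /andP[? ?]; case: (no' i j ij) => /= ?; exfalso; lra.
have muF : (mu (\bigcup_i F i) < r%:E)%E.
  have muFi i : mu (F i) = (T i - S i)%:E.
    rewrite [LHS]lebesgue_measure_itv/= lte_fin.
    by have := st i; rewrite /= /T /S; case: ltP => // ? ?; congr (_%:E); lra.
  rewrite measure_bigcup_finType// (eq_bigr _ (fun i _ => muFi i)).
  rewrite sumEFin lte_fin; apply: le_lt_trans str; apply: ler_sum => i _.
  by apply: clamp_lip; case: no.
have := H _ mUF muF; apply: le_lt_trans.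
have iV' A : measurable A -> mu.-integrable A (EFin \o V).
  by move=> mA; exact: integrableS iV.
have mV : measurable_fun setT (EFin \o V) by case/integrableP : iV.
have -> : \int[mu]_(z in \bigcup_i F i) `|V z| = \int[mu]_(z in \bigcup_i F i) V z.
  by apply: eq_Rintegral => z _; rewrite ger0_norm.
rewrite -lee_fin -sumEFin /Rintegral fineK; last first.
  by apply: integrable_fin_num => //; exact: iV'.
rewrite (@ge0_integral_bigcup_finType I F (EFin \o V))//.
apply: lee_sum => i _ /=.
have ViW : (\int[mu]_(z in F i) (V z)%:E = \int[mu]_(z in F i) (W z)%:E)%E.
  apply: eq_integral => z; rewrite inE /F /= in_itv/= => /andP[Sz zT].
  rewrite /V patchE ifT// inE /= in_itv/=; have := xS i; have := Ty i.
  by move=> ? ?; apply/andP; split; lra.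
rewrite ViW -[leRHS]fineK.
  by rewrite lee_fin; apply: fW; [exact: xS|exact: st|exact: Ty].
rewrite -ViW; apply: integrable_fin_num => //; exact: iV'.
Qed.

Lemma locally_nondecreasing_le x y (h : R -> R) : x <= y ->
  (forall t, x <= t <= y -> exists2 r, 0 < r & forall s, x <= s <= y ->
    `|s - t| < r -> (t <= s -> h t <= h s) /\ (s <= t -> h s <= h t)) ->
  h x <= h y.
Proof.
move=> xy hloc.
pose A := [set z | x <= z <= y /\ h x <= h z].
have Ax : A x by rewrite /A /= lexx xy.
have hsA : has_sup A by split; [exists x|exists y => z [/andP[]]].
pose c := sup A.
have xc : x <= c by apply: ub_le_sup => //; case: hsA.
have cy : c <= y by apply: ge_sup; [exists x|move=> z [/andP[]]].
have [|r r0 Hc] := hloc c; first by rewrite xc.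
have [z [/andP[xz zy] hxz] zc] := sup_adherent r0 hsA.
have zc' : z <= c by apply: ub_le_sup; [case: hsA|rewrite /A /= xz zy].
have hxc : h x <= h c.
  apply: le_trans hxz _; apply: (Hc z _ _).2 => //; first by rewrite xz.
  by rewrite ler0_norm; rewrite /c in zc' *; lra.
have [yc|cy'] := leP y c; first by have -> : y = c by lra.
pose s := Num.min y (c + r / 2).
have sy : s <= y by rewrite ge_min lexx.
have cs : c < s by rewrite lt_min cy'; lra.
have sr : s <= c + r / 2 by rewrite ge_min lexx orbT.
have : s <= c.
  apply: ub_le_sup; first by case: hsA.
  split; first by apply/andP; split; lra.
  apply: le_trans hxc _; apply: (Hc s _ _).1; last lra.
    by apply/andP; split; lra.
  by rewrite gtr0_norm; lra.
by move=> ?; exfalso; lra.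
Qed.


(** Layer cake form of the Vitali-Caratheodory theorem: an integrable [w] is
    bounded by an integrable [W] that stays above the integer part of [w t]
    plus one on a whole neighborhood of each [t]. *)
Lemma open_layer_majorant x y (w : R -> R) :
  mu.-integrable `[x, y]%classic (EFin \o w) -> (forall t, 0 <= w t) ->
  exists W : R -> R, [/\ forall t, 0 <= W t,
    mu.-integrable `[x, y]%classic (EFin \o W) &
    forall t, x <= t <= y -> exists2 r, 0 < r & exists2 c, w t < c &
      forall u v, x <= u -> u <= v -> v <= y -> `|u - t| < r -> `|v - t| < r ->
        c * (v - u) <= \int[mu]_(z in `]u, v]) W z].
Proof.
move=> iw w0.
pose D : set (measurableTypeR R) := `[x, y]%classic.
have mD : measurable D by exact: measurable_itv.
have mw : measurable_fun D w by case/integrableP : iw => /measurable_EFinP.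
pose E n : set (measurableTypeR R) := D `&` [set t | n%:R <= w t < n.+1%:R].
have mE n : measurable (E n).
  have -> : E n = D `&` w @^-1` `[n%:R, n.+1%:R[.
    by apply/seteqP; split => t [Dt]; rewrite /= in_itv.
  by apply: mw.
have tE : trivIset setT E.
  apply/trivIsetP => i j _ _ ij; apply/seteqP; split => // t [[_ /=]] /andP[i1 i2] [_ /=] /andP[j1 j2].
  have := le_lt_trans i1 j2; have := le_lt_trans j1 i2; rewrite !ltr_nat !ltnS => ji ij'.
  by move: ij; rewrite eqn_leq ji ij'.
have UE : \bigcup_n E n = D.
  apply/seteqP; split => [t [n _ []]//|t Dt].
  exists (Num.truncn (w t)) => //; split => //=.
  by rewrite truncn_le ?truncnS_gt// w0.
have muD : (mu D < +oo)%E by rewrite /D lebesgue_measure_itv/= -EFinB; case: ifP; rewrite ltry.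
have muE n : (mu (E n) < +oo)%E.
  by apply: le_lt_trans muD; apply: le_measure; rewrite ?inE//; exact: subIsetl.
pose eps n : R := 1 / (2 ^ n.+1)%:R / n.+1%:R.
have eps0 n : 0 < eps n by rewrite !divr_gt0// ltr0n expn_gt0.
have /choice[U HU] : forall n, exists U : set R,
    [/\ open U, E n `<=` U & (mu (U `\` E n) < (eps n)%:E)%E].
  move=> n; have [V [oV EV mV]] := lebesgue_regularity_outer (mE n) (muE n) (eps0 n).
  by exists V.
have mU n : measurable (U n : set (measurableTypeR R)).
  by apply: open_measurable; have [] := HU n.
pose h n (t : measurableTypeR R) : \bar R := (n.+1%:R * \1_(U n) t)%:E.
have h0 n t : (0 <= h n t)%E by rewrite lee_fin mulr_ge0.
have mh n : measurable_fun [set: measurableTypeR R] (h n).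
  by apply/measurable_EFinP; apply: measurable_funM => //; exact: measurable_indic.
pose H (t : measurableTypeR R) := (\sum_(n <oo) h n t)%E.
have H0 t : (0 <= H t)%E by exact: nneseries_ge0.
have mH : measurable_fun [set: measurableTypeR R] H.
  by apply: ge0_emeasurable_sum => // n _ _.
have mw1 : measurable_fun D (fun t => (w t + 1)%:E).
  by apply/measurable_EFinP; exact: measurable_funD.
have mw1E n : measurable_fun (E n) (fun t => (w t + 1)%:E).
  by apply: measurable_funS mw1 => //; exact: subIsetl.
have w10 t : (0 <= (w t + 1)%:E)%E by rewrite lee_fin addr_ge0.
have ihn n : (\int[mu]_(t in D) h n t <=
    \int[mu]_(t in E n) (w t + 1)%:E + (1 / (2 ^ n.+1)%:R)%:E)%E.
  have -> : (\int[mu]_(t in D) h n t = n.+1%:R%:E * mu (U n `&` D))%E.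
    rewrite /h; under eq_integral do rewrite EFinM.
    rewrite ge0_integralZl_EFin ?integral_indic//.
    by apply/measurable_EFinP; exact: measurable_indic.
  apply: (@le_trans _ _ (n.+1%:R%:E * (mu (E n) + (eps n)%:E))%E).
    apply: lee_wpmul2l => //.
    have [oU EU UEe] := HU n.
    apply: (@le_trans _ _ (mu (E n `|` (U n `\` E n)))).
      apply: le_measure; rewrite ?inE//.
      - exact: measurableI.
      - by apply: measurableU => //; exact: measurableD.
      - by move=> t [Ut _]; have [?|?] := pselect (E n t); [left|right].
    apply: le_trans (measureU2 _ _ _) _ => //; first exact: measurableD.
    by rewrite leeD2l// ltW.
  rewrite muleDr//; last by rewrite ge0_adde_def// inE ?measure_ge0// lee_fin ltW.
  apply: leeD; last by rewrite -EFinM lee_fin mulrC divfK// pnatr_eq0.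
  rewrite -integral_cst//; apply: ge0_le_integral => //.
  - by move=> t _; rewrite lee_fin.
  - by move=> t [_ /= /andP[nt _]]; rewrite lee_fin -(natr1 n) lerD2r.
have iw' : (\int[mu]_(t in D) (w t)%:E < +oo)%E.
  have /integrableP[_] := iw; rewrite (eq_integral (fun t : measurableTypeR R => (w t)%:E))//.
  by move=> t _ /=; rewrite ger0_norm.
have iH : (\int[mu]_(t in D) H t < +oo)%E.
  rewrite /H integral_nneseries//; last by move=> n; exact: measurable_funTS.
  apply: (@le_lt_trans _ _ (\sum_(n <oo) (\int[mu]_(t in E n) (w t + 1)%:E + (1 / (2 ^ n.+1)%:R)%:E))%E).
    by apply: lee_nneseries => // n _ _; apply: integral_ge0.
  apply: le_lt_trans (epsilon_trick _ _ _) _ => //.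
    by move=> n; apply: integral_ge0.
  rewrite -ge0_integral_bigcup//; last by rewrite UE.
  rewrite UE; under eq_integral do rewrite EFinD.
  rewrite ge0_integralD//; last 2 first.
  - by move=> t _; rewrite lee_fin.
  - exact/measurable_EFinP.
  rewrite integral_cst// mul1e lte_add_pinfty//; last exact: (ltry 1).
  by rewrite lte_add_pinfty.
have iH' : mu.-integrable D H.
  apply/integrableP; split; first exact: measurable_funTS.
  rewrite (eq_integral H); first exact: iH.
  by move=> t _; rewrite gee0_abs.
have mfH : measurable_fun [set: measurableTypeR R] (fine \o H).
  by apply: measurableT_comp => //; exact: fine_measurable.
exists (fine \o H); split.
- by move=> t /=; exact: fine_ge0.
- apply: le_integrable iH' => //; first by apply/measurable_EFinP; exact: measurable_funTS.
  by move=> t _ /=; have := H0 t; case: (H t) => [s||]//= _; rewrite ?normr0 ?lexx// leey.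
move=> t Dt.
have [n _ Ent] : (\bigcup_n E n) t by rewrite UE /D /= in_itv.
have [oU EU _] := HU n.
have /nbhs_ballP[r /= r0 rU] : nbhs t (U n) by apply: open_nbhs_nbhs; split => //; exact: EU.
exists r => //; exists n.+1%:R; first by case: Ent => _ /= /andP[].
move=> u v xu uv vy ut vt.
pose J : set (measurableTypeR R) := `]u, v]%classic.
have mJ : measurable J by exact: measurable_itv.
have JU : J `<=` U n.
  move=> z; rewrite /J /= in_itv/= => /andP[uz zv]; apply: rU; rewrite /ball/= distrC.
  move: ut vt; rewrite !ltr_norml => /andP[? ?] /andP[? ?]; apply/andP; split; lra.
have JD : J `<=` D.
  move=> z; rewrite /J /D /= !in_itv/= => /andP[uz zv]; apply/andP; split; lra.
have muJ : mu J = (v - u)%:E.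
  by rewrite [LHS]lebesgue_measure_itv/= lte_fin; case: ltP => // ?; congr (_%:E); lra.
have ifJ : mu.-integrable J (EFin \o (fine \o H)).
  apply: le_integrable (integrableS mD mJ JD iH') => //.
    by apply/measurable_EFinP; exact: measurable_funTS.
  by move=> z _ /=; have := H0 z; case: (H z) => [s||]//= _; rewrite ?normr0 ?lexx// leey.
rewrite -lee_fin /Rintegral fineK; last exact: integrable_fin_num.
have -> : (\int[mu]_(z in J) ((fine \o H) z)%:E = \int[mu]_(z in J) H z)%E.
  apply: ae_eq_integral => //.
  - by apply/measurable_EFinP; exact: measurable_funTS.
  - exact: measurable_funTS.
  have [A [mA A0 HA]] := integrable_ae mD iH'; exists A; split => // z /= Hz.
  by apply: HA => /= fz; apply: Hz => Jz; rewrite fineK// fz//; exact: JD.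
rewrite EFinM -muJ -integral_cst//.
apply: ge0_le_integral => //; [by move=> z _; rewrite lee_fin|exact: measurable_funTS|].
move=> z Jz; apply: (@le_trans _ _ (h n z)).
  by rewrite /h indicE mem_set ?mulr1//; exact: JU.
have := @nneseries_lim_ge R (h^~ z) xpredT 0 n.+1 (fun k _ _ => h0 k z).
by apply: le_trans; rewrite big_nat_recr//= leeDr// sume_ge0.
Qed.

End absolute_continuity_on.

Section fundamental_theorem.
Context {R : realType}.
Implicit Types (f g F D : R -> R) (a b x y z e r : R).
Local Notation mu := (@lebesgue_measure R).

Lemma derivable_bound f t c : derivable f t 1 -> `|derive1 f t| < c ->
  exists2 r, 0 < r & forall s, `|s - t| < r -> `|f s - f t| <= c * `|s - t|.
Proof.
move=> df fc.
have e0 : 0 < c - `|derive1 f t| by lra.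
have := df; rewrite /derivable => /cvgrPdist_lt/(_ _ e0).
rewrite near_withinE => /nbhs_ballP[r /= r0 Hr]; exists r => // s st.
have [->|st0] := eqVneq s t; first by rewrite !subrr normr0 mulr0.
have st1 : s - t != 0 by rewrite subr_eq0.
have := Hr (s - t); rewrite /ball/= sub0r normrN => /(_ st st1).
rewrite /= /shift /= -[_ *: 1]/(_ * 1) mulr1 subrK -[_ *: _]/(_ * _).
rewrite -/(derive f t 1) -derive1E.
set q := _ * _ => qc.
have qc' : `|q| <= c.
  have := ler_normB (derive1 f t) (derive1 f t - q).
  by rewrite subKr; lra.
have -> : f s - f t = (s - t) * q by rewrite /q mulrA mulfV// mul1r.
by rewrite normrM mulrC ler_wpM2r.
Qed.

(** An everywhere differentiable function with integrable derivative is
    absolutely continuous. *)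
Lemma derivable_abs_cont_on x y f (w : R -> R) : x <= y ->
  mu.-integrable `[x, y]%classic (EFin \o w) ->
  (forall t, x <= t <= y -> derivable f t 1 /\ `|derive1 f t| <= w t) ->
  (forall t, 0 <= w t) -> abs_cont_on x y f.
Proof.
move=> xy iw fw w0.
have [W [W0 iW HW]] := open_layer_majorant iw w0.
apply: (abs_cont_on_integral xy iW W0) => u v xu uv vy.
pose G s := \int[mu]_(z in `]x, s]) W z.
have GB s t : x <= s -> s <= t -> t <= y -> G t - G s = \int[mu]_(z in `]s, t]) W z.
  move=> xs st ty; rewrite /G Rintegral_itvB//= ?bnd_simp//.
  apply: integrableS iW => //.
  by move=> z /=; rewrite !in_itv/= => /andP[? ?]; apply/andP; split; lra.
have loc t : u <= t <= v -> exists2 r, 0 < r & forall s, u <= s <= v ->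
    `|s - t| < r -> (t <= s -> `|f s - f t| <= G s - G t) /\
                    (s <= t -> `|f s - f t| <= G t - G s).
  move=> /andP[ut tv].
  have xty : x <= t <= y by apply/andP; split; lra.
  have [r1 r10 [c wc Hc]] := HW t xty.
  have [dft /le_lt_trans/(_ wc) fc] := fw t xty.
  have [r2 r20 Hf] := derivable_bound dft fc.
  exists (Num.min r1 r2); first by rewrite lt_min r10.
  move=> s /andP[us sv]; rewrite lt_min => /andP[sr1 sr2].
  have fst := Hf s sr2.
  split=> [ts|st]; apply: le_trans fst _; rewrite GB; try lra.
    by rewrite ger0_norm ?subr_ge0//; apply: Hc; rewrite ?subrr ?normr0//; lra.
  rewrite distrC ger0_norm ?subr_ge0//; apply: Hc; rewrite ?subrr ?normr0//; lra.
rewrite -GB//.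
have h1 : (G \- f) u <= (G \- f) v.
  apply: locally_nondecreasing_le => // t /loc[r r0 H]; exists r => // s us sr.
  have [H1 H2] := H s us sr; split => [/H1|/H2] /=; rewrite ler_norml; lra.
have h2 : (G \+ f) u <= (G \+ f) v.
  apply: locally_nondecreasing_le => // t /loc[r r0 H]; exists r => // s us sr.
  have [H1 H2] := H s us sr; split => [/H1|/H2] /=; rewrite ler_norml; lra.
by rewrite /= in h1 h2; rewrite ler_norml; apply/andP; split; lra.
Qed.

Lemma clampK x y z : x <= y -> clamp x y (clamp x y z) = clamp x y z.
Proof. by move=> xy; rewrite clamp_id// clamp_itv. Qed.

Lemma near_clamp x y f t : x < t < y -> {near t, f =1 f \o clamp x y}.
Proof.
move=> /andP[xt ty]; near=> z => /=.
have xz : x < z by near: z; exact: lt_nbhsr.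
have zy : z < y by near: z; exact: lt_nbhsl.
by rewrite clamp_id// !ltW.
Unshelve. all: by end_near. Qed.

Lemma abs_cont_on_is_derive x y f : x <= y -> abs_cont_on x y f ->
  exists g, [/\ mu.-integrable setT (EFin \o g),
    f y - f x = \int[mu]_(t in `]x, y]) g t &
    {ae mu, forall t, x < t < y -> derivable f t 1 /\ 'D_1 f t = g t}].
Proof.
move=> xy acf.
have fE z : (f \o clamp x y) z = (f \o clamp x y) (clamp x y z).
  by rewrite /= clampK.
have [g gP] := abs_cont_is_integral xy acf fE.
exists g; split; first by case: gP.
  by case: gP => _ /(_ x y xy) <- /=; rewrite !clamp_id ?lexx ?xy.
have [A [mA A0 HA]] := is_integral_of_derive gP.
exists A; split => // t /= Ht; apply: HA => /= Dt; apply: Ht => xty.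
suff [] : is_derive t (1 : R) f (g t) by [].
apply: near_eq_is_derive Dt; have := near_clamp f xty.
by apply: filterS => z ->.
Qed.

Lemma abs_cont_on_FTC x y f D : x <= y -> abs_cont_on x y f ->
  measurable_fun `]x, y[%classic D ->
  {ae mu, forall t, x < t < y -> derivable f t 1 -> 'D_1 f t = D t} ->
  mu.-integrable `]x, y[%classic (EFin \o D) /\
  f y - f x = \int[mu]_(t in `]x, y[) D t.
Proof.
move=> xy acf mD [B [mB B0 HB]].
have [g [ig fg [A [mA A0 HA]]]] := abs_cont_on_is_derive xy acf.
have mxy : measurable (`]x, y[%classic : set (measurableTypeR R)) by exact: measurable_itv.
have mg : measurable_fun `]x, y[%classic g.
  by apply: measurable_funTS; case/integrableP : ig => /measurable_EFinP.
have Dg : ae_eq mu `]x, y[%classic (EFin \o D) (EFin \o g).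
  exists (A `|` B); split; [exact: measurableU| |].
    apply/eqP; rewrite eq_le measure_ge0 andbT.
    apply: le_trans (measureU2 _ mA mB) _.
    have /= -> := A0; have /= -> := B0; by rewrite adde0.
  move=> t /= Ht; have [At|nAt] := pselect (A t); first by left.
  have [Bt|nBt] := pselect (B t); first by right.
  exfalso; apply: Ht; rewrite in_itv/= => xty; congr (_%:E).
  have [df <-] : derivable f t 1 /\ 'D_1 f t = g t.
    by apply: contrapT => h; apply: nAt; apply: HA => /= /(_ xty).
  by apply/esym; apply: contrapT => h; apply: nBt; apply: HB => /= /(_ xty df).
have igxy : mu.-integrable `]x, y[%classic (EFin \o g) by exact: integrableS ig.
split.
  have /integrableP[_ ioo] := igxy.
  apply/integrableP; split; first exact/measurable_EFinP.
  apply: le_lt_trans ioo; rewrite le_eqVlt; apply/orP; left; apply/eqP.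
  apply: ge0_ae_eq_integral => //.
  - by apply: measurableT_comp => //; exact/measurable_EFinP.
  - by apply: measurableT_comp => //; exact/measurable_EFinP.
  - have [C [mC C0 HC]] := Dg; exists C; split => // t /= Ht; apply: HC => /= Hc.
    by apply: Ht => Jt /=; have [->] := Hc Jt.
rewrite fg -Rintegral_itv_bndo_bndc// /Rintegral; congr fine.
apply/esym/ae_eq_integral => //; exact/measurable_EFinP.
Qed.

End fundamental_theorem.

Section truncations.
Context {R : realType}.
Implicit Types (c e s u v : R).

Definition saturate c s : R := s / (1 + c * s ^+ 2).
Definition dsaturate c s : R := (1 - c * s ^+ 2) / (1 + c * s ^+ 2) ^+ 2.

Definition soften e s : R := if s <= e then 0 else (s - e) ^+ 2 / s.
Definition dsoften e s : R := if s <= e then 0 else 1 - e ^+ 2 / s ^+ 2.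

Let den_gt0 c s : 0 <= c -> 0 < 1 + c * s ^+ 2.
Proof. by move=> c0; rewrite ltr_pwDl// mulr_ge0// sqr_ge0. Qed.

Lemma saturate_lipschitz c u v : 0 <= c ->
  `|saturate c u - saturate c v| <= 1 * `|u - v|.
Proof.
move=> c0; have du := den_gt0 u c0; have dv := den_gt0 v c0.
have du0 : 1 + c * u ^+ 2 != 0 by rewrite gt_eqF.
have dv0 : 1 + c * v ^+ 2 != 0 by rewrite gt_eqF.
have -> : saturate c u - saturate c v =
    (u - v) * ((1 - c * (u * v)) / ((1 + c * u ^+ 2) * (1 + c * v ^+ 2))).
  by rewrite /saturate; field; rewrite du0 dv0.
rewrite normrM mul1r ler_piMr// normrM normfV (gtr0_norm (mulr_gt0 du dv)).
rewrite ler_pdivrMr ?mulr_gt0// mul1r ler_norml.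
have h1 : 0 <= c * (u - v) ^+ 2 by rewrite mulr_ge0// sqr_ge0.
have h2 : 0 <= c * (u + v) ^+ 2 by rewrite mulr_ge0// sqr_ge0.
have h3 : 0 <= (c * (u * v)) ^+ 2 by rewrite sqr_ge0.
have hu : 0 <= c * u ^+ 2 by rewrite mulr_ge0// sqr_ge0.
have hv : 0 <= c * v ^+ 2 by rewrite mulr_ge0// sqr_ge0.
by apply/andP; split; nra.
Qed.

Lemma saturate_le c s : 0 <= c -> `|saturate c s| <= `|s|.
Proof.
move=> c0; have := saturate_lipschitz s 0 c0.
by rewrite {2}/saturate mul0r !subr0 mul1r.
Qed.

Lemma saturate_bounded c s : 0 < c -> `|saturate c s| <= 1 + c^-1.
Proof.
move=> c0; have d0 := den_gt0 s (ltW c0).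
rewrite normrM normfV (gtr0_norm d0) ler_pdivrMr//.
have : `|s| <= 1 + s ^+ 2.
  by rewrite -(real_normK (num_real s)); have := sqr_ge0 (`|s| - 1); nra.
move=> hs; apply: le_trans hs _.
have -> : (1 + c^-1) * (1 + c * s ^+ 2) = 1 + c * s ^+ 2 + c^-1 + (c^-1 * c) * s ^+ 2.
  by ring.
rewrite mulVf ?gt_eqF// mul1r.
have : 0 <= c * s ^+ 2 by rewrite mulr_ge0 ?sqr_ge0// ltW.
have : 0 < c^-1 by rewrite invr_gt0.
lra.
Qed.

Lemma dsaturate_le1 c s : 0 <= c -> `|dsaturate c s| <= 1.
Proof.
move=> c0; have d0 := den_gt0 s c0.
have h : 0 <= c * s ^+ 2 by rewrite mulr_ge0// sqr_ge0.
rewrite normrM normfV (gtr0_norm (exprn_gt0 2 d0)) ler_pdivrMr ?exprn_gt0//.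
by rewrite mul1r ler_norml; apply/andP; split; nra.
Qed.

Lemma is_derive_saturate c s : 0 <= c ->
  is_derive s (1 : R) (saturate c) (dsaturate c s).
Proof.
move=> c0; have d0 : 1 + c * s ^+ 2 != 0 by rewrite gt_eqF// den_gt0.
have h1 : is_derive s (1 : R) (fun u : R => 1 + c * u ^+ 2) (c * (2 * s)).
  have -> : (fun u : R => 1 + c * u ^+ 2) = cst 1 + c \*: (@id R ^+ 2).
    by apply/funext => u; rewrite fctE.
  apply: is_derive_eq; rewrite /GRing.scale /= add0r; ring.
have h2 := @is_deriveV _ (fun u : R => 1 + c * u ^+ 2) s _ _ d0 h1.
have h3 := is_deriveM (is_derive_id s (1 : R)) h2.
apply: is_derive_eq h3 _; rewrite /GRing.scale /dsaturate /=.
by field.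
Qed.

Lemma soften_le e s : 0 < e -> 0 <= soften e s /\ (0 <= s -> soften e s <= s).
Proof.
move=> e0; rewrite /soften; case: (leP s e) => es; first by [].
have s0 : 0 < s by lra.
split; first by rewrite divr_ge0 ?sqr_ge0// ltW.
by rewrite ler_pdivrMr// => _; nra.
Qed.

Lemma dsoften_le1 e s : 0 < e -> 0 <= dsoften e s <= 1.
Proof.
move=> e0; rewrite /dsoften; case: (leP s e) => es; first by rewrite lexx ler01.
have s0 : 0 < s by lra.
rewrite subr_ge0 ler_pdivrMr ?exprn_gt0// mul1r gerBl divr_ge0 ?sqr_ge0// andbT.
by rewrite ler_pXn2r// ?nnegrE; lra.
Qed.

Let soften_alt e s : 0 < e -> e < s -> soften e s = s - 2 * e + e ^+ 2 / s.
Proof.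
move=> e0 es; rewrite /soften leNgt es /=; field; lra.
Qed.

Lemma soften_lipschitz e u v : 0 < e -> `|soften e u - soften e v| <= 1 * `|u - v|.
Proof.
move=> e0; rewrite mul1r; wlog vu : u v / v <= u.
  move=> W; have [vu|/ltW uv] := leP v u; first exact: W.
  by rewrite distrC [leRHS]distrC; exact: W.
rewrite [leRHS]ger0_norm ?subr_ge0//.
have [ve|ev] := leP v e; last first.
  have eu : e < u by lra.
  have u0 : 0 < u by lra.
  have v0 : 0 < v by lra.
  have -> : soften e u - soften e v = (u - v) * (1 - e ^+ 2 / (u * v)).
    rewrite !soften_alt//; field; rewrite !gt_eqF//.
  have h : 0 <= e ^+ 2 / (u * v) <= 1.
    apply/andP; split; first by rewrite divr_ge0 ?sqr_ge0// ltW// mulr_gt0.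
    by rewrite ler_pdivrMr ?mulr_gt0// mul1r expr2; apply: ler_pM; lra.
  rewrite normrM ger0_norm ?subr_ge0// ler_piMr ?subr_ge0//.
  by rewrite ger0_norm; lra.
rewrite {2}/soften ve subr0 ger0_norm; last by have [] := soften_le u e0.
rewrite /soften; case: (leP u e) => eu; first lra.
rewrite ler_pdivrMr; last lra.
have -> : (u - e) ^+ 2 = (u - e) * (u - e) by rewrite expr2.
by apply: ler_pM; lra.
Qed.

Lemma is_derive_quadratic (f : R -> R) a C r : 0 < r ->
  (forall s, `|s - a| < r -> `|f s - f a| <= C * (s - a) ^+ 2) ->
  is_derive a (1 : R) f 0.
Proof.
move=> r0 Hf.
suff h : h^-1 *: (f (h *: (1 : R) + a) - f a) @[h --> 0^'] --> (0 : R).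
  by apply: DeriveDef; [apply/cvg_ex; exists 0|exact/cvg_lim].
have C0 : 0 <= `|C| + 1 by rewrite addr_ge0.
apply/cvgrPdist_lt => e e0.
have eC : 0 < e / (`|C| + 1) by rewrite divr_gt0// ltr_wpDl.
near=> h; have h0 : h != 0 by near: h; exact: nbhs_dnbhs_neq.
rewrite sub0r normrN -[_ *: 1]/(_ * 1) mulr1 -[_ *: _]/(_ * _).
have hr : `|h| < r by near: h; exact: dnbhs0_lt.
have he : `|h| < e / (`|C| + 1) by near: h; exact: dnbhs0_lt.
have := Hf (h + a); rewrite addrK => /(_ hr) hf.
have h0' : 0 < `|h| by rewrite normr_gt0.
rewrite normrM normfV -(ltr_pM2l h0') mulrA divff ?gt_eqF// mul1r.
apply: le_lt_trans hf _; rewrite -(real_normK (num_real h)) expr2.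
rewrite ltr_pdivlMr ?ltr_wpDl// in he.
have := ler_norm C; nra.
Unshelve. all: by end_near. Qed.

Lemma is_derive_soften e s : 0 < e ->
  is_derive s (1 : R) (soften e) (dsoften e s).
Proof.
move=> e0; rewrite /dsoften; case: (ltgtP s e) => es.
- have h : is_derive s (1 : R) (cst (0 : R)) 0 by exact: is_derive_cst.
  apply: near_eq_is_derive h; near=> z; rewrite /soften ifT//.
  by apply/ltW; near: z; exact: lt_nbhsl.
- have s0 : s != 0 by rewrite gt_eqF//; lra.
  have h2 := @is_deriveV _ (@id R) s _ _ s0 (is_derive_id s (1 : R)).
  have h : is_derive s (1 : R) (id - cst (2 * e) + e ^+ 2 \*: (fun y : R => y^-1)) (1 - e ^+ 2 / s ^+ 2).
    apply: is_derive_eq; rewrite /GRing.scale /= subr0 mulr1 mulrN.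
    by congr (_ - _); rewrite exprVn.
  apply: near_eq_is_derive h; near=> z; rewrite soften_alt ?fctE//.
  by near: z; exact: lt_nbhsr.
- rewrite es; apply: (@is_derive_quadratic _ _ e^-1 1) => // z _.
  rewrite {2}/soften lexx subr0 ger0_norm; last by have [] := soften_le z e0.
  rewrite /soften; case: (leP z e) => ez.
    by rewrite mulr_ge0 ?sqr_ge0// invr_ge0 ltW.
  rewrite mulrC ler_wpM2r ?sqr_ge0// lef_pV2 ?posrE; lra.
Unshelve. all: by end_near. Qed.

Lemma cvg_saturate (c_ : nat -> R) s : c_ n @[n --> \oo] --> (0 : R) ->
  saturate (c_ n) s @[n --> \oo] --> s /\ dsaturate (c_ n) s @[n --> \oo] --> (1 : R).
Proof.
move=> c0.
have d : 1 + c_ n * s ^+ 2 @[n --> \oo] --> 1 + 0 * s ^+ 2.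
  by apply: cvgD; [exact: cvg_cst|apply: cvgM => //; exact: cvg_cst].
rewrite mul0r addr0 in d.
have n1 : 1 - c_ n * s ^+ 2 @[n --> \oo] --> 1 - 0 * s ^+ 2.
  by apply: cvgB; [exact: cvg_cst|apply: cvgM => //; exact: cvg_cst].
rewrite mul0r subr0 in n1.
split.
  rewrite -[X in _ --> X]divr1.
  apply: cvgM; first exact: cvg_cst.
  by apply: cvgV => //; rewrite oner_eq0.
have : (1 - c_ n * s ^+ 2) / ((1 + c_ n * s ^+ 2) ^+ 2) @[n --> \oo] --> 1 / (1 * 1 : R).
  apply: cvgM => //; apply: cvgV; first by rewrite mulr1 oner_eq0.
  exact: cvgM.
by rewrite mulr1 divr1.
Qed.

Lemma cvg_soften (e_ : nat -> R) s : 0 < s -> e_ n @[n --> \oo] --> (0 : R) ->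
  soften (e_ n) s @[n --> \oo] --> s /\ dsoften (e_ n) s @[n --> \oo] --> (1 : R).
Proof.
move=> s0 e0.
have nes : \forall n \near \oo, e_ n < s by exact: cvgr_lt e0 _ s0.
split.
  have : (s - e_ n) ^+ 2 / s @[n --> \oo] --> (s - 0) ^+ 2 / s.
    apply: cvgM; last exact: cvg_cst.
    by apply: cvgM; (apply: cvgB; [exact: cvg_cst|exact: e0]).
  rewrite subr0 expr2 mulfK ?gt_eqF//; apply: cvg_trans; apply: near_eq_cvg.
  by near=> n; rewrite /soften leNgt ifN// negbK; near: n.
have : 1 - e_ n ^+ 2 / s ^+ 2 @[n --> \oo] --> 1 - 0 ^+ 2 / s ^+ 2.
  apply: cvgB; first exact: cvg_cst.
  by apply: cvgM; [exact: cvgM|exact: cvg_cst].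
rewrite expr0n mul0r subr0; apply: cvg_trans; apply: near_eq_cvg.
by near=> n; rewrite /dsoften leNgt ifN// negbK; near: n.
Unshelve. all: by end_near. Qed.

End truncations.

Lemma measurable_funV_gt0 d (T : measurableType d) (R : realType) (D : set T)
    (f : T -> R) : measurable D -> measurable_fun D f -> (forall x, D x -> 0 < f x) ->
  measurable_fun D (fun x => (f x)^-1).
Proof.
move=> mD mf f0; apply: (@eq_measurable_fun _ _ _ _ _ (fun x => powR (f x) (-1))).
  by move=> x; rewrite inE => /f0 /ltW; exact: powR_inv1.
exact: measurableT_comp (measurable_powR _) mf.
Qed.

Section measurable_truncations.
Context d (T : measurableType d) (R : realType) (D : set T) (f : T -> R).
Hypotheses (mD : measurable D) (mf : measurable_fun D f).

Let derivable_continuous (g dg : R -> R) :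
  (forall s, is_derive s (1 : R) g (dg s)) -> continuous g.
Proof.
by move=> gd s; apply: differentiable_continuous; apply/derivable1_diffP; case: (gd s).
Qed.

Lemma measurable_saturate c : 0 <= c -> measurable_fun D (fun t => saturate c (f t)).
Proof.
move=> c0; apply: measurableT_comp mf; apply: continuous_measurable_fun.
by apply: derivable_continuous => s; exact: is_derive_saturate.
Qed.

Lemma measurable_soften e : 0 < e -> measurable_fun D (fun t => soften e (f t)).
Proof.
move=> e0; apply: measurableT_comp mf; apply: continuous_measurable_fun.
by apply: derivable_continuous => s; exact: is_derive_soften.
Qed.

Lemma measurable_dsaturate c : 0 <= c -> measurable_fun D (fun t => dsaturate c (f t)).
Proof.
move=> c0; rewrite /dsaturate; apply: measurable_funM.
  apply: measurable_funB => //; apply: measurable_funM => //.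
  exact: measurable_funX.
apply: measurable_funV_gt0 => //.
  apply: measurable_funX; apply: measurable_funD => //; apply: measurable_funM => //.
  exact: measurable_funX.
by move=> x _; rewrite exprn_gt0// ltr_pwDl// mulr_ge0// sqr_ge0.
Qed.

Lemma measurable_dsoften e : 0 < e -> (forall x, D x -> 0 < f x) ->
  measurable_fun D (fun t => dsoften e (f t)).
Proof.
move=> e0 f0.
apply: (@eq_measurable_fun _ _ _ _ _ (fun x => Num.max 0 (1 - e ^+ 2 * (f x ^+ 2)^-1))).
  move=> x; rewrite inE => /f0 fx; rewrite /dsoften; case: leP => fe.
    rewrite (max_idPl _)// subr_le0 ler_pdivlMr ?exprn_gt0// mul1r.
    by rewrite ler_pXn2r// nnegrE ltW.
  rewrite (max_idPr _)// subr_ge0 ler_pdivrMr ?exprn_gt0// mul1r.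
  by rewrite ler_pXn2r// ?nnegrE ltW.
apply: measurable_maxr => //; apply: measurable_funB => //; apply: measurable_funM => //.
apply: measurable_funV_gt0 => //; first exact: measurable_funX.
by move=> x /f0 fx; rewrite exprn_gt0.
Qed.

End measurable_truncations.

Section integration_by_parts_on_a_line.
Context {R : realType}.
Local Notation mu := (@lebesgue_measure R).

Lemma integrable_small (f : R -> R) (M e : R) :
  mu.-integrable setT (EFin \o f) -> 0 < e ->
  (exists2 x, M <= x & `|f x| < e) /\ (exists2 x, x <= M & `|f x| < e).
Proof.
move=> fi e0.
suff H (A : set (measurableTypeR R)) : measurable A -> mu A = +oo%E ->
    exists2 x, A x & `|f x| < e.
  split.
    have [||x] := H `[M, +oo[%classic.
    - exact: measurable_itv.
    - by rewrite lebesgue_measure_itv/= ltry.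
    - by rewrite /= in_itv/= andbT => ? ?; exists x.
  have [||x] := H `]-oo, M]%classic.
  - exact: measurable_itv.
  - by rewrite lebesgue_measure_itv/= ltNyr.
  - by rewrite /= in_itv/= => ? ?; exists x.
move=> mA muA; apply: contrapT => hn.
have /integrableP[mf] := integrableS measurableT mA (@subsetT _ _) fi.
apply/negP; rewrite -leNgt.
apply: (@le_trans _ _ (\int[mu]_(x in A) (cst e%:E x))%E).
  by rewrite integral_cst//= muA gt0_muley ?lte_fin.
apply: ge0_le_integral => //.
- by move=> x _; rewrite lee_fin ltW.
- exact: measurableT_comp.
- move=> x Ax /=; rewrite lee_fin leNgt; apply/negP => fx; apply: hn; by exists x.
Qed.

Lemma compactly_approximated_integral (F D : R -> R) :
  mu.-integrable setT (EFin \o F) -> mu.-integrable setT (EFin \o D) ->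
  (forall x y, x <= y -> F y - F x = \int[mu]_(t in `]x, y]) D t) ->
  \int[mu]_t D t = 0.
Proof.
move=> iF iD FD.
have n0 (n : nat) : 0 < (n.+1%:R : R)^-1 by rewrite invr_gt0.
have /choice[u Hu] (n : nat) : exists x, n%:R <= x /\ `|F x| < n.+1%:R^-1.
  by have [[x]] := integrable_small n%:R iF (n0 n); exists x.
have /choice[v Hv] (n : nat) : exists x, x <= - n%:R /\ `|F x| < n.+1%:R^-1.
  by have [_ [x]] := integrable_small (- n%:R) iF (n0 n); exists x.
pose f n := EFin \o (D \_ `]v n, u n]).
have mD : measurable_fun setT D by case/integrableP : iD => /measurable_EFinP.
have : (\int[mu]_t f n t @[n --> \oo] --> \int[mu]_t (D t)%:E)%E.
  apply: (@dominated_cvg _ _ _ mu setT _ f _ (abse \o (EFin \o D))) => //.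
  - move=> n; apply/measurable_EFinP; apply/(measurable_restrictT _ _).1 => //.
    exact: measurable_funTS.
  - move=> x _; apply: cvg_near_cst; near=> n.
    rewrite /f /= patchE ifT// inE /= in_itv/=.
    have nx : `|x| < n%:R by near: n; exact: nbhs_infty_gtr.
    move: nx; rewrite ltr_norml => /andP[? ?].
    by have [? _] := Hu n; have [? _] := Hv n; apply/andP; split; lra.
  - exact: integrable_abse.
  - by move=> n x _; rewrite /f /= patchE; case: ifPn => //; rewrite normr0 lee_fin.
have -> : (fun n => \int[mu]_t f n t)%E = (fun n => (F (u n) - F (v n))%:E).
  apply/funext => n; have vu : v n <= u n.
    by have [? _] := Hu n; have [? _] := Hv n; have := ler0n R n; lra.
  rewrite FD// /Rintegral fineK; last first.
    by apply: integrable_fin_num => //; exact: integrableS iD.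
  by rewrite [RHS]integral_mkcond; apply: eq_integral => t _; rewrite /f /= restrict_EFin.
have F0 : F (u n) - F (v n) @[n --> \oo] --> (0 : R).
  have h (w : nat -> R) : (forall n, `|F (w n)| < n.+1%:R^-1) -> F (w n) @[n --> \oo] --> (0 : R).
    move=> Hw; apply/norm_cvg0P; apply: (@squeeze_cvgr _ _ _ _ (cst 0) (fun n => n.+1%:R^-1)).
    - by apply: nearW => n; rewrite normr_ge0 ltW.
    - exact: cvg_cst.
    - exact: cvg_harmonic.
  rewrite -[X in _ --> X](subr0 0); apply: cvgB.
    by apply: h => n; case: (Hu n).
  by apply: h => n; case: (Hv n).
move=> c1.
have c2 : ((F (u n) - F (v n))%:E @[n --> \oo] --> 0%:E)%E.
  by apply: cvg_EFin; [exact: nearW|exact: F0].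
have := cvg_unique _ c1 c2.
by rewrite /Rintegral => ->.
Unshelve. all: by end_near. Qed.

Lemma local_FTC_global (F D : R -> R) : mu.-integrable setT (EFin \o D) ->
  (forall t0, exists2 r, 0 < r & forall x y, t0 - r < x -> x <= y -> y < t0 + r ->
     F y - F x = \int[mu]_(t in `]x, y]) D t) ->
  forall x y, x <= y -> F y - F x = \int[mu]_(t in `]x, y]) D t.
Proof.
move=> iD loc.
pose I y := \int[mu]_(t in `]-oo, y]) D t.
have IB x y : x <= y -> I y - I x = \int[mu]_(t in `]x, y]) D t.
  by move=> xy; rewrite /I Rintegral_itvB//; exact: integrableS iD.
have A0 t0 : is_derive t0 (1 : R) (F \- I) 0.
  have [r r0 H] := loc t0; apply: (@is_derive_quadratic _ _ _ 0 r) => // s.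
  rewrite ltr_norml mul0r => /andP[? ?].
  suff -> : (F \- I) s - (F \- I) t0 = 0 by rewrite normr0.
  have [st|/ltW ts] /= := leP s t0.
    have h1 := IB _ _ st; have h2 : F t0 - F s = \int[mu]_(t in `]s, t0]) D t by apply: H; lra.
    by lra.
  have h1 := IB _ _ ts; have h2 : F s - F t0 = \int[mu]_(t in `]t0, s]) D t by apply: H; lra.
  by lra.
move=> x y xy; rewrite -IB//.
by have /= := is_derive_0_is_cst x y A0; lra.
Qed.

Variables (U : set R) (q b dq db : R -> R).
Let V := U `&` [set t | 0 < q t].
Hypotheses (oU : open U) (q0 : forall t, U t -> 0 <= q t).
Hypothesis acq : forall x y, x <= y -> `[x, y]%classic `<=` U -> abs_cont_on x y q.
Hypothesis q_boundary : forall t, ~ U t -> forall e, 0 < e ->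
  \forall s \near t, U s -> q s < e.
Hypothesis acb : forall x y, x <= y -> `[x, y]%classic `<=` V -> abs_cont_on x y b.
Hypothesis dqE : forall t, V t -> derivable q t 1 -> 'D_1 q t = dq t.
Hypothesis dbE : {ae mu, forall t, V t -> 'D_1 b t = db t}.
Hypotheses (mb : measurable_fun V b) (mdb : measurable_fun V db) (mdq : measurable_fun V dq).
Hypothesis iq : mu.-integrable V (EFin \o q).
Hypothesis i1 : mu.-integrable V (fun t => (db t * q t)%:E).
Hypothesis i2 : mu.-integrable V (fun t => (b t * dq t)%:E).

Let nbhs_itv t (A : set R) : nbhs t A ->
  exists2 r, 0 < r & forall s, t - r < s -> s < t + r -> A s.
Proof.
move=> /nbhs_ballP[r /= r0 rA]; exists r => // s s1 s2.
by apply: rA; rewrite /ball/= ltr_norml; apply/andP; split; lra.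
Qed.

Let cq t : U t -> {for t, continuous q}.
Proof.
move=> Ut; have [r r0 HU] := nbhs_itv (open_nbhs_nbhs (conj oU Ut)).
have xy : t - r / 2 <= t + r / 2 by lra.
have sub : `[t - r / 2, t + r / 2]%classic `<=` U.
  by move=> s /=; rewrite in_itv/= => /andP[? ?]; apply: HU; lra.
have /abs_cont_continuous /(_ t) := acq xy sub.
have tt : t - r / 2 < t < t + r / 2 by apply/andP; split; lra.
rewrite /continuous_at /= clamp_id; last by case/andP: tt => t1 t2; rewrite (ltW t1) (ltW t2).
apply: cvg_trans; apply: near_eq_cvg.
by have := near_clamp q tt; apply: filterS => z /= <-.
Qed.

Let oV : open V.
Proof.
rewrite openE => t [Ut qt]; apply: filterI; first exact: open_nbhs_nbhs.
exact: cvgr_gt (cq Ut) _ qt.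
Qed.

Let mV : measurable (V : set (measurableTypeR R)).
Proof. exact: open_measurable. Qed.

Let mq : measurable_fun V q.
Proof. by case/integrableP : iq => /measurable_EFinP. Qed.

Let iG : mu.-integrable V (fun t => (`|db t * q t| + `|b t * dq t|)%:E).
Proof.
rewrite (_ : (fun _ => _) = (abse \o (fun t => (db t * q t)%:E)) \+
    (abse \o (fun t => (b t * dq t)%:E)))%E.
  by apply: integrableD => //; exact: integrable_abse.
by apply/funext => t /=; rewrite EFinD.
Qed.

Section fixed_truncation.
Variables (c e : R).
Hypotheses (c0 : 0 < c) (e0 : 0 < e).

Let F0 t := saturate c (b t) * soften e (q t).
Let D0 t := dsaturate c (b t) * db t * soften e (q t) +
            saturate c (b t) * (dsoften e (q t) * dq t).

Lemma measurable_truncated_derivative : measurable_fun V D0.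
Proof.
apply: measurable_funD.
  apply: measurable_funM; last exact: measurable_soften.
  by apply: measurable_funM => //; apply: measurable_dsaturate => //; exact: ltW.
apply: measurable_funM; first by apply: measurable_saturate => //; exact: ltW.
by apply: measurable_funM => //; apply: measurable_dsoften => // t [].
Qed.

Lemma truncated_derivative_bound t : V t -> `|D0 t| <= `|db t * q t| + `|b t * dq t|.
Proof.
move=> [Ut qt]; have [se0 /(_ (ltW qt)) se] := soften_le (q t) e0.
have /andP[ds0 ds1] := dsoften_le1 (q t) e0.
have sb := saturate_le (b t) (ltW c0); have db1 := dsaturate_le1 (b t) (ltW c0).
rewrite /D0; move: (saturate c (b t)) (dsaturate c (b t)) (soften e (q t))
  (dsoften e (q t)) se0 se ds0 ds1 sb db1 => A A' B B' B0 Bq B'0 B'1 Ab A'1.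
apply: le_trans (ler_normD _ _) _; rewrite !normrM (ger0_norm B0) (ger0_norm B'0) (gtr0_norm qt).
apply: lerD; first by apply: ler_pM; rewrite ?mulr_ge0// ler_piMl.
by apply: ler_pM; rewrite ?mulr_ge0// ler_piMl.
Qed.

Lemma integrable_truncated_derivative : mu.-integrable V (EFin \o D0).
Proof.
apply: (@le_integrable _ _ _ mu V mV _ (fun t => (`|db t * q t| + `|b t * dq t|)%:E)).
- apply/measurable_EFinP; exact: measurable_truncated_derivative.
- move=> t Vt /=; rewrite lee_fin [leRHS]ger0_norm ?addr_ge0//.
  exact: truncated_derivative_bound.
- exact: iG.
Qed.

Let iF0 : mu.-integrable V (EFin \o F0).
Proof.
apply: (@le_integrable _ _ _ mu V mV _ (fun t => ((1 + c^-1) * q t)%:E)).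
- apply/measurable_EFinP; apply: measurable_funM; last exact: measurable_soften.
  by apply: measurable_saturate => //; exact: ltW.
- move=> t [Ut qt] /=; have [se0 /(_ (ltW qt)) se] := soften_le (q t) e0.
  have sb := saturate_bounded (b t) c0.
  rewrite lee_fin /F0; move: (saturate c (b t)) sb => A sb.
  rewrite normrM (ger0_norm se0) (le_trans _ (ler_norm _))//.
  exact: ler_pM.
- by under eq_fun do rewrite EFinM; exact: integrableZl.
Qed.

Lemma truncated_integral_eq0 : \int[mu]_(t in V) D0 t = 0.
Proof.
pose F := F0 \_ V; pose D := D0 \_ V.
have iF : mu.-integrable setT (EFin \o F).
  by rewrite /F -restrict_EFin; apply/(integrable_mkcond _ _).1.
have iD : mu.-integrable setT (EFin \o D).
  rewrite /D -restrict_EFin; apply/(integrable_mkcond _ _).1 => //.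
  exact: integrable_truncated_derivative.
rewrite Rintegral_mkcond; apply: (compactly_approximated_integral iF iD).
apply: local_FTC_global => // t0.
have [[Ut0 qt0]|nV] := pselect (V t0).
  have [r r0 HV] := nbhs_itv (open_nbhs_nbhs (conj oV (conj Ut0 qt0))).
  exists r => // x y xt xy yt.
  have xyV : `[x, y]%classic `<=` V.
    by move=> s /=; rewrite in_itv/= => /andP[? ?]; apply: HV; lra.
  have xyU : `[x, y]%classic `<=` U by move=> s /xyV[].
  have mDxy : measurable_fun `]x, y[%classic D.
    by apply: measurable_funTS; case/integrableP : iD => /measurable_EFinP.
  have acF : abs_cont_on x y F.
    have acF0 : abs_cont_on x y ((saturate c \o b) \* (soften e \o q)).
      apply: abs_cont_onM => //.
        apply: (@abs_cont_on_lipschitz _ _ _ _ _ 1); last exact: acb.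
        by move=> u v; apply: saturate_lipschitz; exact: ltW.
      apply: (@abs_cont_on_lipschitz _ _ _ _ _ 1); last exact: acq.
      by move=> u v; exact: soften_lipschitz.
    rewrite /abs_cont_on (_ : _ \o _ = ((saturate c \o b) \* (soften e \o q)) \o clamp x y)//.
    apply/funext => z /=; rewrite /F patchE ifT// inE; apply: xyV => /=.
    by rewrite in_itv/=; exact: clamp_itv.
  have [|_] := abs_cont_on_FTC xy acF mDxy.
    have [gq [_ _ [A [mA A0 HA]]]] := abs_cont_on_is_derive xy (acq xy xyU).
    have [gb [_ _ [B [mB B0 HB]]]] := abs_cont_on_is_derive xy (acb xy xyV).
    have [C [mC C0 HC]] := dbE.
    have mAB := measurableU _ _ mA mB.
    exists (A `|` B `|` C); split; first exact: measurableU.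
      apply/eqP; rewrite eq_le measure_ge0 andbT.
      apply: le_trans (measureU2 _ mAB mC) _.
      have /= -> := C0; rewrite adde0; apply: le_trans (measureU2 _ mA mB) _.
      by have /= -> := A0; have /= -> := B0; rewrite adde0.
    move=> t /= Ht; have [At|nAt] := pselect (A t); first by left; left.
    have [Bt|nBt] := pselect (B t); first by left; right.
    have [Ct|nCt] := pselect (C t); first by right.
    exfalso; apply: Ht => xty _.
    have txy : `[x, y]%classic t.
      by rewrite /= in_itv/=; case/andP: xty => xt' ty'; rewrite (ltW xt') (ltW ty').
    have Vt : V t := xyV t txy.
    have dqt : is_derive t (1 : R) q (dq t).
      have [dq1 _] : derivable q t 1 /\ 'D_1 q t = gq t.
        by apply: contrapT => h; apply: nAt; apply: HA => /= /(_ xty).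
      by apply: DeriveDef => //; exact: dqE.
    have dbt : is_derive t (1 : R) b (db t).
      have [db1 _] : derivable b t 1 /\ 'D_1 b t = gb t.
        by apply: contrapT => h; apply: nBt; apply: HB => /= /(_ xty).
      apply: DeriveDef => //; apply: contrapT => h; apply: nCt; apply: HC => /=.
      by move=> /(_ Vt).
    have h1 := is_derive1_comp (is_derive_saturate (b t) (ltW c0)) dbt.
    have h2 := is_derive1_comp (is_derive_soften (q t) e0) dqt.
    have [_ h12] := is_deriveM h1 h2.
    transitivity ('D_1 ((saturate c \o b) * (soften e \o q)) t).
      apply: near_eq_derive; near=> z.
      rewrite /F patchE ifT//= inE; near: z; exact: open_nbhs_nbhs.
    by rewrite h12 /D patchE ifT ?inE// /D0 /GRing.scale /=; ring.
  move=> ->; rewrite Rintegral_itv_bndo_bndc//.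
  exact: integrableS iD.
have [r r0 HV] : exists2 r, 0 < r & forall s, t0 - r < s -> s < t0 + r -> V s -> q s < e.
  have [Ut0|nU] := pselect (U t0).
    have qt0 : q t0 = 0.
      by apply/eqP; rewrite eq_le q0// andbT leNgt; apply/negP => ?; exact: nV.
    have [r r0 H] : exists2 r, 0 < r & forall s, t0 - r < s -> s < t0 + r -> q s < e.
      by apply: nbhs_itv; apply: cvgr_lt (cq Ut0) _ _; rewrite qt0.
    by exists r => // s s1 s2 _; exact: H.
  have [r r0 H] := nbhs_itv (q_boundary nU e0).
  by exists r => // s s1 s2 [Us _]; exact: H.
exists r => // x y xt xy yt.
have Fz s : t0 - r < s -> s < t0 + r -> F s = 0 /\ D s = 0.
  move=> s1 s2; rewrite /F /D !patchE; case: ifPn => //; rewrite inE => Vs.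
  have qs := HV _ s1 s2 Vs.
  by rewrite /F0 /D0 /soften /dsoften !ifT ?(ltW qs)// !mulr0 mul0r mulr0 addr0.
rewrite (Fz x _ _).1 ?(Fz y _ _).1; [|lra..].
rewrite subrr; have -> : \int[mu]_(t in `]x, y]) D t = \int[mu]_(t in `]x, y]) (cst 0 t).
  apply: eq_Rintegral => t; rewrite inE /= in_itv/= => /andP[? ?].
  by apply: (Fz t _ _).2; lra.
by rewrite Rintegral_cst//= mul0r.
Unshelve. all: by end_near. Qed.

End fixed_truncation.

Theorem integral_product_derivative_eq0 :
  \int[mu]_(t in V) (db t * q t + b t * dq t) = 0.
Proof.
pose e n : R := n.+1%:R^-1.
have e0 n : 0 < e n by rewrite invr_gt0.
have ecvg : e n @[n --> \oo] --> (0 : R) by exact: cvg_harmonic.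
pose f n t := dsaturate (e n) (b t) * db t * soften (e n) (q t) +
            saturate (e n) (b t) * (dsoften (e n) (q t) * dq t).
have : (\int[mu]_(t in V) (f n t)%:E @[n --> \oo] -->
        \int[mu]_(t in V) (db t * q t + b t * dq t)%:E)%E.
  apply: (@dominated_cvg _ _ _ mu V mV (fun n t => (f n t)%:E) _ (fun t => (`|db t * q t| + `|b t * dq t|)%:E)) => //.
  - move=> n; apply/measurable_EFinP; exact: measurable_truncated_derivative.
  - move=> t [Ut qt].
    have [s1 s2] := cvg_saturate (b t) ecvg; have [s3 s4] := cvg_soften qt ecvg.
    apply: cvg_EFin; first exact: nearW.
    have cst_cvg (x : R) : x @[n --> \oo] --> x by exact: cvg_cst.
    have h := cvgD (cvgM (cvgM s2 (cst_cvg (db t))) s3)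
                 (cvgM s1 (cvgM s4 (cst_cvg (dq t)))).
    rewrite !mul1r in h; exact: h.
  - move=> n t Vt; rewrite lee_fin; exact: truncated_derivative_bound.
have -> : (fun n => \int[mu]_(t in V) (f n t)%:E)%E = fun=> 0%E.
  apply/funext => n; rewrite -[LHS]fineK.
    by congr (_%:E); exact: truncated_integral_eq0.
  by apply: integrable_fin_num => //; exact: integrable_truncated_derivative.
move=> /cvg_lim; rewrite lim_cst// => h.
by rewrite /Rintegral -h.
Qed.

End integration_by_parts_on_a_line.

Section measurable_column_vectors.
Context {R : realType}.

Definition closed_cube n (c : 'cV[R]_n) (r : R) : set 'cV[R]_n :=
  [set v | forall i, c i ord0 - r <= v i ord0 <= c i ord0 + r].

Definition open_cube n (c : 'cV[R]_n) (r : R) : set 'cV[R]_n :=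
  [set v | forall i, c i ord0 - r < v i ord0 < c i ord0 + r].

Lemma measurable_coord n (i : 'I_n) : measurable_fun [set: 'cV[R]_n] (fun v => v i ord0).
Proof. exact: measurable_mx_coord. Qed.

Lemma measurable_open_cube n (c : 'cV[R]_n) r : measurable (open_cube c r).
Proof.
have -> : open_cube c r = \bigcap_(i in [set: 'I_n])
    ((fun v : 'cV[R]_n => v i ord0) @^-1` `]c i ord0 - r, c i ord0 + r[).
  by apply/seteqP; split => v /= H i; have := H i; rewrite /= in_itv/= => // /(_ I).
apply: fin_bigcap_measurable => [|i _]; first exact: finite_finset.
by rewrite -[X in measurable X]setTI; exact: measurable_coord.
Qed.

Lemma nbhs_cubeP n (x : 'cV[R]_n) (A : set 'cV[R]_n) :
  nbhs x A <-> exists2 e, 0 < e & open_cube x e `<=` A.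
Proof.
split => [/nbhs_ballP[e /= e0 eA]|[e e0 eA]].
  exists e => // v Hv; apply: eA; split => // i j; rewrite ord1 /ball/=.
  by have /andP[? ?] := Hv i; rewrite ltr_norml; apply/andP; split; lra.
apply/nbhs_ballP; exists e => //= v [_ Hv]; apply: eA => i.
have := Hv i ord0; rewrite /ball/= ltr_norml => /andP[? ?].
by apply/andP; split; lra.
Qed.

Lemma open_open_cube n (c : 'cV[R]_n) r : open (open_cube c r).
Proof.
rewrite openE => x Hx.
pose f (e : R) := forall i, c i ord0 - r < x i ord0 - e /\ x i ord0 + e < c i ord0 + r.
suff [e e0 He] : exists2 e, 0 < e & f e.
  apply/nbhs_cubeP; exists e => // v Hv i; have [? ?] := He i.
  by have /andP[? ?] := Hv i; apply/andP; split; lra.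
pose m := \big[Num.min/1]_i Num.min (x i ord0 - (c i ord0 - r)) (c i ord0 + r - x i ord0).
have m0 : 0 < m.
  apply: lt_bigmin => // i _; have /andP[? ?] := Hx i.
  by rewrite lt_min; apply/andP; split; lra.
exists (m / 2); first by lra.
move=> i; have : m <= Num.min (x i ord0 - (c i ord0 - r)) (c i ord0 + r - x i ord0).
  exact: bigmin_le_cond.
by rewrite le_min => /andP[? ?]; split; lra.
Qed.

Definition rat_cube n (p : 'cV[rat]_n * rat) : 'cV[R]_n * R :=
  (map_mx ratr p.1, ratr p.2).

(** Every point of an open set lies in a rational open cube whose closure is
    contained in the set; there are countably many such cubes. *)
Lemma rat_cube_nbhs n (x : 'cV[R]_n) (A : set 'cV[R]_n) : nbhs x A ->
  exists p, closed_cube (rat_cube p).1 (rat_cube p).2 `<=` A /\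
            open_cube (rat_cube p).1 (rat_cube p).2 x.
Proof.
move=> /nbhs_cubeP[e e0 eA].
have e4 : 0 < e / 4 by lra.
have e2 : e / 4 < e / 2 by lra.
have [r /andP[/=]] := rat_in_itvoo e2; rewrite !bnd_simp => r1 r2.
have /choice[c Hc] : forall i, exists c : rat, x i ord0 - e / 4 < ratr c < x i ord0 + e / 4.
  move=> i; have h : x i ord0 - e / 4 < x i ord0 + e / 4 by lra.
  have [q /andP[/=]] := rat_in_itvoo h; rewrite !bnd_simp => q1 q2.
  by exists q; rewrite q1 q2.
exists (\col_i c i, r); split => [v Hv|] /=.
  apply: eA => i; have := Hv i; rewrite /= !mxE => /andP[? ?].
  by have /andP[? ?] := Hc i; apply/andP; split; lra.
move=> i; rewrite !mxE; have /andP[? ?] := Hc i.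
by apply/andP; split; lra.
Qed.

Lemma open_bigcup_cubes n (A : set 'cV[R]_n) : open A ->
  A = \bigcup_(p in [set p | closed_cube (rat_cube p).1 (rat_cube p).2 `<=` A])
        open_cube (rat_cube p).1 (rat_cube p).2.
Proof.
move=> oA; apply/seteqP; split => [x Ax|x [p /= pA xp]].
  have [p [pA px]] := rat_cube_nbhs (open_nbhs_nbhs (conj oA Ax)).
  by exists p.
by apply: pA => i; have /andP[? ?] := xp i; rewrite !ltW.
Qed.

Lemma bigcup_countType_measurable d (T : sigmaRingType d) (I : countType)
    (P : set I) (F : I -> set T) :
  (forall i, P i -> measurable (F i)) -> measurable (\bigcup_(i in P) F i).
Proof.
move=> mF; rewrite bigcup_mkcond; apply: countable_bigcupT_measurable.
  exact: countableP.
by move=> i; case: ifPn => // /set_mem; exact: mF.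
Qed.

Lemma open_measurable_cV n (A : set 'cV[R]_n) : open A -> measurable A.
Proof.
move=> /open_bigcup_cubes ->; apply: bigcup_countType_measurable => p _.
exact: measurable_open_cube.
Qed.

Lemma measurable_fun_bigcup_countType d d' (T : measurableType d) (T' : measurableType d')
    (I : countType) (P : set I) (F : I -> set T) (f : T -> T') :
  (forall i, P i -> measurable (F i)) -> (forall i, P i -> measurable_fun (F i) f) ->
  measurable_fun (\bigcup_(i in P) F i) f.
Proof.
move=> mF mf _ Y mY; rewrite setI_bigcupl; apply: bigcup_countType_measurable => i Pi.
by apply: mf => //; exact: mF.
Qed.

Lemma measurable_fun_countable_param d d' (T : measurableType d) (T' : measurableType d')
    (I : countType) (h : T -> I) (F : I -> T -> T') :
  (forall i, measurable (h @^-1` [set i])) -> (forall i, measurable_fun setT (F i)) ->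
  measurable_fun setT (fun x => F (h x) x).
Proof.
move=> mh mF; have -> : [set: T] = \bigcup_(i in [set: I]) (h @^-1` [set i]).
  by apply/seteqP; split => // x _; exists (h x).
apply: measurable_fun_bigcup_countType => // i _.
apply: (eq_measurable_fun (F i)); last exact: measurable_funTS.
by move=> x; rewrite inE /= => ->.
Qed.

(** Continuity along each coordinate line. *)
Definition line_continuous n (D : set 'cV[R]_n) (f : 'cV[R]_n -> R) : Prop :=
  forall x, D x -> forall i : 'I_n,
    {for 0, continuous (fun s : R => f (x + s *: delta_mx i ord0))}.

Lemma line_continuousT n (f : 'cV[R]_n -> R) : line_continuous setT f ->
  forall x i, continuous (fun s : R => f (x + s *: delta_mx i ord0)).
Proof.
move=> cf x i s.
have := cf (x + s *: delta_mx i ord0) I i; rewrite /prop_for /continuous_at /= scale0r addr0 => h.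
have ts : (t - s) @[t --> s] --> (0 : R).
  by rewrite -(subrr s); apply: cvgB; [exact: cvg_id|exact: cvg_cst].
have := cvg_comp _ _ ts h; rewrite /continuous_at; apply: cvg_trans.
by apply: near_eq_cvg; apply: nearW => t /=; rewrite -addrA -scalerDl subrKC.
Qed.

Lemma cons_cV_line0 n (x s : R) (y : 'cV[R]_n) :
  cons_cV (x + s, y) = cons_cV (x, y) + s *: delta_mx ord0 ord0.
Proof.
apply/colP => i; rewrite !mxE.
by case: (unliftP ord0 i) => [j ->|->]; rewrite ?eqxx ?andbT/=; ring.
Qed.

Lemma cons_cV_line n (x s : R) (y : 'cV[R]_n) (i : 'I_n) :
  cons_cV (x, y + s *: delta_mx i ord0) = cons_cV (x, y) + s *: delta_mx (lift ord0 i) ord0.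
Proof.
apply/colP => j; rewrite !mxE.
case: (unliftP ord0 j) => [k ->|->].
  by rewrite ?liftK ?mxE (inj_eq (@lift_inj _ ord0)) !andbT.
by rewrite ?unlift_none ?mxE (_ : ord0 == lift ord0 i = false)// mulr0 addr0.
Qed.

Lemma line_continuous_measurable n (f : 'cV[R]_n -> R) :
  line_continuous setT f -> measurable_fun setT f.
Proof.
elim: n f => [|n IH] f cf.
  by rewrite (_ : f = cst (f 0))//; apply/funext => v; rewrite (flatmx0 v).
pose fl k (v : 'cV[R]_n.+1) : int := Num.floor (v ord0 ord0 * k.+1%:R).
pose F k (z : int) (v : 'cV[R]_n.+1) := f (cons_cV (z%:~R / k.+1%:R, (uncons_cV v).2)).
have mF k z : measurable_fun setT (F k z).
  apply: (@measurableT_comp _ _ _ _ _ _ (fun y => f (cons_cV (z%:~R / k.+1%:R, y)))).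
    apply: IH => y _ i.
    rewrite (_ : (fun s => _) = fun s => f (cons_cV (z%:~R / k.+1%:R, y) + s *: delta_mx (lift ord0 i) ord0)).
      exact: line_continuousT.
    by apply/funext => s; rewrite cons_cV_line.
  exact: measurableT_comp measurable_snd (@measurable_uncons_cV R n).
apply: (@measurable_fun_cvg _ _ _ _ (fun k v => F k (fl k v) v)) => [k|v _].
  apply: measurable_fun_countable_param => // z.
  have -> : fl k @^-1` [set z] =
      (fun v : 'cV[R]_n.+1 => v ord0 ord0 * k.+1%:R) @^-1` `[z%:~R, (z + 1)%:~R[.
    by apply/seteqP; split => v /=; rewrite in_itv/=; [move=> <-; rewrite floor_itv|
       move=> /floor_def].
  rewrite -[X in measurable X]setTI.
  by apply: (measurable_funM (measurable_coord _) (measurable_cst _)).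
have h := @line_continuousT _ f cf (cons_cV (0, (uncons_cV v).2)) ord0.
have hE s : f (cons_cV (0, (uncons_cV v).2) + s *: delta_mx ord0 ord0) = f (cons_cV (s, (uncons_cV v).2)).
  by rewrite -cons_cV_line0 add0r.
have := h (v ord0 ord0); rewrite /continuous_at /= hE.
have -> : cons_cV (v ord0 ord0, (uncons_cV v).2) = v.
  apply/colP => i; rewrite !mxE.
  by case: (unliftP ord0 i) => [j ->|->]; rewrite ?mxE.
move=> hv.
have rk : (fl k v)%:~R / k.+1%:R @[k --> \oo] --> v ord0 ord0.
  apply: (@squeeze_cvgr _ _ _ _ (fun k => v ord0 ord0 - k.+1%:R^-1) (cst (v ord0 ord0))).
  - apply: nearW => k; have k0 : 0 < k.+1%:R :> R by [].
    rewrite ler_pdivlMr// ler_pdivrMr// mulrBl mulVf ?gt_eqF// /fl.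
    have /andP[h1 h2] := floor_itv (v ord0 ord0 * k.+1%:R).
    by rewrite h1 andbT lerBlDr ltW// -intrD1.
  - rewrite -[X in _ --> X]subr0; apply: cvgB; [exact: cvg_cst|exact: cvg_harmonic].
  - exact: cvg_cst.
have := cvg_comp _ _ rk hv; rewrite /F.
rewrite (_ : _ \o _ = fun k => f (cons_cV ((fl k v)%:~R / k.+1%:R, (uncons_cV v).2)))//.
by apply/funext => k /=; rewrite hE.
Qed.

End measurable_column_vectors.

Section line_continuous_on_open_sets.
Context {R : realType}.

Lemma exists_harmonic_lt (r : R) : 0 < r -> exists m : nat, m.+1%:R^-1 < r.
Proof.
move=> r0; have ri : 0 <= r^-1 by rewrite invr_ge0 ltW.
exists (Num.bound r^-1); rewrite -[ltRHS]invrK ltf_pV2 ?posrE ?invr_gt0//.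
by apply: lt_trans (archi_boundP ri) _; rewrite ltr_nat.
Qed.

Definition clamp_cV n (c : 'cV[R]_n) (r : R) (v : 'cV[R]_n) : 'cV[R]_n :=
  \col_i clamp (c i ord0 - r) (c i ord0 + r) (v i ord0).

Lemma clamp_cV_closed_cube n (c : 'cV[R]_n) r v : 0 <= r ->
  closed_cube c r (clamp_cV c r v).
Proof. by move=> r0 i; rewrite mxE; apply: clamp_itv; lra. Qed.

Lemma clamp_cV_id n (c : 'cV[R]_n) r v : closed_cube c r v -> clamp_cV c r v = v.
Proof. by move=> cv; apply/colP => i; rewrite mxE clamp_id. Qed.

Lemma clamp_lipschitz (a b y z : R) : `|clamp a b y - clamp a b z| <= `|y - z|.
Proof.
wlog zy : y z / z <= y.
  move=> W; have [zy|/ltW yz] := leP z y; first exact: W.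
  by rewrite distrC [leRHS]distrC; exact: W.
have := clamp_lip a b zy; have := clamp_homo a b zy => h1 h2.
by rewrite !ger0_norm; lra.
Qed.

Lemma line_continuous_clamp n (D : set 'cV[R]_n) f c r : 0 <= r ->
  closed_cube c r `<=` D -> line_continuous D f ->
  line_continuous setT (f \o clamp_cV c r).
Proof.
move=> r0 cD cf x _ i.
pose sg (s : R) := clamp (c i ord0 - r) (c i ord0 + r) (x i ord0 + s)
             - clamp (c i ord0 - r) (c i ord0 + r) (x i ord0).
have shiftE s : clamp_cV c r (x + s *: delta_mx i ord0) =
    clamp_cV c r x + sg s *: delta_mx i ord0.
  apply/colP => j; rewrite !mxE; have [->|ji] := eqVneq j i.
    by rewrite /sg eqxx /= !mulr1; lra.
  by rewrite /= !mulr0 !addr0.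
have sg0 : sg s @[s --> 0] --> (0 : R).
  apply/norm_cvg0P; apply: (@squeeze_cvgr _ _ _ _ (cst 0) (fun s : R => `|s|)).
  - apply: nearW => s; rewrite normr_ge0 /= /sg.
    by apply: le_trans (clamp_lipschitz _ _ _ _) _; rewrite addrC addKr.
  - exact: cvg_cst.
  - have := @norm_continuous _ R (0 : R); rewrite /continuous_at normr0; exact.
have Dx : D (clamp_cV c r x) by apply: cD; exact: clamp_cV_closed_cube.
have := cf _ Dx i; rewrite /prop_for /continuous_at /= !scale0r !addr0 => h.
have := cvg_comp _ _ sg0 h; apply: cvg_trans.
by apply: near_eq_cvg; apply: nearW => s /=; rewrite shiftE.
Qed.

Lemma rat_cube_local d (T' : measurableType d) n (D : set 'cV[R]_n) (F : 'cV[R]_n -> T') :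
  open D ->
  (forall c r, 0 <= r -> closed_cube c r `<=` D -> measurable_fun (open_cube c r) F) ->
  measurable_fun D F.
Proof.
move=> oD H; rewrite (open_bigcup_cubes oD).
apply: measurable_fun_bigcup_countType => p pD; first exact: measurable_open_cube.
have [r0|r0] := leP 0 (@rat_cube R n p).2; first exact: H.
case: n D F oD H p pD r0 => [|n] D F oD H p pD r0.
  move=> _ Y mY.
  have [y|y] := pselect (Y (F 0)).
    rewrite (_ : _ `&` _ = open_cube (rat_cube p).1 (rat_cube p).2); first exact: measurable_open_cube.
    by apply/seteqP; split => [v []//|v Hv]; split => //=; rewrite (flatmx0 v).
  rewrite (_ : _ `&` _ = set0)//; apply/seteqP; split => // v [_ /=].
  by rewrite (flatmx0 v).
have -> : open_cube (rat_cube p).1 (rat_cube p).2 = set0 :> set 'cV[R]_n.+1.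
  by apply/seteqP; split => // v /(_ ord0) /andP[]; lra.
by move=> _ Y mY; rewrite set0I.
Qed.

Lemma line_continuous_measurable_on n (D : set 'cV[R]_n) f : open D ->
  line_continuous D f -> measurable_fun D f.
Proof.
move=> oD cf; apply: rat_cube_local => // c r r0 cD.
have mf := line_continuous_measurable (line_continuous_clamp r0 cD cf).
apply: (eq_measurable_fun (f \o clamp_cV c r)); last exact: measurable_funTS.
move=> v; rewrite inE => Hv /=; rewrite clamp_cV_id// => i.
by have /andP[? ?] := Hv i; apply/andP; split; lra.
Qed.

Section partial_derivative.
Variables (n : nat) (f : 'cV[R]_n -> R) (i : 'I_n).
Hypothesis cf : line_continuous setT f.

Let e : 'cV[R]_n := delta_mx i ord0.
Let Q (h : R) (v : 'cV[R]_n) : R := h^-1 * (f (v + h *: e) - f v).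

Let quotientE v : (fun h : R => h^-1 *: ((f \o shift v) (h *: e) - f v)) = Q^~ v.
Proof. by apply/funext => h; rewrite /= [h *: e + v]addrC. Qed.

Let derivableE v : derivable f v e = cvg (Q h v @[h --> 0^']).
Proof. by rewrite /derivable quotientE. Qed.

Let deriveE v : 'D_e f v = lim (Q h v @[h --> 0^']).
Proof. by rewrite /derive quotientE. Qed.

Let mQ h : measurable_fun setT (Q h).
Proof.
apply: measurable_funM => //; apply: measurable_funB.
  apply: line_continuous_measurable => v _ j.
  have := @line_continuousT _ _ f cf (v + h *: e) j 0; rewrite /continuous_at /prop_for /=.
  rewrite /continuous_at !scale0r !addr0; apply: cvg_trans; apply: near_eq_cvg; apply: nearW => s /=.
  by rewrite addrAC.
exact: line_continuous_measurable.
Qed.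

Let cQ v h : h != 0 -> Q s v @[s --> h] --> Q h v.
Proof.
move=> h0; apply: cvgM; first exact: cvgV.
by apply: cvgB; [exact: line_continuousT|exact: cvg_cst].
Qed.

Let u (a : nat) : R := ratr (odflt 0 (unpickle a : option rat)).

Let uE (x : rat) : u (pickle x) = ratr x.
Proof. by rewrite /u pickleK. Qed.

Let small (m : nat) (h : R) := 0 < `|h| < m.+1%:R^-1.

Let E : set 'cV[R]_n := \bigcap_k \bigcup_m \bigcap_a \bigcap_b
  [set v | small m (u a) -> small m (u b) -> `|Q (u a) v - Q (u b) v| <= k.+1%:R^-1].

Let mE : measurable E.
Proof.
apply: bigcapT_measurable => k; apply: bigcupT_measurable => m.
apply: bigcapT_measurable => a; apply: bigcapT_measurable => b.
have [sa|sa] := boolP (small m (u a)); last first.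
  by rewrite (_ : mkset _ = setT)//; apply/seteqP; split => // v _ /=.
have [sb|sb] := boolP (small m (u b)); last first.
  by rewrite (_ : mkset _ = setT)//; apply/seteqP; split => // v _ /=.
rewrite (_ : mkset _ = (fun v => `|Q (u a) v - Q (u b) v|) @^-1` `]-oo, k.+1%:R^-1]); last first.
  by apply/seteqP; split => v /=; rewrite in_itv/=; [move=> /(_ isT isT)|].
rewrite -[X in measurable X]setTI.
by apply: (measurableT_comp (@normr_measurable R setT) (measurable_funB (mQ _) (mQ _))).
Qed.

Let derivable_EP v : derivable f v e <-> E v.
Proof.
rewrite derivableE; split.
  move=> /cvg_ex[l /= /cvgrPdist_lt Ql] k _.
  have e0 : 0 < (k.+1%:R : R)^-1 / 2 by rewrite divr_gt0.
  have := Ql _ e0; rewrite near_withinE => /nbhs_ballP[r /= r0 Hr].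
  have [m mr] := exists_harmonic_lt r0.
  exists m => // a _ b _ /= /andP[a0 am] /andP[b0 bm].
  have h s : 0 < `|s| -> `|s| < m.+1%:R^-1 -> `|l - Q s v| < k.+1%:R^-1 / 2.
    move=> s0 sm; apply: Hr; last by rewrite -normr_gt0.
    by rewrite /ball/= sub0r normrN; exact: lt_trans sm mr.
  have := h _ a0 am; have := h _ b0 bm.
  move: (k.+1%:R^-1) => dk.
  have := ler_distD l (Q (u a) v) (Q (u b) v); rewrite (distrC (Q (u a) v) l); lra.
move=> Ev; apply: cauchy_cvg; apply: cauchy_exP => eps eps0.
have eps2 : 0 < eps / 2 by lra.
have [k ke] := exists_harmonic_lt eps2.
have [m _ Hm] := Ev k I.
have m0 : 0 < (m.+1%:R : R)^-1 by rewrite invr_gt0.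
have dense (h : R) (A : set R) : nbhs h A -> exists a, A (u a).
  move=> /nbhs_ballP[r /= r0 rA].
  have hr : h < h + r by lra.
  have [q /andP[/=]] := rat_in_itvoo hr; rewrite !bnd_simp => q1 q2.
  exists (pickle q); rewrite uE; apply: rA; rewrite /ball/= ltr_norml; apply/andP; split; lra.
have nsmall h : small m h -> \forall s \near h, small m s.
  move=> /andP[h0 hm]; have ch := @norm_continuous _ R h.
  near=> s; apply/andP; split; near: s; [exact: cvgr_gt ch _ h0|exact: cvgr_lt ch _ hm].
have [b sb] : exists b, small m (u b).
  have : small m (m.+1%:R^-1 / 2).
    rewrite /small; move: (m.+1%:R^-1) m0 => mm m0.
    by rewrite ger0_norm; [apply/andP; split; lra|lra].
  by move=> /nsmall /dense.
exists (Q (u b) v); rewrite /nbhs /=; near=> h.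
have sh : small m h.
  apply/andP; split.
    by rewrite normr_gt0; near: h; exact: nbhs_dnbhs_neq.
  by near: h; exact: dnbhs0_lt.
have h0 : h != 0 by move: sh => /andP[]; rewrite normr_gt0.
have [a [sa Qa]] : exists a, small m (u a) /\ `|Q h v - Q (u a) v| < eps / 2.
  apply: (dense h (fun s => small m s /\ `|Q h v - Q s v| < eps / 2)).
  apply: filterI; first exact: nsmall.
  by have := @cQ v h h0; move/cvgrPdist_lt; apply; lra.
have := Hm a I b I sa sb => Qab; rewrite /ball/=.
have := ler_distD (Q (u a) v) (Q (u b) v) (Q h v).
rewrite (distrC (Q (u b) v) (Q (u a) v)) (distrC (Q (u a) v) (Q h v)).
by move: (k.+1%:R^-1) ke Qab => kk ke Qab; lra.
Unshelve. all: by end_near. Qed.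

Lemma measurable_partial_derivativeT : measurable_fun setT (fun v => 'D_e f v).
Proof.
apply: (@measurable_fun_cvg _ _ _ _ (fun k v => \1_E v * Q (k.+1%:R^-1) v)) => [k|v _].
  by apply: measurable_funM => //; exact: measurable_indic.
have [Ev|nE] := pselect (E v).
  have dv : derivable f v e by exact/derivable_EP.
  have := dv; rewrite derivableE => cv; rewrite deriveE.
  have h : Q (k.+1%:R^-1) v @[k --> \oo] --> lim (Q h v @[h --> 0^']).
    move/cvgr_dnbhsP : cv; apply; split; first by move=> k; rewrite invr_eq0 pnatr_eq0.
    exact: cvg_harmonic.
  rewrite (_ : (fun k => _) = (fun k => Q (k.+1%:R^-1) v))//.
  by apply/funext => k; rewrite indicE mem_set// mul1r.
have nd : ~ derivable f v e by move=> /derivable_EP.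
rewrite deriveE dvgP -?derivableE//.
rewrite (_ : (fun k => _) = cst 0); first exact: cvg_cst.
by apply/funext => k; rewrite indicE memNset// mul0r.
Qed.

End partial_derivative.

Lemma measurable_partial_derivative n (D : set 'cV[R]_n) f i : open D ->
  line_continuous D f -> measurable_fun D (fun v => 'D_(delta_mx i ord0) f v).
Proof.
move=> oD cf; apply: rat_cube_local => // c r r0 cD.
have mf := measurable_partial_derivativeT i (line_continuous_clamp r0 cD cf).
apply: (eq_measurable_fun (fun v => 'D_(delta_mx i ord0) (f \o clamp_cV c r) v)); last exact: measurable_funTS.
move=> v; rewrite inE => Hv /=; apply: near_eq_derive.
have := open_nbhs_nbhs (conj (@open_open_cube _ _ c r) Hv); apply: filterS => w Hw /=.
rewrite clamp_cV_id// => j.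
by have /andP[? ?] := Hw j; apply/andP; split; lra.
Qed.

End line_continuous_on_open_sets.

Section integration_along_lines.
Context {R : realType}.
Local Notation mu := (@lebesgue_measure R).

Lemma integrable_cV_cons n (f : 'cV[R]_n.+1 -> \bar R) :
  (lebesgue_cV R n.+1).-integrable setT f ->
  (mu \x lebesgue_cV R n)%E.-integrable setT (f \o @cons_cV R n).
Proof.
move=> /integrableP[mf fi]; have mc := @measurable_cons_cV R n.
apply/integrableP; split; first exact: measurableT_comp mf mc.
apply: le_lt_trans fi.
have := @ge0_integral_pushforward _ _ _ _ R _ mc (mu \x lebesgue_cV R n)%E setT (abse \o f) measurableT.
rewrite preimage_setT => <-; [|exact: measurableT_comp|by move=> y _ /=; exact: abse_ge0].
by rewrite le_eqVlt; apply/orP; left; apply/eqP; apply: eq_measure_integral.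
Qed.

Lemma integral_cV_cons n (f : 'cV[R]_n.+1 -> \bar R) :
  (lebesgue_cV R n.+1).-integrable setT f ->
  (\int[lebesgue_cV R n.+1]_v f v =
   \int[mu \x lebesgue_cV R n]_p (f \o @cons_cV R n) p)%E.
Proof.
move=> fi; have mc := @measurable_cons_cV R n.
have := @integral_pushforward _ _ _ _ R _ mc (mu \x lebesgue_cV R n)%E setT f.
rewrite preimage_setT => <-//; last 2 first.
- by case/integrableP : fi.
- exact: integrable_cV_cons.
Qed.

(** Fubini in the [i]-th coordinate. *)
Lemma integral_eq0_of_lines n (i : 'I_n) (F G : 'cV[R]_n -> R) :
  measurable_fun setT F -> (forall v, `|F v| <= G v) ->
  (lebesgue_cV R n).-integrable setT (EFin \o G) ->
  (forall c, mu.-integrable setT (fun s => (G (c + s *: delta_mx i ord0))%:E) ->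
    (\int[mu]_s (F (c + s *: delta_mx i ord0))%:E = 0)%E) ->
  (\int[lebesgue_cV R n]_v (F v)%:E = 0)%E.
Proof.
elim: n i F G => [[]//|n IH] i F G mF FG iG lines.
have iF : (lebesgue_cV R n.+1).-integrable setT (EFin \o F).
  apply: le_integrable iG => //; first exact/measurable_EFinP.
  by move=> v _ /=; rewrite lee_fin (le_trans (FG v))// ler_norm.
have iFc := integrable_cV_cons iF; have iGc := integrable_cV_cons iG.
rewrite (integral_cV_cons iF).
case: (unliftP ord0 i) => [j ij|i0].
- rewrite -integral12_prod_meas1//.
  rewrite -(integral0 mu setT); apply: ae_eq_integral => //.
    exact: (measurable_fubini_F iFc).
  have [A [mA A0 HA]] := ae_integrable1 iGc; exists A; split => // x /= Hx.
  apply: HA => /= iGx; apply: Hx => _; rewrite /fubini_F.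
  apply: (IH j (fun y => F (cons_cV (x, y))) (fun y => G (cons_cV (x, y)))) => //.
    have mx : measurable_fun setT (fun y : 'cV[R]_n => cons_cV (x, y)).
      exact: measurableT_comp (@measurable_cons_cV R n) (pair1_measurable x).
    exact: measurableT_comp mF mx.
  move=> c h.
  have cE s : cons_cV (x, c + s *: delta_mx j ord0) = cons_cV (x, c) + s *: delta_mx i ord0.
    by rewrite cons_cV_line -ij.
  have -> : (fun s => (F (cons_cV (x, c + s *: delta_mx j ord0)))%:E) =
      (fun s => (F (cons_cV (x, c) + s *: delta_mx i ord0))%:E).
    by apply/funext => s; rewrite cE.
  apply: lines; rewrite (_ : (fun s => _) =
      (fun s => (G (cons_cV (x, c + s *: delta_mx j ord0)))%:E))//.
  by apply/funext => s; rewrite cE.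
- rewrite -integral21_prod_meas1//.
  rewrite -(integral0 (lebesgue_cV R n) setT); apply: ae_eq_integral => //.
    exact: (measurable_fubini_G iFc).
  have [A [mA A0 HA]] := ae_integrable2 iGc; exists A; split => // y /= Hy.
  apply: HA => /= iGy; apply: Hy => _; rewrite /fubini_G.
  have cE x : cons_cV (x, y) = cons_cV (0, y) + x *: delta_mx i ord0.
    by rewrite i0 -cons_cV_line0 add0r.
  rewrite (_ : (fun x => _) = (fun x => (F (cons_cV (0, y) + x *: delta_mx i ord0))%:E)).
    apply: lines; rewrite (_ : (fun s => _) = (fun x => (EFin \o G \o @cons_cV R n) (x, y)))//.
    by apply/funext => x /=; rewrite (cE x).
  by apply/funext => x /=; rewrite (cE x).
Qed.

End integration_along_lines.

Section density.
Context (R : realType) dT (T : measurableType dT).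
Variables (mu P : {measure set T -> \bar R}) (D : set T) (f : T -> R).
Hypotheses (mD : measurable D) (fP : is_density mu D P f).

Import HBNNSimple.

Lemma ge0_integral_density (F : T -> R) : measurable_fun D F ->
  (forall x, D x -> 0 <= F x) ->
  (\int[P]_(x in D) (F x)%:E = \int[mu]_(x in D) (F x * f x)%:E)%E.
Proof.
move=> mF F0; have [mf f0 Pf] := fP.
have mFE : measurable_fun D (EFin \o F) by apply/measurable_EFinP.
pose s_ := nnsfun_approx mD mFE.
have cvgs x : D x -> (s_ n x)%:E @[n --> \oo] --> (F x)%:E.
  by move=> Dx; apply: cvg_nnsfun_approx => // y Dy; rewrite lee_fin F0.
have inds n : (\int[P]_(x in D) (s_ n x)%:E
               = \int[mu]_(x in D) (s_ n x * f x)%:E)%E.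
  transitivity (\sum_(k \in range (s_ n))
      \int[mu]_(x in D) (k%:E * ((\1_(s_ n @^-1` [set k]) x)%:E * (f x)%:E)))%E.
    rewrite (eq_integral (fun x => (\sum_(k \in range (s_ n))
        (k * \1_(s_ n @^-1` [set k]) x)%:E)%E)); last first.
      by move=> x _; rewrite fsumEFin// -fimfunE.
    rewrite ge0_integral_fsum//; last 2 first.
    - by move=> y; exact/measurable_EFinP/measurable_funM.
    - by move=> y x _; rewrite nnfun_muleindic_ge0.
    apply: eq_fsbigr => k /set_mem [y _ <-{k}].
    set k := s_ n y; have k0 : 0 <= k by [].
    rewrite ge0_integralZl//; last 2 first.
    - apply: emeasurable_funM; first exact/measurable_EFinP.
      exact/measurable_EFinP.
    - by move=> x Dx; rewrite mule_ge0// lee_fin// f0.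
    rewrite integralZl_indic_nnsfun//; congr (_ * _)%E.
    rewrite integral_indic// Pf//; last exact: measurableI.
    rewrite setIC integral_mkcondr; apply: eq_integral => x _.
    rewrite /patch indicE; case: ifPn => _; rewrite /= ?mul1e ?mul0e//.
  rewrite -ge0_integral_fsum//; last 2 first.
  - move=> k; apply: emeasurable_funM => //; apply: emeasurable_funM.
      exact/measurable_EFinP.
    exact/measurable_EFinP.
  - by move=> k x Dx; rewrite muleA mule_ge0// ?nnfun_muleindic_ge0// lee_fin f0.
  apply: eq_integral => x xD; rewrite EFinM.
  have -> : (s_ n x)%:E = (\sum_(k \in range (s_ n))
      (k * \1_(s_ n @^-1` [set k]) x)%:E)%E by rewrite fsumEFin// -fimfunE.
  rewrite [RHS]muleC ge0_mule_fsumr; last first.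
    by move=> k; rewrite nnfun_muleindic_ge0.
  by apply: eq_fsbigr => k _; rewrite EFinM muleA [RHS]muleC.
transitivity (limn (fun n => \int[P]_(x in D) (s_ n x)%:E)%E).
  rewrite -monotone_convergence//.
  - by apply: eq_integral => y /[!inE] yD; apply/esym/cvg_lim => //; exact: cvgs.
  - by move=> n; exact/measurable_EFinP/measurable_funP.
  - by move=> n y _; rewrite lee_fin.
  - by move=> y _ m n mn; rewrite lee_fin; exact/lefP/nd_nnsfun_approx.
rewrite (funext inds) -monotone_convergence//.
- apply: eq_integral => y /[!inE] yD; apply/cvg_lim => //.
  rewrite EFinM (_ : (fun n => _) = (fun n => (s_ n y)%:E * (f y)%:E)%E)//.
  by apply: cvgeZr => //; exact: cvgs.
- move=> n; apply/measurable_EFinP; apply: measurable_funM => //.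
  exact: measurable_funTS.
- by move=> n y Dy; rewrite lee_fin mulr_ge0// f0.
- move=> y Dy m n mn; rewrite lee_fin ler_wpM2r ?f0//.
  exact/lefP/nd_nnsfun_approx.
Qed.

Lemma integrable_density (F : T -> R) : measurable_fun D F ->
  P.-integrable D (EFin \o F) <-> mu.-integrable D (EFin \o (F \* f)).
Proof.
move=> mF; have [mf f0 Pf] := fP.
have E : (\int[P]_(x in D) `|(F x)%:E| = \int[mu]_(x in D) `|(F x * f x)%:E|)%E.
  rewrite (eq_integral (fun x => (`|F x|)%:E)); last by [].
  rewrite ge0_integral_density//; last exact: measurableT_comp.
  apply: eq_integral => x /set_mem Dx.
  by rewrite /= normrM (ger0_norm (f0 _ Dx)).
split=> /integrableP [_ oo]; apply/integrableP; split.
- by apply/measurable_EFinP; apply: measurable_funM.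
- by move: oo; rewrite E.
- exact/measurable_EFinP.
- by move: oo; rewrite E.
Qed.

Lemma Rintegral_density (F : T -> R) : measurable_fun D F ->
  \int[P]_(x in D) F x = \int[mu]_(x in D) (F x * f x).
Proof.
move=> mF; have [mf f0 Pf] := fP.
rewrite /Rintegral; congr fine.
rewrite integralE [RHS]integralE; congr (_ - _)%E.
- rewrite (eq_integral (fun x => (F^\+ x)%:E)); last first.
    by move=> x _; rewrite funeposE /funrpos/= EFin_max.
  rewrite ge0_integral_density//; last exact: measurable_funrpos.
  apply: eq_integral => x /set_mem Dx.
  by rewrite funeposE /funrpos/= -EFin_max; congr EFin;
     rewrite maxr_pMl ?mul0r ?f0.
- rewrite (eq_integral (fun x => (F^\- x)%:E)); last first.
    by move=> x _; rewrite funenegE /funrneg/= EFin_max.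
  rewrite ge0_integral_density//; last exact: measurable_funrneg.
  apply: eq_integral => x /set_mem Dx.
  by rewrite funenegE /funrneg/= -EFin_max; congr EFin;
     rewrite maxr_pMl ?mul0r ?mulNr ?f0.
Qed.

End density.

Section square_integrable.
Context (R : realType) dX (X : measurableType dX).
Variable nu : {measure set X -> \bar R}.
Implicit Types f g h : X -> R.

Definition square_integrable f :=
  measurable_fun setT f /\ nu.-integrable setT (fun x => (f x ^+ 2)%:E).

Definition inner_prod f g := \int[nu]_(x in setT) (f x * g x).

Local Notation sqint := square_integrable.
Local Notation ip := inner_prod.

Lemma sqint_integrableM f g : sqint f -> sqint g ->
  nu.-integrable setT (EFin \o (fun x => f x * g x)).
Proof.
move=> [mf f2] [mg g2].
apply: (le_integrable _ _ _ (integrableD _ f2 g2)) => //.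
  exact/measurable_EFinP/measurable_funM.
move=> x _; rewrite /= lee_fin [leRHS]ger0_norm ?addr_ge0 ?sqr_ge0//.
have := sqr_ge0 (`|f x| - `|g x|); rewrite normrM -(real_normK (num_real (f x))).
rewrite -(real_normK (num_real (g x))).
by have := sqr_ge0 `|f x|; have := sqr_ge0 `|g x|; nra.
Qed.

Lemma sqintZ a f : sqint f -> sqint (fun x => a * f x).
Proof.
move=> [mf f2]; split; first exact: measurable_funM.
rewrite (_ : (fun _ => _) = (fun x => (a ^+ 2)%:E * (f x ^+ 2)%:E)%E).
  exact: integrableZl.
by apply/funext => x; rewrite -EFinM exprMn.
Qed.

Lemma sqintD f g : sqint f -> sqint g -> sqint (fun x => f x + g x).
Proof.
move=> hf hg; have [mf f2] := hf; have [mg g2] := hg.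
split; first exact: measurable_funD.
have I := integrableD measurableT (integrableD measurableT f2 g2)
  (integrableZl measurableT 2 (sqint_integrableM hf hg)).
apply: eq_integrable I => // x _ /=; rewrite -!EFinD; congr EFin; ring.
Qed.

Lemma sqintB f g : sqint f -> sqint g -> sqint (fun x => f x - g x).
Proof.
move=> hf hg; have := sqintD hf (sqintZ (-1) hg).
by congr sqint; apply/funext => x; rewrite mulN1r.
Qed.

Lemma sqint_bounded K h f : measurable_fun setT h ->
  (forall x, `|h x| <= K) -> sqint f -> sqint (fun x => h x * f x).
Proof.
move=> mh hK hf; have [mf f2] := hf.
split; first exact: measurable_funM.
have [_ I] := sqintZ K hf; apply: le_integrable I => //.
  by apply/measurable_EFinP/measurable_funX/measurable_funM.
move=> x _; rewrite /= lee_fin !ger0_norm ?sqr_ge0//.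
rewrite !exprMn ler_wpM2r ?sqr_ge0// -(real_normK (num_real (h x))).
by have := hK x; have := normr_ge0 (h x); nra.
Qed.

Lemma ipC f g : ip f g = ip g f.
Proof. by rewrite /ip; congr Rintegral; apply/funext => x; rewrite mulrC. Qed.

Lemma ipDr f g h : sqint f -> sqint g -> sqint h ->
  ip f (fun x => g x + h x) = ip f g + ip f h.
Proof.
move=> hf hg hh; rewrite /inner_prod -RintegralD//; [|exact: sqint_integrableM..].
by congr Rintegral; apply/funext => x; rewrite mulrDr.
Qed.

Lemma ipZr a f g : sqint f -> sqint g ->
  ip f (fun x => a * g x) = a * ip f g.
Proof.
move=> hf hg; rewrite /inner_prod -RintegralZl//; [|exact: sqint_integrableM..].
by congr Rintegral; apply/funext => x; rewrite mulrCA.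
Qed.

Lemma ipBr f g h : sqint f -> sqint g -> sqint h ->
  ip f (fun x => g x - h x) = ip f g - ip f h.
Proof.
move=> hf hg hh.
rewrite (_ : (fun x => _) = (fun x => g x + (-1) * h x)).
  by rewrite ipDr ?ipZr ?mulN1r//; exact: sqintZ.
by apply/funext => x; rewrite mulN1r.
Qed.

Lemma ip_ge0 f : 0 <= ip f f.
Proof. by apply: Rintegral_ge0 => x _; rewrite -expr2 sqr_ge0. Qed.

Lemma ip_quadratic s f g : sqint f -> sqint g ->
  ip (fun x => f x + s * g x) (fun x => f x + s * g x) =
  ip f f + 2 * s * ip f g + s ^+ 2 * ip g g.
Proof.
move=> hf hg; have hsg := sqintZ s hg; have hh := sqintD hf hsg.
rewrite ipDr// ipZr// [ip _ f]ipC [ip _ g]ipC !ipDr// !ipZr// [ip g f]ipC.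
ring.
Qed.

Lemma ip_cauchy_schwarz f g : sqint f -> sqint g ->
  ip f g ^+ 2 <= ip f f * ip g g.
Proof.
move=> hf hg; have Q s := ip_quadratic s hf hg.
have P s : 0 <= ip f f + 2 * s * ip f g + s ^+ 2 * ip g g by rewrite -Q ip_ge0.
have [g0|g0] := eqVneq (ip g g) 0.
  rewrite g0 mulr0; have [->|fg0] := eqVneq (ip f g) 0; first by rewrite expr0n.
  have := P (- (ip f f + 1) / (2 * ip f g)).
  rewrite g0 mulr0 addr0 (_ : 2 * _ * _ = - (ip f f + 1)); last by field.
  by lra.
have gp : 0 < ip g g by rewrite lt_def g0 ip_ge0.
have := P (- ip f g / ip g g).
rewrite (_ : _ + _ + _ = (ip f f * ip g g - ip f g ^+ 2) / ip g g).
  by rewrite pmulr_lge0 ?invr_gt0// subr_ge0.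
by field.
Qed.

Lemma ip_le_sqrt f g : sqint f -> sqint g ->
  `|ip f g| <= Num.sqrt (ip f f) * Num.sqrt (ip g g).
Proof.
move=> hf hg; rewrite -sqrtrM ?ip_ge0// -sqrtr_sqr.
by apply: ler_wsqrtr; exact: ip_cauchy_schwarz.
Qed.

Lemma ip_sqrD_le f g : sqint f -> sqint g ->
  ip (fun x => f x + g x) (fun x => f x + g x) <= 2 * ip f f + 2 * ip g g.
Proof.
move=> hf hg.
have := ip_quadratic 1 hf hg; have := ip_quadratic (-1) hf hg.
have := ip_ge0 (fun x => f x + (-1) * g x).
have -> : (fun x => f x + 1 * g x) = (fun x => f x + g x).
  by apply/funext => x; rewrite mul1r.
move: (ip (fun x => f x + -1 * g x) _) => A; move: (ip (fun x => f x + g x) _) => B.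
by lra.
Qed.

Lemma ip_sqrB_le f g : sqint f -> sqint g ->
  ip (fun x => f x - g x) (fun x => f x - g x) <= 2 * ip f f + 2 * ip g g.
Proof.
move=> hf hg; have := ip_sqrD_le hf (sqintZ (-1) hg).
have -> : ip (fun x => -1 * g x) (fun x => -1 * g x) = ip g g.
  by congr Rintegral; apply/funext => x; rewrite !mulN1r mulrNN.
by have -> : (fun x => f x + -1 * g x) = (fun x => f x - g x)
  by apply/funext => x; rewrite mulN1r.
Qed.

End square_integrable.

Section differentiation_in_L2.
Context (R : realType) dX (X : measurableType dX).
Variable nu : {measure set X -> \bar R}.
Local Notation sqint := (square_integrable nu).
Local Notation ip := (inner_prod nu).

Lemma sqint_sum (I : Type) (s : seq I) (v : I -> R) (f : I -> X -> R) :
  (forall i, sqint (f i)) -> sqint (fun x => \sum_(i <- s) v i * f i x).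
Proof.
move=> hf; elim: s => [|i s IH].
  rewrite (_ : (fun _ => _) = cst 0); last by apply/funext => x; rewrite big_nil.
  split; first exact: measurable_cst.
  rewrite (_ : (fun _ => _) = cst 0%E); first exact: integrable0.
  by apply/funext => x; rewrite /= expr0n.
rewrite (_ : (fun _ => _) = (fun x => v i * f i x + \sum_(j <- s) v j * f j x)).
  by apply: sqintD IH; exact: sqintZ.
by apply/funext => x; rewrite big_cons.
Qed.

Lemma ip_sumr (I : Type) (s : seq I) (v : I -> R) (f : I -> X -> R) g :
  sqint g -> (forall i, sqint (f i)) ->
  ip g (fun x => \sum_(i <- s) v i * f i x) = \sum_(i <- s) v i * ip g (f i).
Proof.
move=> hg hf; elim: s => [|i s IH].
  rewrite big_nil /inner_prod /Rintegral integral0_eq// => x _.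
  by rewrite big_nil mulr0.
rewrite big_cons -IH -ipZr// -ipDr//; last exact: sqint_sum.
  by congr inner_prod; apply/funext => x; rewrite big_cons.
exact: sqintZ.
Qed.

Lemma sqint_truncation (S z : X -> R) : measurable_fun setT S -> sqint z ->
  forall e, 0 < e -> exists (K : R) (h : X -> R),
    [/\ measurable_fun setT h, forall x, `|h x| <= 1, forall x, `|h x * S x| <= K &
      ip (fun x => z x - h x * z x) (fun x => z x - h x * z x) <= e].
Proof.
move=> mS hz e e0; have [mz z2] := hz.
pose A n := [set x | `|S x| <= n%:R].
have mA n : measurable (A n).
  have mN : measurable_fun setT (fun x => `|S x|) by exact: measurableT_comp.
  have := mN measurableT `]-oo, n%:R]%classic (measurable_itv _).
  by rewrite setTI (_ : _ @^-1` _ = A n)//; apply/seteqP; split => x /=;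
     rewrite /A /= in_itv.
have mh n : measurable_fun setT (\1_(A n) : X -> R) by exact: measurable_indic.
have h1 n x : `|\1_(A n) x : R| <= 1.
  by rewrite indicE; case: (_ \in _); rewrite ?normr1 ?normr0.
have hS n x : `|(\1_(A n) x : R) * S x| <= n%:R.
  rewrite indicE; have [|_] := boolP (x \in A n); last by rewrite mul0r normr0.
  by rewrite inE /A /= mul1r.
pose F n x := (z x - \1_(A n) x * z x) * (z x - \1_(A n) x * z x).
have mF n : measurable_fun setT (F n).
  by apply: measurable_funM; apply: measurable_funB => //; exact: measurable_funM.
have Fz n x : `|F n x| <= z x ^+ 2.
  rewrite /F indicE; case: (_ \in _).
    by rewrite mul1r subrr mulr0 normr0 sqr_ge0.
  by rewrite mul0r subr0 -expr2 ger0_norm ?sqr_ge0.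
have F0 x : (F n x)%:E @[n --> \oo] --> (0 : \bar R)%E.
  apply: cvg_near_cst; near=> n.
  have Sn : `|S x| <= n%:R by near: n; exact: nbhs_infty_ger.
  by rewrite /F indicE mem_set// mul1r subrr mulr0.
have : (\int[nu]_(x in setT) (F n x)%:E @[n --> \oo] -->
        \int[nu]_(x in setT) (cst 0 x : \bar R))%E.
  apply: (@dominated_cvg _ _ _ nu setT measurableT (fun n x => (F n x)%:E) _
    (fun x => (z x ^+ 2)%:E)) => //.
  - by move=> n; exact/measurable_EFinP.
  - by move=> n x _; rewrite abse_EFin lee_fin; exact: Fz.
rewrite integral0 => cF.
have /fine_cvgP[_ /cvgr_lt /(_ e e0) [n _ /(_ n)]] := cF.
rewrite /= leqnn => /(_ isT) /ltW Fe.
by exists n%:R, (\1_(A n)); split.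
Unshelve. all: by end_near. Qed.

Local Notation sq f := (ip f f).

Lemma sqrt_sq_le f (t : R) : 0 <= t -> sq f <= t ^+ 2 -> Num.sqrt (sq f) <= t.
Proof. by move=> t0 ft; rewrite -(ger0_norm t0) -sqrtr_sqr ler_wsqrtr. Qed.

Lemma expectation_derivative (S a z : X -> R) (a_ : R -> X -> R) (C : R) :
  measurable_fun setT S -> sqint a -> sqint z ->
  sqint (fun x => S x * a x) ->
  (\forall s \near 0, [/\ sqint (a_ s), sqint (fun x => S x * a_ s x) &
     sq (fun x => S x * a_ s x) <= C]) ->
  (forall e, 0 < e -> \forall s \near 0,
     sq (fun x => a_ s x - a x - s * z x) <= e * s ^+ 2) ->
  forall e, 0 < e -> \forall s \near 0,
    `|ip (fun x => S x * a_ s x) (a_ s) - ip (fun x => S x * a x) a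
       - s * (2 * ip (fun x => S x * a x) z)| <= e * `|s|.
Proof.
move=> mS ha hz hSa hS hdiff e e0.
set A := Num.sqrt (sq (fun x => S x * a x)).
set B := Num.sqrt (2 * C + 2 * sq (fun x => S x * a x)).
have A0 : 0 <= A by exact: sqrtr_ge0.
have B0 : 0 <= B by exact: sqrtr_ge0.
pose k := e / (2 * (2 * A + 2 * B + 1)).
have k0 : 0 < k by rewrite divr_gt0//; lra.
have [K [h [mh h1 hSK hz_le]]] := sqint_truncation mS hz (exprn_gt0 2 k0).
have hhz : sqint (fun x => h x * z x) by exact: sqint_bounded h1 hz.
have hhSz : sqint (fun x => (h x * S x) * z x).
  by apply: sqint_bounded hSK hz; exact: measurable_funM.
set M := Num.sqrt (sq (fun x => (h x * S x) * z x)).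
have M0 : 0 <= M by exact: sqrtr_ge0.
pose k2 := e / (2 * (M + 1)).
have k20 : 0 < k2 by rewrite divr_gt0//; lra.
set J := sq z; have J0 : 0 <= J by exact: ip_ge0.
have Hsmall : \forall s \near (0 : R), (2 * 1 + 2 * J) * s ^+ 2 <= k2 ^+ 2.
  have t0 : 0 < k2 / (2 + 2 * J) by rewrite divr_gt0//; lra.
  near=> s.
  have s1 : `|s| <= k2 by near: s; exact: (@nbhs0_le _ R).
  have s2 : `|s| <= k2 / (2 + 2 * J) by near: s; exact: (@nbhs0_le _ R).
  rewrite -(real_normK (num_real s)) mulr1.
  have : (2 + 2 * J) * `|s| <= k2 by rewrite mulrC -ler_pdivlMr//; lra.
  have := normr_ge0 s; nra.
have Hd1 := hdiff 1 ltr01; have Hdk := hdiff (k ^+ 2) (exprn_gt0 2 k0).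
near=> s.
have [has hSas SasC] : [/\ sqint (a_ s), sqint (fun x => S x * a_ s x) &
     sq (fun x => S x * a_ s x) <= C] by near: s; exact: hS.
have rk : sq (fun x => a_ s x - a x - s * z x) <= k ^+ 2 * s ^+ 2.
  by near: s; exact: Hdk.
have r1 : sq (fun x => a_ s x - a x - s * z x) <= 1 * s ^+ 2.
  by near: s; exact: Hd1.
have sk2 : (2 * 1 + 2 * J) * s ^+ 2 <= k2 ^+ 2 by near: s; exact: Hsmall.
pose d x := a_ s x - a x.
pose r x := d x - s * z x.
have hd : sqint d by exact: sqintB.
have hsz : sqint (fun x => s * z x) by exact: sqintZ.
have hr : sqint r by exact: sqintB.
have hSd : sqint (fun x => S x * d x).
  rewrite (_ : (fun _ => _) = (fun x => S x * a_ s x - S x * a x)).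
    exact: sqintB.
  by apply/funext => x; rewrite mulrBr.
have Sd_le : Num.sqrt (sq (fun x => S x * d x)) <= B.
  apply: ler_wsqrtr.
  rewrite (_ : (fun x => S x * d x) = (fun x => S x * a_ s x - S x * a x)); last first.
    by apply/funext => x; rewrite mulrBr.
  by apply: (le_trans (ip_sqrB_le hSas hSa)); lra.
have r_le : Num.sqrt (sq r) <= k * `|s|.
  apply: sqrt_sq_le; first by rewrite mulr_ge0 ?(ltW k0).
  by rewrite exprMn (real_normK (num_real s)).
have d_le : Num.sqrt (sq d) <= k2.
  apply: sqrt_sq_le; first exact: ltW.
  rewrite (_ : d = (fun x => r x + s * z x)); last first.
    by apply/funext => x; rewrite /r subrK.
  apply: (le_trans (ip_sqrD_le hr hsz)).
  have -> : sq (fun x => s * z x) = s ^+ 2 * J.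
    by rewrite ipZr// ipC ipZr// /J; ring.
  apply: (@le_trans _ _ ((2 * 1 + 2 * J) * s ^+ 2)) => //.
  have : sq r <= 1 * s ^+ 2 by [].
  by move: (sq r) => A1; lra.
have -> : ip (fun x => S x * a_ s x) (a_ s) - ip (fun x => S x * a x) a
    - s * (2 * ip (fun x => S x * a x) z) =
    2 * ip (fun x => S x * a x) r + ip (fun x => S x * d x) r +
    s * (ip (fun x => S x * d x) (fun x => z x - h x * z x) +
         ip d (fun x => (h x * S x) * z x)).
  have E1 : (fun x => S x * a_ s x) = (fun x => S x * a x + S x * d x).
    by apply/funext => x; rewrite /d; ring.
  have E2 : a_ s = (fun x => a x + (s * z x + r x)).
    by apply/funext => x; rewrite /r /d; ring.
  have E3 : ip d (fun x => (h x * S x) * z x) =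
      ip (fun x => S x * d x) (fun x => h x * z x).
    by congr Rintegral; apply/funext => x; ring.
  have hszr : sqint (fun x => s * z x + r x) by exact: sqintD.
  have Edec : ip (fun x => S x * a_ s x) (a_ s) =
    ip (fun x => S x * a x) a + s * ip (fun x => S x * a x) z
      + ip (fun x => S x * a x) r + ip (fun x => S x * d x) (a_ s).
    have L1 : ip (fun x => S x * a_ s x) (a_ s) =
        ip (fun x => S x * a x) (a_ s) + ip (fun x => S x * d x) (a_ s).
      by rewrite E1 [LHS]ipC ipDr// [X in X + _]ipC [X in _ + X]ipC.
    have L2 : ip (fun x => S x * a x) (a_ s) = ip (fun x => S x * a x) a +
        (s * ip (fun x => S x * a x) z + ip (fun x => S x * a x) r).
      by rewrite [X in ip _ X = _]E2 (ipDr hSa ha hszr) (ipDr hSa hsz hr) ipZr.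
    by rewrite L1 L2; ring.
  have E4 : d = (fun x => s * z x + r x) by apply/funext => x; rewrite /r; ring.
  have Ed2 : ip (fun x => S x * d x) (a_ s) =
    ip (fun x => S x * a x) r + s * ip (fun x => S x * a x) z +
    ip (fun x => S x * d x) d.
    rewrite (_ : a_ s = (fun x => a x + d x)); last first.
      by apply/funext => x; rewrite /d; ring.
    rewrite ipDr//; congr (_ + _).
    rewrite (_ : ip _ a = ip (fun x => S x * a x) d).
      by rewrite [X in ip _ X = _]E4 (ipDr hSa hsz hr) ipZr//; ring.
    by congr Rintegral; apply/funext => x; ring.
  have Ed3 : ip (fun x => S x * d x) d =
    s * ip (fun x => S x * d x) z + ip (fun x => S x * d x) r.
    by rewrite [X in ip _ X = _]E4 (ipDr hSd hsz hr) ipZr.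
  rewrite Edec Ed2 Ed3 E3 ipBr//; ring.
have b1 : `|ip (fun x => S x * a x) r| <= A * (k * `|s|).
  by apply: (le_trans (ip_le_sqrt hSa hr)); rewrite ler_wpM2l.
have b2 : `|ip (fun x => S x * d x) r| <= B * (k * `|s|).
  by apply: (le_trans (ip_le_sqrt hSd hr)); apply: ler_pM => //; exact: sqrtr_ge0.
have b3 : `|ip (fun x => S x * d x) (fun x => z x - h x * z x)| <= B * k.
  apply: (le_trans (ip_le_sqrt hSd (sqintB hz hhz))).
  apply: ler_pM => //; try exact: sqrtr_ge0.
  exact: sqrt_sq_le (ltW k0) _.
have b4 : `|ip d (fun x => (h x * S x) * z x)| <= k2 * M.
  by apply: (le_trans (ip_le_sqrt hd hhSz)); rewrite ler_wpM2r.
have ke : k * (2 * A + 2 * B + 1) = e / 2 by rewrite /k; field; lra.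
have k2e : k2 * (M + 1) = e / 2 by rewrite /k2; field; lra.
move: (ip _ _) b1 (ip _ _) b2 (ip _ _) b3 (ip _ _) b4 => x1 b1 x2 b2 x3 b3 x4 b4.
have s0 := normr_ge0 s.
apply: (@le_trans _ _ (2 * `|x1| + `|x2| + `|s| * (`|x3| + `|x4|))).
  apply: (le_trans (ler_normD _ _)); apply: lerD.
    apply: (le_trans (ler_normD _ _)); apply: lerD => //.
    by rewrite normrM (ger0_norm (ler0n _ _)).
  by rewrite normrM ler_wpM2l//; exact: ler_normD.
have : `|s| * (`|x3| + `|x4|) <= `|s| * (B * k + k2 * M).
  by rewrite ler_wpM2l// lerD.
have : k * `|s| * (2 * A + 2 * B + 1) = e / 2 * `|s| by rewrite -ke; ring.
have : k2 * `|s| * (M + 1) = e / 2 * `|s| by rewrite -k2e; ring.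
have := mulr_ge0 (ltW k0) s0; have := mulr_ge0 (ltW k20) s0.
by nra.
Unshelve. all: by end_near. Qed.

End differentiation_in_L2.

Section hellinger_model.
Context (R : realType) (d : nat) dX (X : measurableType dX).
Variables (nu : {sigma_finite_measure set X -> \bar R}) (Theta0 : set 'cV[R]_d).
Variables (P : 'cV[R]_d -> probability X R) (p : 'cV[R]_d -> X -> R).
Variable xi : 'cV[R]_d -> X -> 'cV[R]_d.
Hypothesis open_Theta0 : open Theta0.
Hypothesis density_p :
  forall theta, Theta0 theta -> is_density nu setT (P theta) (p theta).
Hypothesis hellinger_xi :
  forall theta, Theta0 theta -> hellinger_derivative nu p theta (xi theta).

Local Notation sqint := (square_integrable nu).
Local Notation ip := (inner_prod nu).
Local Notation info t := (fisher_info nu (xi t)).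

Definition sqrt_density t x := Num.sqrt (p t x).

Lemma sqr_sqrt_density t x : Theta0 t -> sqrt_density t x * sqrt_density t x = p t x.
Proof. by move=> /density_p[_ p0 _]; rewrite -expr2 sqr_sqrtr ?p0. Qed.

Lemma measurable_sqrt_density t : Theta0 t -> measurable_fun setT (sqrt_density t).
Proof.
move=> /density_p[mp _ _].
exact: measurableT_comp (continuous_measurable_fun (@sqrt_continuous R)) mp.
Qed.

Lemma integral_density1 t : Theta0 t -> (\int[nu]_x (p t x)%:E = 1)%E.
Proof.
move=> tT; have [_ _ /(_ setT measurableT (@subset_refl _ _)) <-] := density_p tT.
by rewrite probability_setT.
Qed.

Lemma sqint_sqrt_density t : Theta0 t -> sqint (sqrt_density t).
Proof.
move=> tT; have [mp p0 _] := density_p tT.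
split; first exact: measurable_sqrt_density.
rewrite (_ : (fun _ => _) = EFin \o p t); last first.
  by apply/funext => x; rewrite /= expr2 sqr_sqrt_density.
apply/integrableP; split; first exact/measurable_EFinP.
rewrite (eq_integral (fun x => (p t x)%:E)); first by rewrite integral_density1 ?ltry.
by move=> x _; rewrite /= ger0_norm ?p0.
Qed.

Lemma ip_sqrt_density t : Theta0 t -> ip (sqrt_density t) (sqrt_density t) = 1.
Proof.
move=> tT; rewrite /inner_prod /Rintegral (eq_integral (fun x => (p t x)%:E)).
  by rewrite integral_density1.
by move=> x _; rewrite sqr_sqrt_density.
Qed.

Definition score (v : 'cV[R]_d) t x : R := (v^T *m xi t x) ord0 ord0.

Lemma scoreE v t :
  score v t = fun x => \sum_i v i ord0 * xi t x i ord0.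
Proof.
by apply/funext => x; rewrite /score mxE; apply: eq_bigr => i _; rewrite mxE.
Qed.

Lemma sqint_xi t i : Theta0 t -> sqint (fun x => xi t x i ord0).
Proof.
move=> /hellinger_xi[mxi xi2 _].
have mi j : measurable_fun setT (fun x => xi t x j ord0).
  exact: measurableT_comp (measurable_mx_coord j ord0) mxi.
split => //; apply: (@le_integrable _ _ _ nu setT measurableT _
  (fun x => (l2norm (xi t x) ^+ 2)%:E)) => //.
- by apply/measurable_EFinP; exact: measurable_funX.
- move=> x _; rewrite /= lee_fin !ger0_norm ?sqr_ge0// /l2norm sqr_sqrtr.
    rewrite (bigD1 i)//= lerDl; apply: sumr_ge0 => j _; exact: sqr_ge0.
  by apply: sumr_ge0 => j _; exact: sqr_ge0.
- apply/integrableP; split.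
    apply/measurable_EFinP; apply: measurable_funX.
    apply: (measurableT_comp (continuous_measurable_fun (@sqrt_continuous R))).
    by apply: measurable_sum => j; exact: measurable_funX.
  rewrite (eq_integral (fun x => (l2norm (xi t x) ^+ 2)%:E))//.
  by move=> x _; rewrite /= ger0_norm ?sqr_ge0.
Qed.

Lemma sqint_score v t : Theta0 t -> sqint (score v t).
Proof. by move=> tT; rewrite scoreE; apply: sqint_sum => i; exact: sqint_xi. Qed.

Lemma fisher_infoE t i j :
  info t i j = 4 * ip (fun x => xi t x i ord0) (fun x => xi t x j ord0).
Proof.
rewrite !mxE; congr (_ * _); rewrite /inner_prod; congr Rintegral.
by apply/funext => x; rewrite mxE big_ord1 mxE.
Qed.

Lemma fisher_info_quadratic v t : Theta0 t ->
  (v^T *m info t *m v) ord0 ord0 = 4 * ip (score v t) (score v t).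
Proof.
move=> tT; have hxi i := sqint_xi i tT; have hz := sqint_score v tT.
rewrite [X in ip _ X]scoreE ip_sumr// mulr_sumr mxE; apply: eq_bigr => j _.
rewrite ipC [X in ip _ X]scoreE ip_sumr// mxE mulr_suml mulrCA.
rewrite mulr_sumr [RHS]mulr_sumr; apply: eq_bigr => i _.
by rewrite mxE fisher_infoE [in RHS]ipC; ring.
Qed.

Lemma near_line v t : Theta0 t -> \forall s \near (0 : R), Theta0 (t + s *: v).
Proof.
move=> tT.
have cl : (fun s : R => t + s *: v) @ (0 : R) --> t.
  rewrite -[X in _ --> X](_ : t + 0 *: v = t); last by rewrite scale0r addr0.
  by apply: cvgD; [exact: cvg_cst|apply: cvgZr_tmp; exact: cvg_id].
by apply: cl; apply: open_nbhs_nbhs; split.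
Qed.


Lemma sqint_integralE (f : X -> R) : sqint f ->
  (\int[nu]_x (f x ^+ 2)%:E = (ip f f)%:E)%E.
Proof.
move=> hf; rewrite /inner_prod /Rintegral fineK.
  by apply: eq_integral => x _; rewrite expr2.
by apply: integrable_fin_num => //; exact: sqint_integrableM.
Qed.

Lemma l2norm_sqr n (v : 'cV[R]_n) : l2norm v ^+ 2 = \sum_i v i ord0 ^+ 2.
Proof. by rewrite sqr_sqrtr// sumr_ge0// => i _; exact: sqr_ge0. Qed.

Lemma l2normZ_sqr n (v : 'cV[R]_n) s :
  l2norm (s *: v) ^+ 2 = s ^+ 2 * l2norm v ^+ 2.
Proof.
by rewrite !l2norm_sqr mulr_sumr; apply: eq_bigr => i _; rewrite mxE exprMn.
Qed.

Lemma l2norm_gt0 n (v : 'cV[R]_n) : v != 0 -> 0 < l2norm v ^+ 2.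
Proof.
move=> v0; rewrite lt_def sqr_ge0 andbT; apply: contra v0 => /eqP.
rewrite l2norm_sqr => /psumr_eq0P v0; apply/eqP/colP => i; rewrite mxE.
by apply/eqP; rewrite -sqrf_eq0; apply/eqP/v0 => // j _; exact: sqr_ge0.
Qed.

Lemma hellinger_remainder v t e : Theta0 t -> 0 < e -> \forall s \near (0 : R),
  let r := fun x => sqrt_density (t + s *: v) x - sqrt_density t x - s * score v t x in
  ip r r <= e * s ^+ 2.
Proof.
move=> tT e0; have [_ _ cvgH] := hellinger_xi tT.
pose e' := e / (1 + l2norm v ^+ 2).
have v0 : 0 <= l2norm v ^+ 2 by exact: sqr_ge0.
have e'0 : 0 < e' by rewrite divr_gt0//; lra.
have e'v : e' * l2norm v ^+ 2 <= e.
  have : e' * (1 + l2norm v ^+ 2) = e by rewrite /e'; field; lra.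
  by nra.
move: cvgH; set F := (F in F @ _ --> _) => /fine_cvgP[finF /cvgr_lt /(_ e' e'0) ltF].
have Fe' : \forall h \near (0 : 'cV[R]_d),
    h != 0 -> F h \is a fin_num /\ fine (F h) < e'.
  by near=> h => h0; split; move: h0; near: h; [exact: finF|exact: ltF].
have cl : (fun s : R => s *: v) @ (0 : R) --> (0 : 'cV[R]_d).
  by rewrite -[X in _ --> X](scale0r v); apply: cvgZr_tmp; exact: cvg_id.
have Hs := cl _ Fe'.
near=> s.
have tsT : Theta0 (t + s *: v) by near: s; exact: near_line.
have hr : sqint (fun x => sqrt_density (t + s *: v) x - sqrt_density t x - s * score v t x).
  apply: sqintB; first by apply: sqintB; exact: sqint_sqrt_density.
  by apply: sqintZ; exact: sqint_score.
have [sv0|sv0] := eqVneq (s *: v) 0.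
  rewrite /= sv0 addr0 (_ : (fun x => _) = cst 0).
    rewrite /inner_prod /Rintegral integral0_eq; last by move=> x _; rewrite mulr0.
    exact: mulr_ge0 (ltW e0) (sqr_ge0 s).
  apply/funext => x; rewrite subrr sub0r.
  have -> : s * score v t x = ((s *: v)^T *m xi t x) ord0 ord0.
    by rewrite linearZ /= -scalemxAl mxE.
  by rewrite sv0 linear0 mul0mx mxE oppr0.
have /(_ sv0)[_] : s *: v != 0 -> F (s *: v) \is a fin_num /\ fine (F (s *: v)) < e'.
  by near: s; exact: Hs.
rewrite /F (eq_integral (fun x =>
  ((sqrt_density (t + s *: v) x - sqrt_density t x - s * score v t x) ^+ 2)%:E)); last first.
  move=> x _; congr (_ ^+ 2)%:E; rewrite /sqrt_density /score; congr (_ - _ - _).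
  by rewrite linearZ /= -scalemxAl mxE.
rewrite (sqint_integralE hr) -EFinM /= ltr_pdivrMr; last exact: l2norm_gt0.
move=> /ltW /le_trans; apply; rewrite l2normZ_sqr mulrCA [leRHS]mulrC.
by rewrite ler_wpM2l ?sqr_ge0.
Unshelve. all: by end_near. Qed.

Lemma hellinger_continuous v t e : Theta0 t -> 0 < e -> \forall s \near (0 : R),
  let r := fun x => sqrt_density (t + s *: v) x - sqrt_density t x in ip r r <= e.
Proof.
move=> tT e0; set J := ip (score v t) (score v t).
have J0 : 0 <= J by exact: ip_ge0.
have H1 := hellinger_remainder v tT ltr01.
have d0 : 0 < Num.min 1 (e / (2 + 2 * J)).
  by rewrite lt_min ltr01/= divr_gt0//; lra.
near=> s.
have tsT : Theta0 (t + s *: v) by near: s; exact: near_line.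
have : `|s| <= Num.min 1 (e / (2 + 2 * J)) by near: s; exact: (@nbhs0_le _ R).
rewrite le_min => /andP[s1 se].
have r1 : let r := fun x => sqrt_density (t + s *: v) x - sqrt_density t x - s * score v t x in
  ip r r <= 1 * s ^+ 2 by near: s; exact: H1.
pose r x := sqrt_density (t + s *: v) x - sqrt_density t x - s * score v t x.
have hsz := sqintZ s (sqint_score v tT).
have hr : sqint r.
  by apply: sqintB => //; apply: sqintB; exact: sqint_sqrt_density.
rewrite /= (_ : (fun x => _) = (fun x => r x + s * score v t x)); last first.
  by apply/funext => x; rewrite /r; ring.
apply: (le_trans (ip_sqrD_le hr hsz)).
have -> : ip (fun x => s * score v t x) (fun x => s * score v t x) = s ^+ 2 * J.
  have hz := sqint_score v tT.
  by rewrite ipZr// ipC ipZr// /J; ring.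
have : (2 + 2 * J) * `|s| <= e by rewrite mulrC -ler_pdivlMr//; lra.
have s0 := normr_ge0 s.
move: r1; rewrite /= -/r -(real_normK (num_real s)); move: (ip r r) => A; nra.
Unshelve. all: by end_near. Qed.

Lemma ip_sqrt_density_continuous v w t e : Theta0 t -> Theta0 (t + w) -> 0 < e ->
  \forall s \near (0 : R),
    `|ip (sqrt_density (t + s *: v + w)) (sqrt_density (t + s *: v)) - ip (sqrt_density (t + w)) (sqrt_density t)|
      <= e.
Proof.
move=> tT twT e0.
have e2 : 0 < (e / 2) ^+ 2 by rewrite exprn_gt0// divr_gt0.
have H1 := hellinger_continuous v tT e2.
have H2 := hellinger_continuous v twT e2.
near=> s.
have tsT : Theta0 (t + s *: v) by near: s; exact: near_line.
have twsT : Theta0 (t + w + s *: v) by near: s; exact: near_line.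
have h1 : ip (fun x => sqrt_density (t + s *: v) x - sqrt_density t x)
  (fun x => sqrt_density (t + s *: v) x - sqrt_density t x) <= (e / 2) ^+ 2 by near: s; exact: H1.
have h2 : ip (fun x => sqrt_density (t + w + s *: v) x - sqrt_density (t + w) x)
  (fun x => sqrt_density (t + w + s *: v) x - sqrt_density (t + w) x) <= (e / 2) ^+ 2.
  by near: s; exact: H2.
rewrite (addrAC t).
set a := sqrt_density t; set a' := sqrt_density (t + s *: v).
set b := sqrt_density (t + w); set b' := sqrt_density (t + w + s *: v).
have ha : sqint a by exact: sqint_sqrt_density.
have ha' : sqint a' by exact: sqint_sqrt_density.
have hb : sqint b by exact: sqint_sqrt_density.
have hb' : sqint b' by exact: sqint_sqrt_density.
have -> : ip b' a' - ip b a =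
    ip b' (fun x => a' x - a x) + ip a (fun x => b' x - b x).
  by rewrite !ipBr// [ip b' a]ipC [ip b a]ipC; ring.
have e02 : 0 <= e / 2 by lra.
have B1 := ip_le_sqrt hb' (sqintB ha' ha).
have B2 := ip_le_sqrt ha (sqintB hb' hb).
have := sqrt_sq_le e02 h1; have := sqrt_sq_le e02 h2.
move: B1 B2; rewrite !ip_sqrt_density// sqrtr1 !mul1r => B1 B2 C2 C1.
apply: (le_trans (ler_normD _ _)).
rewrite (splitr e); apply: lerD; [exact: le_trans C1|exact: le_trans C2].
Unshelve. all: by end_near. Qed.

Lemma hellinger_distanceE t w : Theta0 t -> Theta0 (t + w) ->
  ip (fun x => sqrt_density (t + w) x - sqrt_density t x) (fun x => sqrt_density (t + w) x - sqrt_density t x) =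
  2 - 2 * ip (sqrt_density (t + w)) (sqrt_density t).
Proof.
move=> tT twT; have ha := sqint_sqrt_density tT; have hb := sqint_sqrt_density twT.
rewrite (_ : (fun x => _) = (fun x => sqrt_density (t + w) x + (-1) * sqrt_density t x)).
  by rewrite ip_quadratic// !ip_sqrt_density//; ring.
by apply/funext => x; rewrite mulN1r.
Qed.

Lemma open_translate w : open [set t | Theta0 (t + w)].
Proof.
rewrite openE => t tw.
have /nbhs_cubeP[e e0 eT] : nbhs (t + w) Theta0 by apply: open_nbhs_nbhs.
apply/nbhs_cubeP; exists e => // v Hv; apply: eT => i.
by have /andP[? ?] := Hv i; rewrite !mxE; apply/andP; split; lra.
Qed.

Lemma measurable_ip_sqrt_density w :
  measurable_fun (Theta0 `&` [set t | Theta0 (t + w)])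
    (fun t => ip (sqrt_density (t + w)) (sqrt_density t)).
Proof.
apply: line_continuous_measurable_on.
  by apply: openI => //; exact: open_translate.
move=> t [tT twT] i; rewrite /prop_for /continuous_at /= scale0r addr0.
apply/cvgrPdist_le => e e0; rewrite near_simpl.
have := ip_sqrt_density_continuous (delta_mx i ord0) tT twT e0.
by apply: filterS => s; rewrite distrC.
Qed.

Lemma hellinger_distance_asymptotics v t : Theta0 t ->
  (fun n => 4 * n.+1%:R ^+ 2 * (2 - 2 *
     ip (sqrt_density (t + n.+1%:R^-1 *: v)) (sqrt_density t))) @ \oo -->
  4 * ip (score v t) (score v t).
Proof.
move=> tT; apply/cvgrPdist_le => e e0.
set J := ip (score v t) (score v t); have J0 : 0 <= J by exact: ip_ge0.
set q := Num.sqrt J; have q0 : 0 <= q by exact: sqrtr_ge0.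
pose k := Num.min 1 (e / (4 * (1 + 2 * q))).
have k0 : 0 < k by rewrite lt_min ltr01/= divr_gt0//; lra.
have H := hellinger_remainder v tT (exprn_gt0 2 k0).
have cvg0 : (fun n : nat => (n.+1%:R^-1 : R)) @ \oo --> (0 : R) by exact: cvg_harmonic.
have N1 := cvg0 _ H; have N2 := cvg0 _ (near_line v tT).
near=> n.
have tsT : Theta0 (t + n.+1%:R^-1 *: v) by near: n; exact: N2.
have rk : let s := n.+1%:R^-1 in
  let r := fun x => sqrt_density (t + s *: v) x - sqrt_density t x - s * score v t x in
  ip r r <= k ^+ 2 * s ^+ 2 by near: n; exact: N1.
have s0 : 0 < n.+1%:R^-1 :> R by rewrite invr_gt0.
have -> : n.+1%:R ^+ 2 = n.+1%:R^-1 ^- 2 :> R by rewrite exprVn invrK.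
move: (n.+1%:R^-1) tsT rk s0 => s tsT rk s0.
rewrite -hellinger_distanceE//.
pose r x := sqrt_density (t + s *: v) x - sqrt_density t x - s * score v t x.
have hz := sqint_score v tT.
have hr : sqint r.
  by apply: sqintB; [apply: sqintB; exact: sqint_sqrt_density|exact: sqintZ].
have -> : (fun x => sqrt_density (t + s *: v) x - sqrt_density t x) = (fun x => r x + s * score v t x).
  by apply/funext => x; rewrite /r; ring.
rewrite ip_quadratic// -/J.
have rr : Num.sqrt (ip r r) <= k * s.
  by apply: sqrt_sq_le; [rewrite mulr_ge0// ltW|rewrite exprMn].
have rz : `|ip r (score v t)| <= k * s * q.
  by apply: (le_trans (ip_le_sqrt hr hz)); rewrite ler_wpM2r.
have := rk; rewrite /= -/r; have := ip_ge0 nu r.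
move: (ip r r) (ip r _) rz => A B Bk A0 Ak.
have -> : 4 * J - 4 * s ^- 2 * (A + 2 * s * B + s ^+ 2 * J) =
   - (4 * (A / s ^+ 2 + 2 * (B / s))) by field; lra.
rewrite normrN normrM ger0_norm//.
have A1 : A / s ^+ 2 <= k ^+ 2 by rewrite ler_pdivrMr// exprn_gt0.
have A2 : 0 <= A / s ^+ 2 by rewrite divr_ge0// ltW// exprn_gt0.
have B1 : `|B / s| <= k * q.
  rewrite normrM normfV (gtr0_norm s0) ler_pdivrMr//.
  by rewrite mulrAC.
have ke : 4 * (1 + 2 * q) * k <= e.
  by rewrite mulrC -ler_pdivlMr ?ge_min ?lexx ?orbT//; lra.
have k1 : k <= 1 by rewrite ge_min lexx.
apply: (@le_trans _ _ (4 * (A / s ^+ 2 + 2 * `|B / s|))).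
  rewrite ler_wpM2l//; apply: (le_trans (ler_normD _ _)).
  by rewrite (ger0_norm A2) normrM ger0_norm.
move: (A / _) (`|B / s|) A1 A2 B1 => A' B' A1 A2 B1.
by nra.
Unshelve. all: by end_near. Qed.

Lemma measurable_score_norm v :
  measurable_fun Theta0 (fun t => 4 * ip (score v t) (score v t)).
Proof.
have mT := open_measurable_cV open_Theta0.
pose D n := [set t : 'cV[R]_d | Theta0 (t + n.+1%:R^-1 *: v)].
have mD n : measurable (D n).
  by apply: open_measurable_cV; exact: open_translate.
pose h n := (fun t => 4 * n.+1%:R ^+ 2 * (2 - 2 *
     ip (sqrt_density (t + n.+1%:R^-1 *: v)) (sqrt_density t))) \_ (D n).
apply: (@measurable_fun_cvg _ _ _ _ h).
  move=> n; apply/measurable_restrict => //.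
  apply: measurable_funM; first exact: measurable_cst.
  apply: measurable_funB; first exact: measurable_cst.
  apply: measurable_funM; first exact: measurable_cst.
  exact: measurable_ip_sqrt_density.
move=> t tT; apply/cvgrPdist_le => e e0.
have /cvgrPdist_le /(_ e e0) N1 := @hellinger_distance_asymptotics v _ tT.
have cvg0 : (fun n : nat => (n.+1%:R^-1 : R)) @ \oo --> (0 : R) by exact: cvg_harmonic.
have N2 := cvg0 _ (near_line v tT).
near=> n; rewrite /h patchE ifT; first by near: n; exact: N1.
by rewrite inE; near: n; exact: N2.
Unshelve. all: by end_near. Qed.

Lemma score_delta i t : score (delta_mx i ord0) t = fun x => xi t x i ord0.
Proof.
rewrite scoreE; apply/funext => x; rewrite (bigD1 i)//= mxE !eqxx mul1r.
by rewrite big1 ?addr0// => j /negPf ji; rewrite mxE ji mul0r.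
Qed.

Lemma measurable_fisher_info i j : measurable_fun Theta0 (fun t => info t i j).
Proof.
pose Q v t := 4 * ip (score v t) (score v t).
apply: (@eq_measurable_fun _ _ _ _ Theta0 (fun t => 2^-1 *
  (Q (delta_mx i ord0 + delta_mx j ord0) t
   - Q (delta_mx i ord0) t - Q (delta_mx j ord0) t))).
  move=> t /set_mem tT; rewrite /Q fisher_infoE.
  have -> : score (delta_mx i ord0 + delta_mx j ord0) t =
      (fun x => xi t x i ord0 + 1 * xi t x j ord0).
    apply/funext => x; rewrite mul1r -(congr1 (@^~ x) (score_delta i t)).
    by rewrite -(congr1 (@^~ x) (score_delta j t)) /score linearD mulmxDl mxE.
  rewrite !score_delta ip_quadratic; [by field|exact: sqint_xi..].
apply: measurable_funM; first exact: measurable_cst.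
by apply: measurable_funB; first apply: measurable_funB;
  exact: measurable_score_norm.
Qed.

Section estimator.
Variables (S : X -> R) (f : 'cV[R]_d -> R) (r : R).
Hypothesis mS : measurable_fun setT S.
Hypothesis risk_le : forall t, Theta0 t ->
  (\int[P t]_x ((S x - f t) ^+ 2)%:E <= r%:E)%E.

Definition mean t := ip (fun x => S x * sqrt_density t x) (sqrt_density t).

Definition mean_derivative v t :=
  2 * ip (fun x => (S x - mean t) * sqrt_density t x) (score v t).

Lemma sqint_risk t : Theta0 t ->
  let g := fun x => (S x - f t) * sqrt_density t x in sqint g /\ ip g g <= r.
Proof.
move=> tT g.
have mf : measurable_fun setT (fun x => S x - f t) by exact: measurable_funB.
have mg : measurable_fun setT g.
  by apply: measurable_funM => //; exact: measurable_sqrt_density.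
have le_r : (\int[nu]_x (g x ^+ 2)%:E <= r%:E)%E.
  have := risk_le tT; rewrite (ge0_integral_density measurableT (density_p tT)).
  - rewrite (eq_integral (fun x => (g x ^+ 2)%:E))//.
    by move=> x _; rewrite /g exprMn -(sqr_sqrt_density x tT) -expr2.
  - exact: measurable_funX.
  - by move=> x _; exact: sqr_ge0.
have hg : sqint g.
  split => //; apply/integrableP; split.
    by apply/measurable_EFinP; exact: measurable_funX.
  rewrite (eq_integral (fun x => (g x ^+ 2)%:E)).
    exact: le_lt_trans le_r (ltry _).
  by move=> x _; rewrite /= ger0_norm ?sqr_ge0.
by split => //; rewrite -lee_fin -sqint_integralE.
Qed.

Lemma sqint_shift c t : Theta0 t -> sqint (fun x => (S x - c) * sqrt_density t x).
Proof.
move=> tT; have [h _] := sqint_risk tT.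
rewrite (_ : (fun _ => _) = (fun x => (S x - f t) * sqrt_density t x +
  (f t - c) * sqrt_density t x)); last by apply/funext => x; ring.
by apply: sqintD => //; apply: sqintZ; exact: sqint_sqrt_density.
Qed.

Lemma sqint_estimator t : Theta0 t -> sqint (fun x => S x * sqrt_density t x).
Proof.
move=> /(sqint_shift 0); congr sqint.
by apply/funext => x; rewrite subr0.
Qed.

Lemma mean_shift c t : Theta0 t ->
  ip (fun x => (S x - c) * sqrt_density t x) (sqrt_density t) = mean t - c.
Proof.
move=> tT; have hS := sqint_estimator tT; have ha := sqint_sqrt_density tT.
rewrite ipC (_ : (fun x => _) = (fun x => S x * sqrt_density t x - c * sqrt_density t x)).
  by rewrite ipBr ?ipZr ?ip_sqrt_density ?mulr1 1?ipC//; exact: sqintZ.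
by apply/funext => x; rewrite mulrBl.
Qed.

Lemma variance_shift b c t : Theta0 t ->
  ip (fun x => (S x - c) * sqrt_density t x) (fun x => (S x - c) * sqrt_density t x) =
  ip (fun x => (S x - b) * sqrt_density t x) (fun x => (S x - b) * sqrt_density t x) +
  2 * (b - c) * (mean t - b) + (b - c) ^+ 2.
Proof.
move=> tT; have ha := sqint_sqrt_density tT; have hb := sqint_shift b tT.
rewrite (_ : (fun x => (S x - c) * _) =
    (fun x => (S x - b) * sqrt_density t x + (b - c) * sqrt_density t x)).
  by rewrite ip_quadratic// mean_shift// ip_sqrt_density// mulr1.
by apply/funext => x; ring.
Qed.

Lemma variance_le t : Theta0 t ->
  ip (fun x => (S x - mean t) * sqrt_density t x) (fun x => (S x - mean t) * sqrt_density t x)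
  <= r - (mean t - f t) ^+ 2.
Proof.
move=> tT; have [_] := sqint_risk tT; rewrite (variance_shift (mean t))//.
by rewrite subrr mulr0 addr0; lra.
Qed.

Lemma near_mean_increment v t : Theta0 t -> \forall s \near (0 : R),
  (mean (t + s *: v) - mean t) ^+ 2 <= 2 * r.
Proof.
move=> tT.
have H := hellinger_continuous v tT (_ : 0 < 4^-1).
near=> s.
have tsT : Theta0 (t + s *: v) by near: s; exact: near_line.
have : let h := fun x => sqrt_density (t + s *: v) x - sqrt_density t x in ip h h <= 4^-1.
  by near: s; apply: H; rewrite invr_gt0.
set a := sqrt_density t; set b := sqrt_density (t + s *: v); set c := mean t.
move=> /= hd.
have hSa : sqint (fun x => (S x - c) * a x) by exact: sqint_shift.
have hSb : sqint (fun x => (S x - c) * b x) by exact: sqint_shift.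
have ha : sqint a by exact: sqint_sqrt_density.
have hb : sqint b by exact: sqint_sqrt_density.
have E : mean (t + s *: v) - c = ip (fun x => (S x - c) * b x + (S x - c) * a x)
   (fun x => b x - a x).
  rewrite ipC ipDr//; last exact: sqintB.
  rewrite ![ip (fun x => b x - a x) _]ipC !ipBr// -(mean_shift c tsT).
  have : ip (fun x => (S x - c) * a x) a = 0 by rewrite mean_shift// subrr.
  have -> : ip (fun x => (S x - c) * b x) a = ip (fun x => (S x - c) * a x) b.
    by congr Rintegral; apply/funext => x; ring.
  by rewrite -/b => ->; ring.
have V1 : ip (fun x => (S x - c) * a x) (fun x => (S x - c) * a x) <= r.
  by apply: (le_trans (variance_le tT)); rewrite gerBl sqr_ge0.
have V2 : ip (fun x => (S x - c) * b x) (fun x => (S x - c) * b x) <=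
    r + (mean (t + s *: v) - c) ^+ 2.
  rewrite (variance_shift (mean (t + s *: v)))// subrr mulr0 addr0 lerD2r.
  by apply: (le_trans (variance_le tsT)); rewrite gerBl sqr_ge0.
have := ip_cauchy_schwarz (sqintD hSb hSa) (sqintB hb ha).
rewrite -E; have := ip_sqrD_le hSb hSa.
have := ip_ge0 nu (fun x => b x - a x).
have := ip_ge0 nu (fun x => (S x - c) * b x + (S x - c) * a x).
move: (ip _ _) V1 (ip _ _) V2 => A V1 B V2.
move: (ip _ _) => C; move: (ip _ _) hd => D hd; move: (_ ^+ 2) V2 => M V2.
by move=> *; nra.
Unshelve. all: by end_near. Qed.

Lemma mean_increment v t e : Theta0 t -> 0 < e -> \forall s \near (0 : R),
  `|mean (t + s *: v) - mean t - s * mean_derivative v t| <= e * `|s|.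
Proof.
move=> tT e0; set c := mean t.
have H : \forall s \near (0 : R), [/\ sqint (sqrt_density (t + s *: v)),
    sqint (fun x => (S x - c) * sqrt_density (t + s *: v) x) &
    ip (fun x => (S x - c) * sqrt_density (t + s *: v) x)
       (fun x => (S x - c) * sqrt_density (t + s *: v) x) <= 3 * r].
  near=> s.
  have tsT : Theta0 (t + s *: v) by near: s; exact: near_line.
  have M : (mean (t + s *: v) - c) ^+ 2 <= 2 * r.
    by near: s; exact: near_mean_increment.
  split; [exact: sqint_sqrt_density|exact: sqint_shift|].
  rewrite (variance_shift (mean (t + s *: v)))// subrr mulr0 addr0.
  have := variance_le tsT; have := sqr_ge0 (mean (t + s *: v) - f (t + s *: v)).
  by move: (_ ^+ 2) (_ ^+ 2) M (ip _ _) => A B M V ? ?; lra.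
have mSc : measurable_fun setT (fun x => S x - c) by exact: measurable_funB.
have := expectation_derivative mSc (sqint_sqrt_density tT) (sqint_score v tT)
  (sqint_shift c tT) H (fun e => @hellinger_remainder v t e tT) e0.
have := near_line v tT.
apply: filterS2 => s tsT.
rewrite !mean_shift// subrr subr0.
by [].
Unshelve. all: by end_near. Qed.

Lemma mean_derivable v t : Theta0 t ->
  derivable mean t v /\ 'D_v mean t = mean_derivative v t.
Proof.
move=> tT.
have H : (fun h : R => h^-1 *: (mean (h *: v + t) - mean t)) @ 0^' -->
    mean_derivative v t.
  apply/cvgrPdist_le => e e0; near=> h.
  have h0 : h != 0 by near: h; exact: nbhs_dnbhs_neq.
  have : `|mean (t + h *: v) - mean t - h * mean_derivative v t| <= e * `|h|.
    by near: h; apply: nbhs_dnbhs; exact: mean_increment.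
  rewrite addrC -[leLHS]normrN.
  rewrite -ler_pdivrMr ?normr_gt0// -normfV -normrM.
  congr (_ <= _); congr (`|_|).
  by rewrite /GRing.scale /= [t + _]addrC; field.
by split; [apply/cvg_ex; exists (mean_derivative v t)|exact: cvg_lim].
Unshelve. all: by end_near. Qed.

Lemma mean_derivative_sum v t : Theta0 t ->
  mean_derivative v t =
    \sum_i v i ord0 * mean_derivative (delta_mx i ord0) t.
Proof.
move=> tT; rewrite /mean_derivative [in LHS]scoreE ip_sumr; last 2 first.
- exact: sqint_shift.
- by move=> i; exact: sqint_xi.
rewrite mulr_sumr; apply: eq_bigr => i _; rewrite score_delta; ring.
Qed.

Lemma information_inequality v t : Theta0 t ->
  mean_derivative v t ^+ 2 <=
    (r - (mean t - f t) ^+ 2) * (v^T *m info t *m v) ord0 ord0.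
Proof.
move=> tT; rewrite fisher_info_quadratic//.
have := ip_cauchy_schwarz (sqint_shift (mean t) tT) (sqint_score v tT).
have := variance_le tT; have := ip_ge0 nu (score v t).
rewrite /mean_derivative.
move: (ip _ _) (ip _ _) (ip _ _) (r - _) => A B C D; nra.
Qed.

End estimator.
End hellinger_model.

Section gluing.
Context {R : realType}.
Implicit Types (f g h : R -> R) (a x y z e r : R).

Lemma abs_cont_comp f h : {homo h : y z / y <= z} ->
  (forall y z, y <= z -> h z - h y <= z - y) -> abs_cont f -> abs_cont (f \o h).
Proof.
move=> hh hl acf e /acf[r r0 H]; exists r => // I s t no str.
have [st _] := no.
apply: (H _ (h \o s) (h \o t)); first exact: nonoverlapping_homo.
by apply: le_lt_trans str; apply: ler_sum => i _; exact: hl.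
Qed.

Lemma abs_cont_onS x y x' y' f : x <= x' -> x' <= y' -> y' <= y ->
  abs_cont_on x y f -> abs_cont_on x' y' f.
Proof.
move=> xx' xy' yy' acf.
rewrite /abs_cont_on (_ : f \o _ = (f \o clamp x y) \o clamp x' y').
  by apply: abs_cont_comp acf; [exact: clamp_homo|move=> u v; exact: clamp_lip].
apply/funext => z /=; have /andP[? ?] := clamp_itv z xy'.
by rewrite (@clamp_id _ x y)//; apply/andP; split; lra.
Qed.

Lemma abs_cont_on_cat x y z f : x <= y -> y <= z ->
  abs_cont_on x y f -> abs_cont_on y z f -> abs_cont_on x z f.
Proof.
move=> xy yz acx acz e e0; have e20 : 0 < e / 2 by lra.
have [r1 r10 H1] := acx _ e20; have [r2 r20 H2] := acz _ e20.
exists (Num.min r1 r2); first by rewrite lt_min r10.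
move=> I s t no; rewrite lt_min => /andP[s1 s2].
have E u : (f \o clamp x z) u = (f \o clamp x y) u + (f \o clamp y z) u - f y.
  rewrite /=; have [uy|/ltW yu] := leP u y.
    rewrite (clamp_left yz uy) addrK; congr f.
    rewrite /clamp (min_idPr uy) (min_idPr (le_trans uy yz))//.
  rewrite (clamp_right xy yu) addrAC subrr add0r; congr f.
  by rewrite /clamp !max_r// le_min ?(le_trans xy) ?yz ?yu.
have := H1 _ _ _ no s1; have := H2 _ _ _ no s2.
move=> h2 h1; rewrite (splitr e).
apply: le_lt_trans (ltrD h1 h2); rewrite -big_split/=; apply: ler_sum => i _.
move: (E (t i)) (E (s i)) => /= -> ->.
apply: le_trans (ler_normD _ _); rewrite le_eqVlt; apply/orP; left; apply/eqP.
by congr (`|_|); ring.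
Qed.

Lemma locally_abs_cont_on x y f : x <= y ->
  (forall z, x <= z <= y -> exists2 e, 0 < e & abs_cont_on (z - e) (z + e) f) ->
  abs_cont_on x y f.
Proof.
move=> xy loc.
pose A := [set w | x <= w <= y /\ abs_cont_on x w f].
have Ax : A x.
  split; first by rewrite lexx.
  have [e e0 he] := loc x (introT andP (conj (lexx x) xy)).
  by apply: abs_cont_onS he; lra.
have supA : has_sup A by split; [exists x|exists y => w [/andP[]]].
set s := sup A.
have xs : x <= s by apply: (ub_le_sup (proj2 supA)).
have sy : s <= y by apply: ge_sup; [exists x|move=> w [/andP[]]].
have [e e0 he] := loc s (introT andP (conj xs sy)).
have [w [/andP[xw wy] Aw] sw] := sup_adherent e0 supA.
have ws : w <= s by apply: (ub_le_sup (proj2 supA)); split => //; apply/andP.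
have Am : A (Num.min y (s + e)).
  have wm : w <= Num.min y (s + e) by rewrite le_min wy/=; lra.
  split; first by rewrite (le_trans xw wm) ge_min lexx.
  apply: (abs_cont_on_cat xw wm Aw); apply: abs_cont_onS he => //.
    exact: ltW.
  by rewrite ge_min lexx orbT.
have : Num.min y (s + e) <= s by apply: (ub_le_sup (proj2 supA)).
rewrite ge_min => /orP[ys|]; last by lra.
by have [_] := Am; rewrite min_l//; lra.
Qed.

End gluing.

Section coordinate_lines.
Context {R : realType} (n : nat).
Variables (D : set 'cV[R]_n) (f : 'cV[R]_n -> R) (i : 'I_n).
Hypotheses (oD : open D) (acf : abs_continuous_on D f).
Local Notation e_ := (delta_mx i ord0 : 'cV[R]_n).

Lemma coord_le_l2norm (v : 'cV[R]_n) j : `|v j ord0| <= l2norm v.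
Proof.
rewrite -sqrtr_sqr; apply: ler_wsqrtr; rewrite (bigD1 j)//= lerDl.
by apply: sumr_ge0 => k _; exact: sqr_ge0.
Qed.

Lemma l2norm_delta : l2norm e_ = 1.
Proof.
rewrite /l2norm (bigD1 i)//= big1 ?addr0 ?mxE ?eqxx ?expr1n ?sqrtr1// => j ji.
by rewrite mxE (negPf ji) expr0n.
Qed.

Lemma abs_continuous_on_line c z : D (c + z *: e_) ->
  exists2 r, 0 < r & abs_cont_on (z - r) (z + r) (fun s => f (c + s *: e_)).
Proof.
move=> Dz.
have /nbhs_cubeP[r r0 rD] : nbhs (c + z *: e_) D by apply: open_nbhs_nbhs.
have bD : [set x | l2norm (x - (c + (z - r / 4) *: e_)) < 3 * r / 4] `<=` D.
  move=> x /= xr; apply: rD => j.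
  have := le_lt_trans (coord_le_l2norm _ j) xr.
  rewrite !mxE ltr_norml; case: (j == i) => /=; rewrite ?mulr1 ?mulr0 => /andP[? ?];
    by apply/andP; split; lra.
exists (r / 8); first by lra.
have acz := acf bD l2norm_delta.
have h : abs_cont ((fun t => f (c + (z - r / 4) *: e_ + t *: e_))
    \o clamp (r / 8) (3 * r / 8)) by apply: (abs_cont_of_itv acz); lra.
rewrite /abs_cont_on.
have -> : (fun s => f (c + s *: e_)) \o clamp (z - r / 8) (z + r / 8) =
  ((fun t => f (c + (z - r / 4) *: e_ + t *: e_)) \o clamp (r / 8) (3 * r / 8))
   \o (fun s => s - (z - r / 4)).
  apply/funext => s /=; rewrite -addrA -scalerDl; congr (f (_ + _ *: _)).
  rewrite /clamp /Num.min /Num.max.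
  by repeat case: ifP => //; lra.
by apply: abs_cont_comp h => [u v|u v]; lra.
Qed.

Lemma abs_continuous_on_segment c x y : x <= y ->
  `[x, y]%classic `<=` [set s | D (c + s *: e_)] ->
  abs_cont_on x y (fun s => f (c + s *: e_)).
Proof.
move=> xy sD; apply: locally_abs_cont_on => // z zxy.
by apply: abs_continuous_on_line; apply: sD; rewrite /= in_itv.
Qed.

End coordinate_lines.

Lemma abs_continuous_on_line_continuous (R : realType) n (D : set 'cV[R]_n) f :
  open D -> abs_continuous_on D f -> line_continuous D f.
Proof.
move=> oD acf x Dx i.
have Dx0 : D (x + 0 *: delta_mx i ord0) by rewrite scale0r addr0.
have [r r0 /abs_cont_continuous /(_ 0)] := abs_continuous_on_line oD acf Dx0.
rewrite /prop_for /continuous_at sub0r add0r /= clamp_id; last by lra.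
apply: cvg_trans; apply: near_eq_cvg; near=> s.
have : `|s| <= r by near: s; exact: (@nbhs0_le _ R).
by rewrite ler_norml => sr; rewrite /= clamp_id.
Unshelve. all: by end_near. Qed.

Section norms.
Context {R : realType} (k : nat) (N : 'cV[R]_k -> R).
Hypothesis normN : is_norm N.

Lemma norm_triangle x y : N (x + y) <= N x + N y.
Proof. by case: normN. Qed.

Lemma norm_scale a x : N (a *: x) = `|a| * N x.
Proof. by case: normN. Qed.

Lemma norm_opp x : N (- x) = N x.
Proof. by rewrite -scaleN1r norm_scale normrN1 mul1r. Qed.

Lemma norm0 : N 0 = 0.
Proof. by rewrite -(scale0r 0) norm_scale normr0 mul0r. Qed.

Lemma norm_ge0 x : 0 <= N x.
Proof. by have := norm_triangle x (- x); rewrite subrr norm0 norm_opp; lra. Qed.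

Lemma norm_le_sum x : N x <= \sum_i `|x i ord0| * N (delta_mx i ord0).
Proof.
have {1}-> : x = \sum_i x i ord0 *: delta_mx i ord0.
  by rewrite [LHS]matrix_sum_delta; apply: eq_bigr => i _; rewrite big_ord1.
elim/big_ind2 : _ => [|x1 a x2 b xa xb|i _]; first by rewrite norm0.
- exact: le_trans (norm_triangle _ _) (lerD xa xb).
- by rewrite norm_scale.
Qed.

Lemma norm_dist x y : `|N x - N y| <= N (x - y).
Proof.
rewrite ler_norml; have := norm_triangle (x - y) y; rewrite subrK => h1.
have := norm_triangle (y - x) x; rewrite subrK -opprB norm_opp => h2.
by apply/andP; split; lra.
Qed.

Lemma measurable_norm : measurable_fun setT N.
Proof.
apply: line_continuous_measurable_on; first exact: openT.
move=> x _ i; rewrite /prop_for /continuous_at /= scale0r addr0.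
have e0 : 0 < N (delta_mx i ord0) + 1 by have := norm_ge0 (delta_mx i ord0); lra.
apply/cvgrPdist_le => e ep; near=> s.
apply: (le_trans (norm_dist _ _)).
rewrite opprD addNKr norm_opp norm_scale.
have : `|s| <= e / (N (delta_mx i ord0) + 1).
  by near: s; apply: (@nbhs0_le _ R); exact: divr_gt0.
rewrite ler_pdivlMr//; apply: le_trans.
by rewrite ler_wpM2l// lerDl.
Unshelve. all: by end_near. Qed.

Lemma continuous_norm_tr : continuous (fun v : 'rV[R]_k => N v^T).
Proof.
move=> v B /nbhs_ballP[e /= e0 eB]; apply/nbhs_ballP.
set K := \sum_i N (delta_mx i ord0).
have K0 : 0 <= K by apply: sumr_ge0 => i _; exact: norm_ge0.
exists (e / (K + 1)) => /=; first by rewrite divr_gt0//; lra.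
move=> w [_ vw] /=; apply: eB; rewrite /ball/=.
apply: (le_lt_trans (norm_dist _ _)); apply: (le_lt_trans (norm_le_sum _)).
apply: (@le_lt_trans _ _ (\sum_i e / (K + 1) * N (delta_mx i ord0))).
  apply: ler_sum => i _; rewrite ler_wpM2r ?norm_ge0// !mxE.
  by have := vw ord0 i; rewrite /ball /= => /ltW.
rewrite -mulr_sumr -/K mulrAC ltr_pdivrMr; last by lra.
by rewrite ltr_pM2l// ltrDl.
Qed.

Lemma norm_slice_min i : exists2 m, 0 < m & forall x : 'cV[R]_k,
  (forall j, `|x j ord0| <= 1) -> x i ord0 = 1 -> m <= N x.
Proof.
pose A (j : 'I_k) : set R := if j == i then [set 1] else `[-1, 1]%classic.
have cA : compact [set v : 'rV[R]_k | forall j, A j (v ord0 j)].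
  apply: rV_compact => j; rewrite /A; case: (j == i).
    exact: compact_set1.
  exact: segment_compact.
have A0 : [set v : 'rV[R]_k | forall j, A j (v ord0 j)] !=set0.
  exists (delta_mx ord0 i) => j; rewrite /A mxE eqxx /=.
  by case: (j == i) => //=; rewrite in_itv/=; apply/andP; split; lra.
have [c /set_mem Ac cmin] := compact_EVT_min A0 cA
  (continuous_subspaceT continuous_norm_tr).
exists (N c^T) => [|x x1 xi].
  rewrite lt_def norm_ge0 andbT; apply/eqP => N0.
  have c0 : c^T = 0 by case: normN => _ _; apply.
  have := Ac i; rewrite /A eqxx /= => ci.
  have := congr1 (fun M : 'cV[R]_k => M i ord0) c0; rewrite !mxE ci => /eqP.
  by rewrite oner_eq0.
rewrite -[x]trmxK; apply: cmin; rewrite inE => j; rewrite /A mxE.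
have [->|ji] := eqVneq j i => //=.
by rewrite in_itv/= -ler_norml.
Qed.

Lemma norm_bounds_coord : exists2 C, 0 <= C &
  forall (x : 'cV[R]_k) j, `|x j ord0| <= C * N x.
Proof.
have /choice[m Hm] (i : 'I_k) : exists m, 0 < m /\ forall x : 'cV[R]_k,
    (forall j, `|x j ord0| <= 1) -> x i ord0 = 1 -> m <= N x.
  by have [m m0 H] := norm_slice_min i; exists m.
have m0 i : 0 < (m i)^-1 by rewrite invr_gt0; have [] := Hm i.
exists (\sum_i (m i)^-1) => [|x j]; first by apply: sumr_ge0 => i _; exact: ltW.
pose i := [arg max_(i > j) `|x i ord0|]%O.
have xi l : `|x l ord0| <= `|x i ord0|.
  by rewrite /i; case: arg_maxP => // i' _ /(_ l isT).
apply: (le_trans (xi j)).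
have [xi0|xi0] := eqVneq (x i ord0) 0.
  rewrite xi0 normr0 mulr_ge0 ?norm_ge0// sumr_ge0// => l _; exact: ltW.
have n0 : 0 < `|x i ord0| by rewrite normr_gt0.
have [mi0 /(_ ((x i ord0)^-1 *: x))] := Hm i.
have -> : m i <= N ((x i ord0)^-1 *: x) = (`|x i ord0| <= (m i)^-1 * N x).
  rewrite norm_scale normfV [_ * N x]mulrC ler_pdivlMr//.
  by rewrite [X in _ = (_ <= X)]mulrC ler_pdivlMr// [m i * _]mulrC.
rewrite mxE mulVf// => /(_ _ erefl) H.
apply: (@le_trans _ _ ((m i)^-1 * N x)).
  by apply: H => l; rewrite mxE normrM normfV mulrC ler_pdivrMr// mul1r.
rewrite ler_wpM2r ?norm_ge0// (bigD1 i)//= lerDl sumr_ge0// => l _; exact: ltW.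
Qed.

Lemma dual_norm_le u x : dual_norm N u <= 1 -> (u^T *m x) ord0 ord0 <= N x.
Proof.
move=> u1; have [C C0 HC] := norm_bounds_coord.
have [x0|x0] := eqVneq (N x) 0.
  have -> : x = 0 by case: normN => _ _; apply.
  by rewrite mulmx0 mxE norm0.
have Nx : 0 < N x by rewrite lt_def x0 norm_ge0.
rewrite -[leRHS]mulr1 -ler_pdivrMl//; apply: le_trans u1.
apply: ub_le_sup; last first.
  exists ((N x)^-1 *: x); rewrite /= ?norm_scale ?gtr0_norm ?invr_gt0 ?mulVf//.
  by rewrite -scalemxAr mxE.
exists (\sum_i `|u i ord0| * C) => _ /= [y y1 <-].
rewrite mxE; apply: ler_sum => i _; rewrite mxE.
apply: (le_trans (ler_norm _)); rewrite normrM ler_wpM2l//.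
by apply: (le_trans (HC y i)); rewrite -[leRHS]mulr1 ler_wpM2l.
Qed.

Lemma op_norm_ge0 d (A : 'M[R]_(d, k)) (h : 'cV[R]_d) : l2norm h <= 1 ->
  N (A^T *m h) <= op_norm N A.
Proof.
move=> h1; apply: ub_le_sup; last by exists h.
exists (\sum_j (\sum_i `|A i j|) * N (delta_mx j ord0)) => _ /= [g g1 <-].
apply: (le_trans (norm_le_sum _)); apply: ler_sum => j _.
rewrite ler_wpM2r ?norm_ge0// mxE; apply: (le_trans (ler_norm_sum _ _ _)).
apply: ler_sum => i _; rewrite mxE normrM -[leRHS]mulr1 ler_wpM2l//.
exact: le_trans (coord_le_l2norm g i) g1.
Qed.

Lemma op_norm_coord : exists2 C, 0 <= C &
  forall d (A : 'M[R]_(d, k)) i j, `|A i j| <= C * op_norm N A.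
Proof.
have [C C0 HC] := norm_bounds_coord; exists C => // d A i j.
have -> : A i j = (A^T *m delta_mx i ord0 : 'cV[R]_k) j ord0.
  by rewrite -colE !mxE.
apply: (le_trans (HC _ j)); rewrite ler_wpM2l//.
by apply: op_norm_ge0; rewrite l2norm_delta.
Qed.

End norms.

Lemma l2norm_sqrtmx (R : realType) k (A : 'M[R]_k) (u : 'cV[R]_k) :
  l2norm (sqrtmx A *m u) = 0 \/
  l2norm (sqrtmx A *m u) ^+ 2 = (u^T *m A *m u) ord0 ord0.
Proof.
rewrite /sqrtmx; case: xgetP => [S _ [[symS _] SS]|_]; [right|left].
  rewrite -SS sqr_sqrtr; last by apply: sumr_ge0 => i _; exact: sqr_ge0.
  rewrite -[in X in _ *m (X *m _)]symS !mulmxA -trmx_mul -mulmxA mxE.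
  by apply: eq_bigr => i _; rewrite !mxE expr2.
by rewrite mul0mx /l2norm big1 ?sqrtr0// => i _; rewrite mxE expr0n.
Qed.

Section coordinate_integration_by_parts.
Context {R : realType}.
Local Notation mu := (@lebesgue_measure R).

Lemma ae_impl (P Q : R -> Prop) : (forall t, P t -> Q t) ->
  {ae mu, forall t, P t} -> {ae mu, forall t, Q t}.
Proof.
move=> PQ [A [mA A0 HA]]; exists A; split => // t /= nQ; apply: HA => /= Pt.
exact: nQ (PQ t Pt).
Qed.

Lemma abs_cont_on_ae_derivable (U : set R) (f : R -> R) : open U ->
  (forall x y, x <= y -> `[x, y]%classic `<=` U -> abs_cont_on x y f) ->
  {ae mu, forall t, U t -> derivable f t 1}.
Proof.
move=> oU acf.
pose P (j : nat) (t : R) := forall a b : rat, unpickle j = Some (a, b) ->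
  ratr a <= ratr b :> R -> `[ratr a, ratr b]%classic `<=` U ->
  ratr a < t < ratr b -> derivable f t 1.
have aeP j : \forall t \ae mu, P j t.
  rewrite /P; case: (unpickle j) => [[a b]|]; last exact: aeW.
  have [[ab abU]|nab] := pselect ((ratr a <= ratr b :> R) /\
      `[ratr a, ratr b]%classic `<=` U).
    have [g [_ _]] := abs_cont_on_is_derive ab (acf _ _ ab abU).
    by apply: ae_impl => t ht a' b' [<- <-] _ _ /ht[].
  by apply: aeW => t a' b' [<- <-] ? ?; exfalso; exact: nab.
have := ae_foralln aeP; apply: ae_impl => t Pt Ut.
have /nbhs_ballP[r /= r0 rU] := open_nbhs_nbhs (conj oU Ut).
have t1 : t - r < t by lra.
have t2 : t < t + r by lra.
have [a] := rat_in_itvoo t1; have [b] := rat_in_itvoo t2.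
rewrite !in_itv/= => /andP[tb br] /andP[ra at_].
apply: (Pt (pickle (a, b)) a b); rewrite ?pickleK//; [by lra| |by apply/andP].
move=> z /=; rewrite in_itv/= => /andP[az zb].
by apply: rU; rewrite /ball/= ltr_norml; apply/andP; split; lra.
Qed.

Context (n : nat).
Implicit Types (D : set 'cV[R]_n) (f g m q w : 'cV[R]_n -> R) (c : 'cV[R]_n).
Variable i : 'I_n.
Local Notation e_ := (delta_mx i ord0 : 'cV[R]_n).
Local Notation line c := (fun s : R => c + s *: e_).

Lemma derive_line f c s :
  'D_1 (f \o line c) s = 'D_e_ f (c + s *: e_) /\
  (derivable f (c + s *: e_) e_ -> derivable (f \o line c) s 1).
Proof.
have E : (fun h : R => h^-1 *: ((f \o line c) (h *: (1 : R) + s) - (f \o line c) s))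
   = (fun h => h^-1 *: (f (h *: e_ + (c + s *: e_)) - f (c + s *: e_))).
  apply/funext => h /=; congr (_ *: (f _ - _)).
  by rewrite -[h *: (1 : R)]/(h * 1) mulr1 scalerDl addrCA.
by rewrite /derive /derivable E.
Qed.

Lemma open_line D c : open D -> open [set s | D (c + s *: e_)].
Proof.
move=> oD; rewrite openE => s /= Ds.
have /nbhs_cubeP[r r0 rD] : nbhs (c + s *: e_) D by apply: open_nbhs_nbhs.
apply/nbhs_ballP; exists r => //= t st; apply: rD => j.
move: st; rewrite /ball /= ltr_norml !mxE => /andP[? ?].
by case: (j == i) => /=; rewrite ?mulr1 ?mulr0; apply/andP; split; lra.
Qed.

Lemma measurable_line c :
  measurable_fun [set: measurableTypeR R] (fun s : measurableTypeR R => c + s *: e_).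
Proof.
apply: measurable_fun_mxP => j l.
rewrite (_ : (fun s => _) = (fun s => c j l + s * e_ j l)).
  by apply: measurable_funD => //; apply: measurable_funM.
by apply/funext => s; rewrite !mxE.
Qed.

Lemma measurable_fun_line D f c : measurable D -> measurable_fun D f ->
  measurable_fun ([set s | D (c + s *: e_)] : set (measurableTypeR R)) (f \o line c).
Proof.
move=> mD mf; apply: (measurable_comp mD _ mf); first by move=> _ [s Ds <-].
exact: measurable_funTS (measurable_line c).
Qed.

Section hypotheses.
Variables (D : set 'cV[R]_n) (q m g dg w : 'cV[R]_n -> R).
Hypotheses (oD : open D) (q0 : forall v, D v -> 0 <= q v).
Hypotheses (acq : abs_continuous_on D q) (lcg : line_continuous D g).
Hypothesis boundary : forall b : 'cV[R]_n, (closure D `\` D) b ->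
  q (b + s *: e_) @[s --> within [set s : R | D (b + s *: e_)] (nbhs 0)]
      --> (0 : R).
Hypothesis acg : forall c x y, x <= y ->
  `[x, y]%classic `<=` [set s | D (c + s *: e_)] -> abs_cont_on x y (g \o line c).
Hypothesis lcm : line_continuous D m.
Hypothesis dm : forall v, D v -> derivable m v e_ /\ `|'D_e_ m v| <= w v.
Hypothesis w0 : forall v, 0 <= w v.
Hypotheses (mw : measurable_fun D w) (mdg : measurable_fun D dg).
Hypothesis dgE : forall c,
  {ae mu, forall s, D (c + s *: e_) -> derivable (g \o line c) s 1 /\
     'D_1 (g \o line c) s = dg (c + s *: e_)}.

Let V := D `&` [set v | 0 < q v].
Let F v := ('D_e_ m v - dg v) * q v + (m v - g v) * 'D_e_ q v.
Let G v := q v + w v * q v + `|dg v| * q v + `|(m v - g v) * 'D_e_ q v|.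

Hypothesis iG : (lebesgue_cV R n).-integrable V (EFin \o G).

Let mD : measurable D. Proof. exact: open_measurable_cV. Qed.
Let mq : measurable_fun D q.
Proof.
by apply: line_continuous_measurable_on => //; exact: abs_continuous_on_line_continuous.
Qed.
Let mdq : measurable_fun D (fun v => 'D_e_ q v).
Proof.
by apply: measurable_partial_derivative => //; exact: abs_continuous_on_line_continuous.
Qed.
Let mm : measurable_fun D m.
Proof. exact: line_continuous_measurable_on. Qed.
Let mdm : measurable_fun D (fun v => 'D_e_ m v).
Proof. exact: measurable_partial_derivative. Qed.
Let mg : measurable_fun D g.
Proof. exact: line_continuous_measurable_on. Qed.

Let mV : measurable V.
Proof.
have := mq mD (measurable_itv `]0, +oo[).
by congr measurable; apply/seteqP; split => v /= [Dv]; rewrite /= in_itv/= andbT.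
Qed.

Let mF : measurable_fun V F.
Proof.
apply: (measurable_funS mD (@subIsetl _ _ _)).
by apply: measurable_funD; apply: measurable_funM => //; exact: measurable_funB.
Qed.

Let FG v : V v -> `|F v| <= G v.
Proof.
move=> [Dv /= qv]; have [_ dmw] := dm Dv; apply: (le_trans (ler_normD _ _)).
rewrite /G lerD2r normrM (gtr0_norm qv).
apply: (@le_trans _ _ ((w v + `|dg v|) * q v)).
  rewrite ler_wpM2r ?(ltW qv)//; apply: (le_trans (ler_normB _ _)).
  by rewrite lerD2r.
by rewrite mulrDl -addrA lerDr ltW.
Qed.

Lemma coordinate_integration_by_parts :
  (\int[lebesgue_cV R n]_(v in V) (F v)%:E = 0)%E.
Proof.
rewrite integral_mkcond restrict_EFin.
apply: (@integral_eq0_of_lines _ _ i _ (G \_ V)).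
- by apply/(measurable_restrictT F mV).
- by move=> v; rewrite !patchE; case: ifPn => [/set_mem /FG//|]; rewrite normr0.
- by rewrite -restrict_EFin; exact/(integrable_mkcond _ mV).1.
move=> c iGc.
pose U := [set s | D (c + s *: e_)].
have oU : open U by exact: open_line.
have mU : measurable (U : set (measurableTypeR R)) by exact: open_measurable.
pose W := U `&` [set s | 0 < (q \o line c) s].
have mql := @measurable_fun_line D q c mD mq.
have mW : measurable (W : set (measurableTypeR R)).
  have := mql mU `]0, +oo[%classic (measurable_itv _).
  by congr measurable; apply/seteqP; split => v /= [Dv]; rewrite /= in_itv/= andbT.
have WV s : W s = V (c + s *: e_) by [].
have iGW : mu.-integrable W (EFin \o (G \o line c)).
  have := integrableS measurableT mW (@subsetT _ _) iGc.
  apply: eq_integrable => // s /set_mem Ws; rewrite /= patchE ifT//.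
  by rewrite inE -WV.
have mS f : measurable_fun D f ->
    measurable_fun (W : set (measurableTypeR R)) (f \o line c).
  by move=> mf; apply: measurable_funS mU (@subIsetl _ _ _) _; exact: measurable_fun_line.
have mS' f : measurable_fun V f ->
    measurable_fun (W : set (measurableTypeR R)) (f \o line c).
  by move=> mf; exact: (@measurable_fun_line V f c mV mf).
have byG (f : R -> R) : measurable_fun (W : set (measurableTypeR R)) f ->
    (forall s, W s -> `|f s| <= G (c + s *: e_)) -> mu.-integrable W (EFin \o f).
  move=> mf fG; apply: le_integrable iGW => //; first exact/measurable_EFinP.
  move=> s Ws /=; rewrite lee_fin (le_trans (fG _ Ws))//; exact: ler_norm.
have Gpos s : W s -> [/\ 0 <= q (c + s *: e_), 0 <= w (c + s *: e_) * q (c + s *: e_),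
    0 <= `|dg (c + s *: e_)| * q (c + s *: e_) &
    0 <= `|(m (c + s *: e_) - g (c + s *: e_)) * 'D_e_ q (c + s *: e_)|].
  by move=> [Us /= /ltW qs]; split => //; rewrite mulr_ge0.
have iwq : mu.-integrable W (EFin \o ((w \o line c) \* (q \o line c))).
  apply: byG; first by apply: measurable_funM; exact: mS.
  move=> s Ws; have [h1 h2 h3 h4] := Gpos _ Ws.
  by rewrite /G /= ger0_norm//; lra.
have acqU x y : x <= y -> `[x, y]%classic `<=` U -> abs_cont_on x y (q \o line c).
  by move=> xy xyU; exact: (abs_continuous_on_segment (i := i) oD acq xy xyU).
have cqU x y : x <= y -> `[x, y]%classic `<=` U ->
    {within `[x, y], continuous (q \o line c)}.
  move=> xy xyU; have cc := abs_cont_continuous (acqU _ _ xy xyU).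
  apply: (@subspace_eq_continuous _ _ _ ((q \o line c) \o clamp x y)).
    by move=> z; rewrite inE /= in_itv/= => zxy; rewrite /= /from_subspace/= clamp_id.
  exact: continuous_subspaceT.
have acmW x y : x <= y -> `[x, y]%classic `<=` W -> abs_cont_on x y (m \o line c).
  move=> xy xyW; have xyU : `[x, y]%classic `<=` U by move=> s /xyW[].
  have [z zxy zmin] := EVT_min xy (cqU _ _ xy xyU).
  have qz : 0 < (q \o line c) z by have [] := xyW _ zxy.
  have mxy : measurable (`[x, y]%classic : set (measurableTypeR R)) by [].
  apply: (@derivable_abs_cont_on _ _ _ _ (w \o line c)) => //.
  - have := integrableZl mxy ((q \o line c) z)^-1 (integrableS mW mxy xyW iwq).
    apply: le_integrable => //.
      by apply/measurable_EFinP; apply: measurable_funS mW xyW _; exact: mS.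
    move=> s sxy; rewrite /= lee_fin ger0_norm//; apply: le_trans (ler_norm _).
    rewrite mulrCA ler_peMr// ler_pdivlMl// mulr1.
    exact: zmin.
  - move=> t txy; have [Ut _] : W t by apply: xyW; rewrite /= in_itv.
    have [dmt le_w] := dm Ut; have [E /(_ dmt) dmt'] := derive_line m c t.
    by rewrite derive1E E.
  - by move=> t; exact: w0.
have iRV (f : R -> R) : mu.-integrable W (EFin \o f) -> \int[mu]_(s in W) f s = 0 ->
    (\int[mu]_(s in W) (f s)%:E = 0)%E.
  by move=> fi f0; rewrite -(fineK (integrable_fin_num mW fi)) -/(Rintegral _ _ _) f0.
have E : (\int[mu]_(s in W) (F (c + s *: e_))%:E = 0)%E.
  apply: iRV; first apply: byG; first exact: (mS' F mF).
    by move=> s Ws; exact: FG.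
  apply: (@integral_product_derivative_eq0 R U (q \o line c)
    ((m \o line c) \- (g \o line c)) ((fun v => 'D_e_ q v) \o line c)
    ((fun v => 'D_e_ m v - dg v) \o line c)) => //.
  - by move=> s Us; exact: q0.
  - move=> t nUt e e0.
    have [cl|ncl] := pselect (closure D (c + t *: e_)).
      have := @boundary (c + t *: e_) (conj cl nUt).
      move=> /cvgr_lt /(_ e e0); rewrite near_withinE.
      move=> /nbhs_ballP[r /= r0 rH]; apply/nbhs_ballP; exists r => //= s st Us.
      have := rH (s - t); rewrite -addrA -scalerDl subrKC; apply => //.
      by move: st; rewrite /ball /= sub0r opprB.
    have oc : open (~` closure D) by apply: closed_openC; exact: closed_closure.
    have := open_nbhs_nbhs (conj (@open_line _ c oc) ncl).
    by apply: filterS => s /= ns Us; exfalso; apply: ns; exact: subset_closure.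
  - move=> x y xy xyW; apply: abs_cont_onB; first exact: acmW.
    by apply: acg => // s /xyW[].
  - by move=> t _ _; have [] := derive_line q c t.
  - apply: ae_impl (dgE c) => s dgs Ws; have [Us _] := Ws.
    have [dg1 dg2] := dgs Us.
    have [dms _] := dm Us; have [E /(_ dms) dmt'] := derive_line m c s.
    by rewrite deriveB// E dg2.
  - by apply: measurable_funB; exact: mS.
  - by apply: mS; exact: measurable_funB.
  - exact: mS.
  - apply: byG; first exact: mS.
    move=> s Ws; have [h1 h2 h3 h4] := Gpos _ Ws.
    by rewrite /G /= ger0_norm//; lra.
  - apply: byG.
      by apply: measurable_funM; apply: mS => //; exact: measurable_funB.
    move=> s Ws; have [h1 h2 h3 h4] := Gpos _ Ws.
    have [Us /= qs] := Ws; have [_ le_w] := dm Us.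
    rewrite /G /= normrM (ger0_norm h1).
    apply: (@le_trans _ _ ((w (c + s *: e_) + `|dg (c + s *: e_)|) * q (c + s *: e_))).
      rewrite ler_wpM2r//; apply: (le_trans (ler_normB _ _)).
      by rewrite lerD2r.
    by rewrite mulrDl; lra.
  - apply: byG.
      by apply: measurable_funM; [apply: measurable_funB|]; apply: mS.
    by move=> s Ws; have [h1 h2 h3 h4] := Gpos _ Ws; rewrite /G /=; lra.
rewrite -E [RHS]integral_mkcond; apply: eq_integral => s _.
by rewrite !patchE; case: ifPn => sV; case: ifPn => sW //; exfalso;
   [move/negP: sW; apply; rewrite inE; move: sV; rewrite inE
   |move/negP: sV; apply; rewrite inE; move: sW; rewrite inE].
Qed.

End hypotheses.
End coordinate_integration_by_parts.

Section linear_forms.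
Context {R : realType}.
Local Notation mu := (@lebesgue_measure R).

Lemma abs_continuous_itv_lin (a b c : R) (f h : R -> R) :
  abs_continuous_itv a b f -> abs_continuous_itv a b h ->
  abs_continuous_itv a b (fun t => c * f t + h t).
Proof.
move=> acf ach e e0.
have c0 : 0 < 2 * (`|c| + 1) by have := normr_ge0 c; lra.
have [r1 r10 H1] := acf _ (divr_gt0 e0 c0).
have [r2 r20 H2] := ach _ (divr_gt0 e0 (ltr0Sn _ 1)).
exists (Num.min r1 r2); first by rewrite lt_min r10.
move=> n s t st tr; rewrite lt_min => /andP[/(H1 _ _ _ st tr) h1 /(H2 _ _ _ st tr) h2].
apply: (@le_lt_trans _ _ (`|c| * (\sum_(i < n) `|f (t i) - f (s i)|) +
   \sum_(i < n) `|h (t i) - h (s i)|)).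
  rewrite mulr_sumr -big_split/=; apply: ler_sum => i _.
  rewrite -normrM; apply: le_trans (ler_normD _ _).
  by rewrite le_eqVlt; apply/orP; left; apply/eqP; congr (`|_|); ring.
move: h1 h2; rewrite ltr_pdivlMr// => h1 h2.
have : `|c| * (\sum_(i < n) `|f (t i) - f (s i)|) <= e / 2.
  have := sumr_ge0 _ (fun i (_ : i \in index_enum 'I_n) => normr_ge0 (f (t i) - f (s i))).
  have := normr_ge0 c; move: h1; rewrite big_seq; move: (\sum_(_ <- _ | _) _) => A.
  by nra.
by lra.
Qed.

Context (d k : nat) (D : set 'cV[R]_d) (phi : 'cV[R]_d -> 'cV[R]_k).
Variable u : 'cV[R]_k.
Hypotheses (oD : open D)
  (acphi : forall j, abs_continuous_on D (fun t => phi t j ord0)).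
Local Notation g := (fun t => \sum_j u j ord0 * phi t j ord0).

Lemma abs_continuous_linear_form : abs_continuous_on D g.
Proof.
move=> c r cD v v1.
elim: (index_enum 'I_k) => [|j s IH].
  move=> e e0; exists 1 => // n s t _ _ _.
  by rewrite big1// => i _; rewrite !big_nil subrr normr0.
have := abs_continuous_itv_lin (u j ord0) (acphi j cD v1) IH.
by congr abs_continuous_itv; apply/funext => t; rewrite big_cons.
Qed.

Lemma ae_derive_linear_form i c : {ae mu, forall s,
   D (c + s *: delta_mx i ord0) ->
   derivable (g \o (fun s : R => c + s *: delta_mx i ord0)) s 1 /\
   'D_1 (g \o (fun s : R => c + s *: delta_mx i ord0)) s =
   \sum_j u j ord0 * 'D_(delta_mx i ord0) (fun t => phi t j ord0)
      (c + s *: delta_mx i ord0)}.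
Proof.
pose line (s : R) : 'cV[R]_d := c + s *: delta_mx i ord0.
have aej (n : nat) : \forall s \ae mu, forall j : 'I_k, j = n :> nat -> D (line s) ->
    derivable ((fun t => phi t j ord0) \o line) s 1.
  have [nk|kn] := ltnP n k; last first.
    by apply: aeW => s j jn; move: (ltn_ord j); rewrite jn ltnNge kn.
  pose j0 := Ordinal nk.
  have := @abs_cont_on_ae_derivable R [set s | D (line s)]
    ((fun t => phi t j0 ord0) \o line) (@open_line R d i D c oD)
    (fun x y xy xyD => abs_continuous_on_segment oD (acphi j0) xy xyD).
  apply: ae_impl => s Hs j jn Ds; have -> : j = j0 by apply: val_inj.
  exact: Hs.
have := ae_foralln aej; apply: ae_impl => s Hs Ds.
have gE : g \o line = \sum_(j < k) (u j ord0 \*: ((fun t => phi t j ord0) \o line)).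
  by apply/funext => z; rewrite fct_sumE.
have dj (j : 'I_k) : derivable ((fun t => phi t j ord0) \o line) s 1 by exact: Hs.
rewrite gE; split; first by apply: derivable_sum => j; exact: derivableZ.
rewrite derive_sum; last by move=> j; exact: derivableZ.
apply: eq_bigr => j _; rewrite deriveZ//.
by have [-> _] := @derive_line R d i (fun t => phi t j ord0) c s.
Qed.

End linear_forms.

Section van_trees_inequality.
Context (R : realType) (d k : nat) (dX : measure_display) (X : measurableType dX).
Variables (nu : {sigma_finite_measure set X -> \bar R}) (Theta0 : set 'cV[R]_d).
Variables (P : 'cV[R]_d -> probability X R) (p : 'cV[R]_d -> X -> R).
Variables (xi : 'cV[R]_d -> X -> 'cV[R]_d) (Q : probability 'cV[R]_d R).
Variable q : 'cV[R]_d -> R.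
Hypothesis oT : open Theta0.
Hypothesis dens :
  forall t, Theta0 t -> is_density nu setT (P t) (p t).
Hypothesis hell :
  forall t, Theta0 t -> hellinger_derivative nu p t (xi t).
Let info t := fisher_info nu (xi t).
Let L := lebesgue_cV R d.

Hypothesis densq : is_density L Theta0 Q q.
Hypothesis acq : abs_continuous_on Theta0 q.
Hypothesis intinfo : forall i j, L.-integrable Theta0
    (fun t => (prior_info_integrand q t i j)%:E).
Hypothesis trinfo : (\int[Q]_(t in Theta0) (\tr (info t))%:E < +oo)%E.

Let mT : measurable Theta0. Proof. exact: open_measurable_cV. Qed.
Let mq : measurable_fun Theta0 q. Proof. by case: densq. Qed.
Let q0 t : Theta0 t -> 0 <= q t. Proof. by case: densq => _ + _ => /[apply]. Qed.

Lemma fisher_info_diag_ge0 t i : 0 <= info t i i.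
Proof. by rewrite fisher_infoE mulr_ge0 ?ip_ge0. Qed.

Lemma fisher_info_le_trace t i j : Theta0 t -> `|info t i j| <= \tr (info t).
Proof.
move=> tT.
have tr1 l : info t l l <= \tr (info t).
  by rewrite /mxtrace (bigD1 l)//= lerDl sumr_ge0// => l' _; exact: fisher_info_diag_ge0.
have := ip_quadratic 1 (sqint_xi hell i tT) (sqint_xi hell j tT).
have := ip_quadratic (-1) (sqint_xi hell i tT) (sqint_xi hell j tT).
move: (tr1 i) (tr1 j); rewrite !fisher_infoE.
have h1 := ip_ge0 nu (fun x => xi t x i ord0 + 1 * xi t x j ord0).
have h2 := ip_ge0 nu (fun x => xi t x i ord0 + -1 * xi t x j ord0).
move: (inner_prod _ _ _) h1 (inner_prod _ _ _) h2 => A A0 B B0.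
move: (inner_prod _ _ _) (inner_prod _ _ _) (inner_prod _ _ _) => C E F; move: (\tr _) => tr h1 h2 h3 h4.
by rewrite ler_norml; apply/andP; split; lra.
Qed.

Lemma integrable_prior (h : 'cV[R]_d -> R) : measurable_fun Theta0 h ->
  Q.-integrable Theta0 (EFin \o h) <-> L.-integrable Theta0 (EFin \o (h \* q)).
Proof. by move=> mh; exact: (integrable_density mT densq mh). Qed.

Lemma integrable_fisher_info i j :
  L.-integrable Theta0 (EFin \o (fun t => info t i j * q t)).
Proof.
have mi l l' := measurable_fisher_info oT dens hell l l'.
have mtr : measurable_fun Theta0 (fun t => \tr (info t)).
  by apply: measurable_sum => l; exact: mi.
apply/(integrable_prior (mi i j)).1.
have Itr : Q.-integrable Theta0 (EFin \o (fun t => \tr (info t))).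
  apply/integrableP; split; first exact/measurable_EFinP.
  rewrite (eq_integral (fun t => (\tr (info t))%:E))// => t _.
  by rewrite /= ger0_norm// sumr_ge0// => l _; exact: fisher_info_diag_ge0.
apply: le_integrable Itr => //; first exact/measurable_EFinP.
move=> t tT; rewrite /= lee_fin; apply: le_trans (ler_norm _).
exact: fisher_info_le_trace.
Qed.

Lemma integral_prior1 : (\int[L]_(t in Theta0) (q t)%:E = Q Theta0)%E.
Proof. by have [_ _ ->] := densq. Qed.

Lemma integrable_q : L.-integrable Theta0 (EFin \o q).
Proof.
apply/integrableP; split; first exact/measurable_EFinP.
rewrite (eq_integral (fun t => (q t)%:E)).
  by rewrite integral_prior1; apply: le_lt_trans (probability_le1 _ mT) (ltry _).
by move=> t /set_mem tT; rewrite /= ger0_norm ?q0.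
Qed.


Let V := Theta0 `&` [set t | 0 < q t].

Let mV : measurable V.
Proof.
have := mq mT (measurable_itv `]0, +oo[).
by congr measurable; apply/seteqP; split => v /= [Dv]; rewrite /= in_itv/= andbT.
Qed.

Definition has_integral (h : 'cV[R]_d -> R) (a : R) :=
  L.-integrable V (EFin \o h) /\ \int[L]_(t in V) h t = a.

Lemma has_integralD h1 h2 a1 a2 : has_integral h1 a1 -> has_integral h2 a2 ->
  has_integral (fun t => h1 t + h2 t) (a1 + a2).
Proof.
move=> [i1 <-] [i2 <-]; split; last by rewrite RintegralD.
exact: (integrableD mV i1 i2).
Qed.

Lemma has_integralZ c h a : has_integral h a ->
  has_integral (fun t => c * h t) (c * a).
Proof.
move=> [i1 <-]; split; last by rewrite RintegralZl.
exact: (integrableZl mV c i1).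
Qed.

Lemma has_integral_sum (I : Type) (s : seq I) (c : I -> R) h a :
  (forall i, has_integral (h i) (a i)) ->
  has_integral (fun t => \sum_(i <- s) c i * h i t) (\sum_(i <- s) c i * a i).
Proof.
move=> H; elim: s => [|i s IH].
  rewrite big_nil (_ : (fun _ => _) = cst 0); last first.
    by apply/funext => t; rewrite big_nil.
  split; first exact: integrable0.
  by rewrite /Rintegral integral0.
rewrite big_cons (_ : (fun _ => _) =
  (fun t => c i * h i t + \sum_(j <- s) c j * h j t)); last first.
  by apply/funext => t; rewrite big_cons.
by apply: has_integralD => //; exact: has_integralZ.
Qed.

Lemma has_integral_le h1 h2 a1 a2 : has_integral h1 a1 -> has_integral h2 a2 ->
  (forall t, V t -> h1 t <= h2 t) -> a1 <= a2.
Proof. by move=> [i1 <-] [i2 <-] h12; exact: le_Rintegral. Qed.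

Lemma has_integral_ext h1 h2 a : (forall t, V t -> h1 t = h2 t) ->
  has_integral h1 a -> has_integral h2 a.
Proof.
move=> E [i1 <-]; split.
  by apply: eq_integrable i1 => // t /set_mem Vt; rewrite /= E.
by apply: eq_Rintegral => t /set_mem Vt; rewrite E.
Qed.

Lemma has_integral_restrict h : L.-integrable Theta0 (EFin \o h) ->
  (forall t, Theta0 t -> ~ V t -> h t = 0) ->
  has_integral h (\int[L]_(t in Theta0) h t).
Proof.
move=> ih h0; split; first by apply: integrableS ih => //; exact: subIsetl.
rewrite Rintegral_mkcond [RHS]Rintegral_mkcond; congr Rintegral.
apply/funext => t; rewrite !patchE; case: ifPn => [/set_mem [tT _]|nV].
  by rewrite mem_set.
case: ifPn => // /set_mem tT; rewrite h0// => Vt.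
by move/negP : nV; apply; rewrite inE.
Qed.

Lemma notV_q t : Theta0 t -> ~ V t -> q t = 0.
Proof.
move=> tT nV; apply/eqP; rewrite eq_le q0// andbT leNgt; apply/negP => qt.
exact: nV.
Qed.

Lemma has_integral_prior h : measurable_fun Theta0 h ->
  Q.-integrable Theta0 (EFin \o h) ->
  has_integral (fun t => h t * q t) (\int[Q]_(t in Theta0) h t).
Proof.
move=> mh ih; rewrite (Rintegral_density mT densq mh).
apply: has_integral_restrict; first exact: (proj1 (integrable_prior mh) ih).
by move=> t tT nV; rewrite notV_q// mulr0.
Qed.

Lemma prior_infoE i j t : V t ->
  prior_info_integrand q t i j = (q t)^-1 *
    ('D_(delta_mx i ord0) q t * 'D_(delta_mx j ord0) q t).
Proof.
move=> [_ /= qt]; rewrite /prior_info_integrand qt mxE mxE big_ord1 !mxE.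
by [].
Qed.

Lemma has_integral_prior_info i j :
  has_integral (fun t => prior_info_integrand q t i j) (prior_info Theta0 q i j).
Proof.
rewrite mxE; apply: has_integral_restrict; first exact: intinfo.
move=> t tT nV; by rewrite /prior_info_integrand notV_q// ltxx mxE.
Qed.

Lemma has_integral_fisher i j :
  has_integral (fun t => info t i j * q t) (mx_integral Q Theta0 info i j).
Proof.
rewrite mxE; apply: has_integral_prior; first exact: (measurable_fisher_info oT dens hell i j).
apply/(integrable_prior (measurable_fisher_info oT dens hell i j)).2.
exact: integrable_fisher_info.
Qed.

Definition total_info := prior_info Theta0 q + mx_integral Q Theta0 info.

Lemma mx_quadraticE n (A : 'M[R]_n) (v : 'cV[R]_n) :
  (v^T *m A *m v) ord0 ord0 = \sum_i v i ord0 * \sum_j v j ord0 * A i j.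
Proof.
rewrite -mulmxA mxE; apply: eq_bigr => i _; rewrite !mxE; congr (_ * _).
by apply: eq_bigr => j _; rewrite mulrC.
Qed.

Lemma has_integral_total_info (v : 'cV[R]_d) : has_integral
  (fun t => (v^T *m info t *m v) ord0 ord0 * q t +
    (q t)^-1 * (\sum_i v i ord0 * 'D_(delta_mx i ord0) q t) ^+ 2)
  ((v^T *m total_info *m v) ord0 ord0).
Proof.
have := has_integral_sum (index_enum 'I_d) (fun i => v i ord0) (fun i =>
  has_integral_sum (index_enum 'I_d) (fun j => v j ord0) (fun j =>
    has_integralD (has_integral_prior_info i j) (has_integral_fisher i j))).
rewrite (_ : \sum_(i <- _) _ = (v^T *m total_info *m v) ord0 ord0); last first.
  rewrite mx_quadraticE; apply: eq_bigr => i _; congr (_ * _).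
  by apply: eq_bigr => j _; congr (_ * _); rewrite /total_info [RHS]mxE.
apply: has_integral_ext => t Vt.
transitivity (q t * (\sum_i v i ord0 * \sum_j v j ord0 * info t i j) + (q t)^-1 *
    (\sum_i v i ord0 * \sum_j v j ord0 *
       ('D_(delta_mx i ord0) q t * 'D_(delta_mx j ord0) q t))); last first.
  rewrite mulrC -mx_quadraticE; congr (_ + _ * _).
  rewrite expr2 mulr_suml; apply: eq_bigr => i _.
  by rewrite mulr_sumr [RHS]mulr_sumr; apply: eq_bigr => j _; ring.
rewrite !mulr_sumr -big_split/=; apply: eq_bigr => i _.
rewrite !mulr_sumr -big_split/=; apply: eq_bigr => j _.
by rewrite prior_infoE//; ring.
Qed.

Section linear_functional.
Variables (psi phi : 'cV[R]_d -> 'cV[R]_k) (N : 'cV[R]_k -> R).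
Variables (T : X -> 'cV[R]_k) (u : 'cV[R]_k) (r delta2 : R).
Hypotheses (mpsi : measurable_fun Theta0 psi) (mTX : measurable_fun setT T).
Hypothesis acphi : forall j, abs_continuous_on Theta0 (fun t => phi t j ord0).
Hypotheses (normN : is_norm N) (u1 : dual_norm N u <= 1) (r0 : 0 <= r).
Hypothesis risk : forall t, Theta0 t ->
  (\int[P t]_x (N (T x - psi t) ^+ 2)%:E <= r%:E)%E.
Hypothesis approx :
  (\int[Q]_(t in Theta0) (N (psi t - phi t) ^+ 2)%:E = delta2%:E)%E.
Hypothesis gradint :
  Q.-integrable Theta0 (fun t => (op_norm N (vgradient phi t))%:E).
Hypothesis boundary : forall (b : 'cV[R]_d) (i : 'I_d),
    (closure Theta0 `\` Theta0) b ->
    q (b + s *: delta_mx i ord0)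
      @[s --> within [set s : R | Theta0 (b + s *: delta_mx i ord0)] (nbhs 0)]
      --> (0 : R).
Hypothesis supported : Q Theta0 = 1%E.

Let S x : R := (u^T *m T x) ord0 ord0.
Let f t : R := (u^T *m psi t) ord0 ord0.
Let g t := \sum_j u j ord0 * phi t j ord0.
Let m := mean nu p S.
Let dg (i : 'I_d) (t : 'cV[R]_d) : R := \sum_j u j ord0 * 'D_(delta_mx i ord0) (fun t => phi t j ord0) t.

Lemma linear_form_sqr_le x : (u^T *m x) ord0 ord0 ^+ 2 <= N x ^+ 2.
Proof.
have h1 := dual_norm_le normN x u1; have h2 := dual_norm_le normN (- x) u1.
rewrite (norm_opp normN) mulmxN mxE in h2; have := norm_ge0 normN x; nra.
Qed.

Lemma measurable_linear_form dS (Y : measurableType dS) (D : set Y)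
    (h : Y -> 'cV[R]_k) : measurable_fun D h ->
  measurable_fun D (fun y => (u^T *m h y) ord0 ord0).
Proof.
move=> mh; rewrite (_ : (fun y => _) = (fun y => \sum_j u j ord0 * h y j ord0)).
  apply: measurable_sum => j; apply: measurable_funM => //.
  exact: measurableT_comp (measurable_mx_coord j ord0) mh.
by apply/funext => y; rewrite mxE; apply: eq_bigr => j _; rewrite mxE.
Qed.

Lemma measurable_S : measurable_fun setT S.
Proof. exact: measurable_linear_form. Qed.

Lemma measurable_f : measurable_fun Theta0 f.
Proof. exact: measurable_linear_form. Qed.

Lemma gE t : g t = (u^T *m phi t) ord0 ord0.
Proof. by rewrite mxE; apply: eq_bigr => j _; rewrite mxE. Qed.

Lemma measurable_mxB dS (Y : measurableType dS) (D : set Y)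
    (h1 h2 : Y -> 'cV[R]_k) : measurable D ->
  measurable_fun D h1 -> measurable_fun D h2 ->
  measurable_fun D (fun y => N (h1 y - h2 y) ^+ 2).
Proof.
move=> mD m1 m2; apply: measurable_funX.
apply/(measurable_restrictT _ mD).
have mr (h : Y -> 'cV[R]_k) j : measurable_fun D h ->
    measurable_fun setT ((fun y => h y j ord0) \_ D).
  move=> mh; apply/(measurable_restrictT _ mD).
  exact: measurableT_comp (measurable_mx_coord j ord0) mh.
rewrite (_ : _ \_ D = (fun y => N (\col_j (((fun y => h1 y j ord0) \_ D) y -
   ((fun y => h2 y j ord0) \_ D) y)))).
  apply: (measurableT_comp (measurable_norm normN)).
  apply: measurable_fun_mxP => i j; rewrite ord1.
  have := measurable_funB (mr h1 i m1) (mr h2 i m2).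
  by apply: eq_measurable_fun => y _; rewrite mxE.
apply/funext => y; rewrite patchE; case: ifPn => yD.
  by congr N; apply/colP => j; rewrite !mxE !patchE yD.
rewrite (_ : \col_j _ = 0) ?(norm0 normN)//.
by apply/colP => j; rewrite !mxE !patchE (negPf yD) subrr.
Qed.

Lemma linear_risk t : Theta0 t -> (\int[P t]_x ((S x - f t) ^+ 2)%:E <= r%:E)%E.
Proof.
move=> tT; apply: le_trans (risk tT); apply: ge0_le_integral => //.
- by move=> x _; rewrite lee_fin sqr_ge0.
- apply/measurable_EFinP; apply: measurable_funX.
  by apply: measurable_funB => //; exact: measurable_S.
- apply/measurable_EFinP.
  exact: (measurable_mxB measurableT mTX (measurable_cst (psi t))).
- move=> x _; rewrite lee_fin /S /f.
  rewrite -[X in X ^+ 2 <= _](_ : (u^T *m (T x - psi t)) ord0 ord0 = _).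
    exact: linear_form_sqr_le.
  by rewrite mulmxBr [LHS]mxE [X in _ + X = _]mxE.
Qed.

Lemma sqr_bias_le t : Theta0 t -> (m t - f t) ^+ 2 <= r.
Proof.
move=> tT; have := variance_le dens measurable_S linear_risk tT.
have := ip_ge0 nu (fun x => (S x - m t) * sqrt_density p t x).
by rewrite -/m; lra.
Qed.

Lemma mean_derivableE v t : Theta0 t ->
  derivable m t v /\ 'D_v m t = mean_derivative nu p xi S v t.
Proof. exact: (mean_derivable oT dens hell measurable_S linear_risk). Qed.

Lemma line_continuous_mean : line_continuous Theta0 m.
Proof.
move=> t tT i; rewrite /prop_for /continuous_at /= scale0r addr0.
have H := mean_increment oT dens hell measurable_S linear_risk
  (delta_mx i ord0) tT ltr01.
set D := mean_derivative _ _ _ _ _ _ in H.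
have D0 : 0 < 1 + `|D| by have := normr_ge0 D; lra.
apply/cvgrPdist_le => e e0; near=> s.
have h1 : `|m (t + s *: delta_mx i ord0) - m t - s * D| <= 1 * `|s|.
  by near: s; exact: H.
have h2 : `|s| <= e / (1 + `|D|).
  by near: s; apply: (@nbhs0_le _ R); exact: divr_gt0.
rewrite ler_pdivlMr// in h2; rewrite distrC.
have := ler_normD (m (t + s *: delta_mx i ord0) - m t - s * D) (s * D).
by rewrite subrK normrM => /le_trans; apply; lra.
Unshelve. all: by end_near. Qed.

Lemma mean_derivative_le v t : Theta0 t ->
  ('D_v m t) ^+ 2 <= (r - (m t - f t) ^+ 2) * (v^T *m info t *m v) ord0 ord0.
Proof.
move=> tT; have [_ ->] := mean_derivableE v tT.
exact: (information_inequality dens hell measurable_S linear_risk).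
Qed.

Lemma fisher_info_delta (i : 'I_d) t : Theta0 t ->
  ((delta_mx i ord0 : 'cV[R]_d)^T *m info t *m (delta_mx i ord0 : 'cV[R]_d)) ord0 ord0 = info t i i.
Proof. by move=> _; rewrite trmx_delta -rowE -colE !mxE. Qed.

Lemma partial_mean_le i t : Theta0 t ->
  `|'D_(delta_mx i ord0) m t| <= r + info t i i.
Proof.
move=> tT; have := mean_derivative_le (delta_mx i ord0) tT.
rewrite fisher_info_delta//; have := fisher_info_diag_ge0 t i.
have := sqr_ge0 (m t - f t); have := normr_ge0 ('D_(delta_mx i ord0) m t).
rewrite -(real_normK (num_real ('D__ m t))).
move: ((m t - f t) ^+ 2) (`|_|) (info t i i) => h a I a0 h0 I0 le_a.
have rI : 0 <= r * I by exact: mulr_ge0.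
have hI : 0 <= h * I by exact: mulr_ge0.
rewrite -ler_sqr ?nnegrE ?addr_ge0//; have := sqr_ge0 r; have := sqr_ge0 I; nra.
Qed.

Lemma measurable_partial_phi i j : measurable_fun Theta0
  (fun t => 'D_(delta_mx i ord0) (fun t => phi t j ord0) t).
Proof.
apply: measurable_partial_derivative => //.
exact: abs_continuous_on_line_continuous.
Qed.

Lemma measurable_dg i : measurable_fun Theta0 (dg i).
Proof.
apply: measurable_sum => j; apply: measurable_funM => //.
exact: measurable_partial_phi.
Qed.

Lemma has_integral_partial_phi i j :
  has_integral (fun t => 'D_(delta_mx i ord0) (fun t => phi t j ord0) t * q t)
    (mx_integral Q Theta0 (vgradient phi) i j).
Proof.
rewrite mxE (_ : \int[Q]_(t in Theta0) vgradient phi t i j =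
  \int[Q]_(t in Theta0) 'D_(delta_mx i ord0) (fun t => phi t j ord0) t).
  apply: has_integral_prior; first exact: measurable_partial_phi.
  have [C C0 HC] := op_norm_coord normN.
  apply: le_integrable (integrableZl mT C gradint) => //.
    by apply/measurable_EFinP; exact: measurable_partial_phi.
  move=> t tT; rewrite /= lee_fin; apply: le_trans (ler_norm _).
  by have := HC _ (vgradient phi t) i j; rewrite !mxE.
by apply: eq_Rintegral => t _; rewrite !mxE.
Qed.

Lemma has_integral_dg i : has_integral (fun t => dg i t * q t)
  ((mx_integral Q Theta0 (vgradient phi) *m u) i ord0).
Proof.
have := has_integral_sum (index_enum 'I_k) (fun j => u j ord0)
  (fun j => has_integral_partial_phi i j).
rewrite (_ : \sum_(_ <- _) _ = (mx_integral Q Theta0 (vgradient phi) *m u) i ord0).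
  apply: has_integral_ext => t _; rewrite /dg mulr_suml.
  by apply: eq_bigr => j _; rewrite mulrA.
by rewrite mxE; apply: eq_bigr => j _; rewrite mulrC.
Qed.


Lemma integrable_approx : Q.-integrable Theta0
  (EFin \o (fun t => N (psi t - phi t) ^+ 2)).
Proof.
apply/integrableP; split.
  apply/measurable_EFinP; apply: measurable_mxB => //.
  apply/(measurable_restrictT _ mT); apply: measurable_fun_mxP => j l; rewrite ord1.
  have /(measurable_restrictT _ mT) := line_continuous_measurable_on oT
    (abs_continuous_on_line_continuous oT (acphi j)).
  by apply: eq_measurable_fun => t _; rewrite !patchE; case: ifP => // _; rewrite mxE.
rewrite (eq_integral (fun t => (N (psi t - phi t) ^+ 2)%:E)); first by rewrite approx ltry.
by move=> t _; rewrite /= ger0_norm ?sqr_ge0.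
Qed.

Lemma measurable_g : measurable_fun Theta0 g.
Proof.
apply: (line_continuous_measurable_on oT).
exact: abs_continuous_on_line_continuous (abs_continuous_linear_form u acphi).
Qed.

Lemma measurable_m : measurable_fun Theta0 m.
Proof. exact: line_continuous_measurable_on line_continuous_mean. Qed.

Lemma sqr_fg_le t : (f t - g t) ^+ 2 <= N (psi t - phi t) ^+ 2.
Proof.
rewrite gE /f.
rewrite -[X in X ^+ 2 <= _](_ : (u^T *m (psi t - phi t)) ord0 ord0 = _).
  exact: linear_form_sqr_le.
by rewrite mulmxBr [LHS]mxE [X in _ + X = _]mxE.
Qed.

Lemma integrable_sqr_fg : Q.-integrable Theta0 (EFin \o (fun t => (f t - g t) ^+ 2)).
Proof.
apply: le_integrable integrable_approx => //.
  apply/measurable_EFinP; apply: measurable_funX.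
  by apply: measurable_funB; [exact: measurable_f|exact: measurable_g].
by move=> t tT; rewrite /= lee_fin !ger0_norm ?sqr_ge0// sqr_fg_le.
Qed.

Lemma has_integral_sqr_fg : exists2 a, a <= delta2 &
  has_integral (fun t => (f t - g t) ^+ 2 * q t) a.
Proof.
exists (\int[Q]_(t in Theta0) (f t - g t) ^+ 2).
  have -> : delta2 = \int[Q]_(t in Theta0) (N (psi t - phi t) ^+ 2).
    by rewrite /Rintegral approx.
  apply: le_Rintegral => //; [exact: integrable_sqr_fg|exact: integrable_approx|].
  by move=> t _; exact: sqr_fg_le.
apply: has_integral_prior integrable_sqr_fg; apply: measurable_funX.
by apply: measurable_funB; [exact: measurable_f|exact: measurable_g].
Qed.

Lemma has_integral_q : has_integral q 1.
Proof.
have mc : measurable_fun Theta0 (cst 1 : 'cV[R]_d -> R) by exact: measurable_cst.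
have ic : Q.-integrable Theta0 (EFin \o cst 1).
  apply: (integrableS measurableT mT (@subsetT _ _)).
  exact: finite_measure_integrable_cst.
have := has_integral_prior mc ic.
rewrite /Rintegral (eq_integral (cst 1%E))// integral_cst// mul1e /=.
have /= -> := supported; rewrite /=.
by apply: has_integral_ext => t _; rewrite mul1r.
Qed.

Let F i t := ('D_(delta_mx i ord0) m t - dg i t) * q t +
  (m t - g t) * 'D_(delta_mx i ord0) q t.

Lemma has_integral_line i : has_integral (F i) 0.
Proof.
have mdq : measurable_fun Theta0 (fun t => 'D_(delta_mx i ord0) q t).
  apply: measurable_partial_derivative => //.
  exact: abs_continuous_on_line_continuous.
have mdm : measurable_fun Theta0 (fun t => 'D_(delta_mx i ord0) m t).
  by apply: measurable_partial_derivative => //; exact: line_continuous_mean.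
have sV : V `<=` Theta0 by exact: subIsetl.
have mVf (h : 'cV[R]_d -> R) : measurable_fun Theta0 h -> measurable_fun V h.
  by move=> mh; exact: measurable_funS mT sV mh.
have [a _ hfg] := has_integral_sqr_fg.
have hI := has_integral_fisher i i.
have hq := has_integral_q.
pose w t := r + info t i i.
have iw : L.-integrable V (EFin \o (fun t => w t * q t)).
  have [+ _] := has_integralD (has_integralZ r hq) hI.
  by apply: eq_integrable => // t _; rewrite /= /w mulrDl.
have idg : L.-integrable V (EFin \o (fun t => `|dg i t| * q t)).
  have [ig _] := has_integral_dg i.
  apply: le_integrable (ig) => //.
    apply/measurable_EFinP; apply: measurable_funM; last exact: mVf.
    by apply: measurableT_comp => //; apply: mVf; exact: measurable_dg.
  by move=> t _; rewrite /= lee_fin !normrM normr_id.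
have ib : L.-integrable V
    (EFin \o (fun t => `|(m t - g t) * 'D_(delta_mx i ord0) q t|)).
  have [+ _] := has_integralD (has_integralD (has_integralZ (2 * r) hq)
    (has_integralZ 2 hfg)) (has_integral_prior_info i i).
  apply: le_integrable => //.
    apply/measurable_EFinP; apply: measurableT_comp => //.
    apply: measurable_funM; last exact: mVf.
    by apply: mVf; apply: measurable_funB; [exact: measurable_m|exact: measurable_g].
  move=> t Vt; rewrite /= lee_fin normr_id; apply: le_trans (ler_norm _).
  rewrite prior_infoE//; have [tT /= qt] := Vt.
  have := sqr_bias_le tT; rewrite normrM.
  have := normr_ge0 (m t - g t); have := real_normK (num_real (m t - g t)).
  have := normr_ge0 ('D_(delta_mx i ord0) q t).
  have := real_normK (num_real ('D_(delta_mx i ord0) q t)).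
  rewrite -expr2.
  move: ('D_(delta_mx i ord0) q t) (`|'D__ q t|) => x ax <- ax0.
  move: (`|_|) => b bE b0 h.
  have b2 : b ^+ 2 <= 2 * r + 2 * (f t - g t) ^+ 2.
    by rewrite bE; have := sqr_ge0 (m t - f t - (f t - g t)); nra.
  apply: (@le_trans _ _ (b ^+ 2 * q t + (q t)^-1 * ax ^+ 2)).
    have qV : (q t)^-1 * q t = 1 by rewrite mulVf ?gt_eqF.
    have qi : 0 < (q t)^-1 by rewrite invr_gt0.
    move: (q t)^-1 qV qi => k1 qV qi.
    have := sqr_ge0 (b * q t - ax); have := mulr_ge0 b0 ax0.
    move=> ba sq; have : 0 <= k1 * (b * q t - ax) ^+ 2 by rewrite mulr_ge0// ltW.
    have -> : k1 * (b * q t - ax) ^+ 2 =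
        b ^+ 2 * q t * (k1 * q t) - 2 * (b * ax) * (k1 * q t) + k1 * ax ^+ 2 by ring.
    by rewrite qV; lra.
  by have := ler_wpM2r (ltW qt) b2; lra.
have iG : L.-integrable V (EFin \o (fun t => q t + w t * q t + `|dg i t| * q t +
    `|(m t - g t) * 'D_(delta_mx i ord0) q t|)).
  have [iq _] := hq.
  exact: (integrableD mV (integrableD mV (integrableD mV iq iw) idg) ib).
have mw : measurable_fun Theta0 w.
  by apply: measurable_funD => //; exact: (measurable_fisher_info oT dens hell).
have w0 t : 0 <= w t by rewrite addr_ge0// fisher_info_diag_ge0.
have mF : measurable_fun V (F i).
  apply: mVf; apply: measurable_funD; apply: measurable_funM => //.
    by apply: measurable_funB => //; exact: measurable_dg.
  by apply: measurable_funB; [exact: measurable_m|exact: measurable_g].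
have dm t : Theta0 t -> derivable m t (delta_mx i ord0) /\
    `|'D_(delta_mx i ord0) m t| <= w t.
  by move=> tT; have [dmt _] := mean_derivableE (delta_mx i ord0) tT; split => //;
     exact: partial_mean_le.
have acg := abs_continuous_linear_form u acphi.
have I0 := coordinate_integration_by_parts oT q0 acq
  (abs_continuous_on_line_continuous oT acg) (fun b => @boundary b i)
  (fun c x y => @abs_continuous_on_segment R d Theta0 g i oT acg c x y)
  line_continuous_mean dm w0 mw (measurable_dg i)
  (ae_derive_linear_form u oT acphi i) iG.
split; last by rewrite /Rintegral I0.
apply: le_integrable iG => //; first exact/measurable_EFinP.
move=> t Vt; have [tT /= qt] := Vt; have [_ dmw] := dm t tT.
rewrite /= lee_fin; apply: le_trans (ler_norm _); apply: (le_trans (ler_normD _ _)).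
rewrite lerD2r normrM (gtr0_norm qt).
apply: (@le_trans _ _ ((w t + `|dg i t|) * q t)).
  rewrite ler_wpM2r ?(ltW qt)//; apply: (le_trans (ler_normB _ _)).
  by rewrite lerD2r.
by rewrite mulrDl -addrA lerDr ltW.
Qed.


Lemma amgm_le (l a b x : R) : 0 < l -> 0 <= a -> 0 <= b -> x ^+ 2 <= a * b ->
  x <= l / 2 * a + (2 * l)^-1 * b.
Proof.
move=> l0 a0 b0 xab.
have -> : (2 * l)^-1 * b = b / l / 2 by field; lra.
have bl0 : 0 <= b / l by rewrite divr_ge0// ltW.
have E : b = l * (b / l) by field; lra.
move: xab bl0; rewrite [in X in _ <= X]E; move: (b / l) => c xac c0.
have lac : 0 <= l * a + c by rewrite addr_ge0// mulr_ge0// ltW.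
have s4 : (2 * x) ^+ 2 <= (l * a + c) ^+ 2.
  by have := sqr_ge0 (l * a - c); nra.
have := ler_norm (2 * x).
have : `|2 * x| <= l * a + c by rewrite -ler_sqr ?nnegrE// real_normK ?num_real.
lra.
Qed.

Lemma fisher_quadratic_ge0 (v : 'cV[R]_d) t : Theta0 t ->
  0 <= (v^T *m info t *m v) ord0 ord0.
Proof. by move=> tT; rewrite (fisher_info_quadratic hell)// mulr_ge0// ip_ge0. Qed.

Lemma parametric_bound (v : 'cV[R]_d) (l mu : R) : 0 < l -> 0 < mu ->
  (v^T *m (mx_integral Q Theta0 (vgradient phi) *m u)) ord0 ord0 <=
  l / 2 * r + mu / 2 * delta2 +
    ((2 * l)^-1 + (2 * mu)^-1) * (v^T *m total_info *m v) ord0 ord0.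
Proof.
move=> l0 mu0; set c := (2 * l)^-1 + (2 * mu)^-1.
have h1 := has_integral_sum (index_enum 'I_d) (fun i => v i ord0) has_integral_dg.
have [a ad hfg] := has_integral_sqr_fg.
have hF := has_integral_sum (index_enum 'I_d) (fun i => v i ord0) has_integral_line.
have h2 := has_integralD (has_integralD (has_integralD
  (has_integralZ (l / 2 * r) has_integral_q) (has_integralZ (mu / 2) hfg))
  (has_integralZ c (has_integral_total_info v))) (has_integralZ (-1) hF).
have le12 := has_integral_le h1 h2.
apply: (@le_trans _ _ (l / 2 * r * 1 + mu / 2 * a +
  c * (v^T *m total_info *m v) ord0 ord0 + -1 * (\sum_i v i ord0 * 0))).
  rewrite (_ : (v^T *m _) ord0 ord0 = \sum_i v i ord0 *
      (mx_integral Q Theta0 (vgradient phi) *m u) i ord0); last first.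
    by rewrite mxE; apply: eq_bigr => i _; rewrite mxE.
  apply: le12 => t Vt; have [tT /= qt] := Vt.
  set A := 'D_v m t.
  have AE : \sum_i v i ord0 * 'D_(delta_mx i ord0) m t = A.
    rewrite /A; have [_ ->] := mean_derivableE v tT.
    rewrite (mean_derivative_sum dens hell measurable_S linear_risk)//.
    by apply: eq_bigr => i _; have [_ ->] := mean_derivableE (delta_mx i ord0) tT.
  set B := \sum_i v i ord0 * 'D_(delta_mx i ord0) q t.
  set G := \sum_i v i ord0 * (dg i t * q t).
  have -> : \sum_i v i ord0 * F i t = A * q t - G + (m t - g t) * B.
    rewrite -AE /B /G mulr_suml mulr_sumr -sumrB -big_split/=.
    by apply: eq_bigr => i _; rewrite /F; ring.
  have A2 := mean_derivative_le v tT; rewrite -/A in A2.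
  have I0 := fisher_quadratic_ge0 v tT.
  move: (_ *m _ *m v) A2 I0 => I A2 I0.
  have xr : 0 <= r - (m t - f t) ^+ 2 by rewrite subr_ge0 sqr_bias_le.
  pose b := B / q t.
  have BE : B = b * q t by rewrite /b divfK// gt_eqF.
  have -> : (q t)^-1 * B ^+ 2 = b ^+ 2 * q t by rewrite BE; field; lra.
  rewrite BE.
  have a1 := amgm_le l0 xr I0 A2.
  have a2 : (m t - f t) * b <= l / 2 * (m t - f t) ^+ 2 + (2 * l)^-1 * b ^+ 2.
    by apply: amgm_le; rewrite ?sqr_ge0// exprMn.
  have a3 : (f t - g t) * b <= mu / 2 * (f t - g t) ^+ 2 + (2 * mu)^-1 * b ^+ 2.
    by apply: amgm_le; rewrite ?sqr_ge0// exprMn.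
  have a4 : 0 <= (2 * mu)^-1 * I ord0 ord0.
    by rewrite mulr_ge0// invr_ge0 mulr_ge0// ltW.
  suff : A + (m t - g t) * b <= l / 2 * r + mu / 2 * (f t - g t) ^+ 2 +
      c * (I ord0 ord0 + b ^+ 2).
    by move=> /(ler_wpM2r (ltW qt)); lra.
  by rewrite /c; lra.
rewrite big1 ?mulr0 ?addr0 ?mulr1; last by move=> i _; rewrite mulr0.
rewrite lerD2r lerD2l ler_wpM2l// divr_ge0// ltW//.
Qed.

Hypothesis posdef_prior : posdefmx (prior_info Theta0 q).

Lemma total_info_unit : total_info \in unitmx.
Proof.
rewrite -row_free_unit -kermx_eq0; apply/rowV0P => w /sub_kermxP wM.
have [_ pos] := posdef_prior.
rewrite -[w]trmxK in wM *; move: (w^T) wM => z zM {w}.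
apply/eqP; rewrite trmx_eq0; apply: contraT => /pos pos_z.
have q1 : 0 <= (z^T *m mx_integral Q Theta0 info *m z) ord0 ord0.
  have := has_integral_sum (index_enum 'I_d) (fun i => z i ord0) (fun i =>
    has_integral_sum (index_enum 'I_d) (fun j => z j ord0) (has_integral_fisher i)).
  have h0 := has_integralZ 0 has_integral_q.
  move=> /(has_integral_le h0); rewrite mul0r mx_quadraticE; apply => t [tT /= qt].
  rewrite mul0r; have := mulr_ge0 (fisher_quadratic_ge0 z tT) (ltW qt).
  rewrite mx_quadraticE mulr_suml; congr (_ <= _); apply: eq_bigr => i _.
  by rewrite -mulrA mulr_suml; congr (_ * _); apply: eq_bigr => j _; rewrite mulrA.
have := congr1 (fun A : 'rV[R]_d => (A *m z) ord0 ord0) zM.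
rewrite mulmxDr mulmxDl mxE mul0mx [RHS]mxE => E; clear zM; lra.
Qed.

Lemma sqrt_le_of_parametric (c : R) : 0 <= delta2 -> 0 < c ->
  (forall l mu, 0 < l -> 0 < mu ->
    c <= l / 2 * r + mu / 2 * delta2 + ((2 * l)^-1 + (2 * mu)^-1) * c) ->
  Num.sqrt c <= Num.sqrt r + Num.sqrt delta2.
Proof.
move=> d0 c0 H; set s := Num.sqrt c.
have s0 : 0 < s by rewrite sqrtr_gt0.
have cE : c = s ^+ 2 by rewrite sqr_sqrtr// ltW.
have rE : r = Num.sqrt r ^+ 2 by rewrite sqr_sqrtr.
have dE : delta2 = Num.sqrt delta2 ^+ 2 by rewrite sqr_sqrtr.
have := sqrtr_ge0 r; have := sqrtr_ge0 delta2.
move: (Num.sqrt r) (Num.sqrt delta2) rE dE => x y rE dE y0 x0.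
apply/ler_addgt0Pr => e e0; pose x' := x + e / 2; pose y' := y + e / 2.
have x'0 : 0 < x' by rewrite /x'; lra.
have y'0 : 0 < y' by rewrite /y'; lra.
have := H _ _ (divr_gt0 s0 x'0) (divr_gt0 s0 y'0).
rewrite cE rE dE.
have -> : s / x' / 2 * x ^+ 2 + s / y' / 2 * y ^+ 2 +
    ((2 * (s / x'))^-1 + (2 * (s / y'))^-1) * s ^+ 2 =
  s * ((x ^+ 2 / x' + x') / 2 + (y ^+ 2 / y' + y') / 2) by field; lra.
rewrite expr2 ler_pM2l// => /le_trans; apply.
have hx : x ^+ 2 / x' <= x' by rewrite ler_pdivrMr// /x'; nra.
have hy : y ^+ 2 / y' <= y' by rewrite ler_pdivrMr// /y'; nra.
by move: hx hy; rewrite /x' /y'; lra.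
Qed.

Lemma l2norm_van_trees_le :
  l2norm (sqrtmx (van_trees_mx Theta0 info phi Q q) *m u) <=
    Num.sqrt r + Num.sqrt delta2.
Proof.
rewrite /van_trees_mx -/total_info; set D := mx_integral Q _ (vgradient phi).
set n := l2norm _; have n0 : 0 <= n by exact: sqrtr_ge0.
have [n00|n2] := l2norm_sqrtmx (D^T *m invmx total_info *m D) u.
  by rewrite /n n00 addr_ge0 ?sqrtr_ge0.
have d0 : 0 <= delta2.
  by rewrite -lee_fin -approx integral_ge0// => t _; rewrite lee_fin sqr_ge0.
rewrite -/n in n2; have [c0|c0] := ltP 0 n; last by rewrite (le_trans c0)// addr_ge0 ?sqrtr_ge0.
rewrite -[n]ger0_norm// -sqrtr_sqr; apply: sqrt_le_of_parametric => //.
  exact: exprn_gt0.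
move=> l mu l0 mu0; pose v := invmx total_info *m (D *m u).
have vD : (v^T *m (D *m u)) ord0 ord0 = n ^+ 2.
  rewrite n2 -[v^T *m _]trmxK [in LHS]mxE trmx_mul trmxK trmx_mul /v !mulmxA.
  by [].
have vM : (v^T *m total_info *m v) ord0 ord0 = n ^+ 2.
  by rewrite -vD -[in LHS]mulmxA /v mulKVmx// total_info_unit.
by have := parametric_bound v l0 mu0; rewrite vD vM.
Qed.

End linear_functional.
End van_trees_inequality.

Lemma van_trees_bound_le (R : realType) (d k : nat)
    (dX : measure_display) (X : measurableType dX)
    (nu : {sigma_finite_measure set X -> \bar R})
    (Theta0 : set 'cV[R]_d)
    (P : 'cV[R]_d -> probability X R)
    (p : 'cV[R]_d -> X -> R)
    (xi : 'cV[R]_d -> X -> 'cV[R]_d)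
    (psi phi : 'cV[R]_d -> 'cV[R]_k)
    (N : 'cV[R]_k -> R)
    (Q : probability 'cV[R]_d R) (q : 'cV[R]_d -> R) (T : X -> 'cV[R]_k) (r : R) :
  let info := fun theta => fisher_info nu (xi theta) in
  open Theta0 ->
  (forall theta, Theta0 theta -> is_density nu setT (P theta) (p theta)) ->
  (forall theta, Theta0 theta -> hellinger_derivative nu p theta (xi theta)) ->
  measurable_fun Theta0 psi ->
  (forall j, abs_continuous_on Theta0 (fun t => phi t j ord0)) ->
  is_norm N -> nice Theta0 info phi N Q q -> measurable_fun setT T -> 0 <= r ->
  (forall t, Theta0 t -> (\int[P t]_x (N (T x - psi t) ^+ 2)%:E <= r%:E)%E) ->
  (van_trees_bound Theta0 info phi N psi Q q <= r%:E)%E.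
Proof.
move=> info oT dens hell mpsi acphi normN nQ mT r0 risk.
rewrite /van_trees_bound.
set s := ereal_sup _; set I := (\int[Q]_(t in Theta0) _)%E.
have I0 : (0 <= I)%E by apply: integral_ge0 => t _; rewrite lee_fin sqr_ge0.
suff sr : (maxe (s - sqrte I) 0 <= (Num.sqrt r)%:E)%E.
  have m0 : (0 <= maxe (s - sqrte I) 0)%E by rewrite le_max lexx orbT.
  rewrite -[r in leRHS]sqr_sqrtr// expr2 EFinM.
  by rewrite expe2; apply: lee_pmul.
rewrite ge_max lee_fin sqrtr_ge0 andbT.
have [I_oo|I_fin] := eqVneq I +oo%E.
  by rewrite I_oo /= addeNy leNye.
have [delta IE] : exists delta : R, I = delta%:E.
  by exists (fine I); rewrite fineK// ge0_fin_numE// ltey.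
rewrite IE (_ : sqrte delta%:E = (Num.sqrt delta)%:E)//.
rewrite leeBlDr// -EFinD; apply: ge_ereal_sup => _ /= [u u1 <-].
rewrite lee_fin; case: nQ => supQ dQ acq iI pI _ gI tI bd.
exact: (l2norm_van_trees_le oT dens hell dQ acq iI tI mpsi mT acphi normN u1 r0
  risk IE gI bd supQ pI).
Qed.

Theorem theorem5 (R : realType) (d k : nat)
    (dX : measure_display) (X : measurableType dX)
    (nu : {sigma_finite_measure set X -> \bar R})
    (Theta0 : set 'cV[R]_d)
    (P : 'cV[R]_d -> probability X R)
    (p : 'cV[R]_d -> X -> R)
    (xi : 'cV[R]_d -> X -> 'cV[R]_d)
    (psi phi : 'cV[R]_d -> 'cV[R]_k)
    (N : 'cV[R]_k -> R) :
  open Theta0 ->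
  (forall theta, Theta0 theta -> is_density nu setT (P theta) (p theta)) ->
  (forall theta, Theta0 theta -> hellinger_derivative nu p theta (xi theta)) ->
  measurable_fun Theta0 psi ->
  (forall j, abs_continuous_on Theta0 (fun t => phi t j ord0)) ->
  is_norm N ->
  let info := fun theta => fisher_info nu (xi theta) in
  (ereal_sup [set van_trees_bound Theta0 info phi N psi Qq.1 Qq.2
               | Qq in [set Qq : probability 'cV[R]_d R * ('cV[R]_d -> R)
                         | nice Theta0 info phi N Qq.1 Qq.2]]
   <= minimax_risk Theta0 P psi N)%E.
Proof.
move=> oT dens hell mpsi acphi normN; cbv zeta.
set info := fun theta => fisher_info nu (xi theta).
apply: ge_ereal_sup => _ /= [[Q q] /= nQ <-].
apply: le_ereal_inf_tmp => _ /= [T mT <-].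
set rho := ereal_sup _.
have risk t : Theta0 t ->
    (\int[P t]_x (N (T x - psi t) ^+ 2)%:E <= rho)%E.
  move=> tT; apply: ereal_sup_ubound; exists t => //.
  by rewrite unlock.
have [t tT] : Theta0 !=set0.
  apply/set0P/eqP => T0; have := nice_supported nQ.
  by rewrite T0 measure0 => /eqP; rewrite eq_sym onee_eq0.
have rho0 : (0 <= rho)%E.
  apply: le_trans (risk t tT); apply: integral_ge0 => x _.
  by rewrite lee_fin sqr_ge0.
have [rho_oo|rho_fin] := eqVneq rho +oo%E; first by rewrite rho_oo leey.
have rhoE : rho = (fine rho)%:E by rewrite fineK// ge0_fin_numE// ltey.
rewrite rhoE; apply: (van_trees_bound_le oT dens hell mpsi acphi normN nQ mT).
  exact: fine_ge0.
by move=> t' t'T; rewrite -rhoE; exact: risk.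
Qed.
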